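(* Let $\sigma:\mathbb{R}_+\to\mathbb{R}_+$ be a Borel function that is bounded on $[0,n]$ for each $n\ge1$ and satisfies $\lambda\{u\in\mathbb{R}_+:\sigma(u)=0\}=0$, and put $\sigma_0(x):=\int_0^x\sigma(y)\,dy$ for $x\ge0$. Let $\mu$ be a finite Borel measure on $\mathbb{R}$ with $\mu(1)>0$ and let $\{X_t:t\ge0\}$ be an interacting super-Brownian motion with branching rate function $\sigma$ and $X_0=\mu$. Let $\hat\tau_0:=\inf\{t\ge0:X_t(1)=0\}$ with $\inf\emptyset=\infty$. (i) If there exists a constant $\gamma_1\in[0,2)$ such that $\liminf_{x\to0+}\sigma_0(x)/x^{\gamma_1}>0$, then $\mathbf{P}\{\hat\tau_0<\infty\}=1$ and ($\mathbf{P}$-a.s.) $X_t(1)=0$ for all large enough $t$. (ii) If there exists a constant $\gamma_2\in[2,\infty)$ such that $\limsup_{x\to0+}\sigma_0(x)/x^{\gamma_2}<\infty$, then $\mathbf{P}\{\hat\tau_0=\infty\}=1$ and ($\mathbf{P}$-a.s.) $X_t(1)>0$ for all $t>0$.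
   Context: Notation: $\mathbb{R}_+=[0,\infty)$; $\lambda$ is Lebesgue measure. $M(\mathbb{R})$ is the space of finite Borel measures on $\mathbb{R}$ with the weak convergence topology; $\mu(f)=\int f\,d\mu$, so $X_t(1)$ is the total mass. $C^2(\mathbb{R})$ is the space of twice continuously differentiable functions bounded together with their derivatives up to order 2. All random elements are defined on a filtered complete probability space satisfying the usual hypotheses. Interacting super-Brownian motion with branching rate function $\sigma$: a continuous $M(\mathbb{R})$-valued process $\{X_t:t\ge0\}$ such that for any $f\in C^2(\mathbb{R})$, $M_t(f):=X_t(f)-X_0(f)-\frac12\int_0^tX_s(f'')ds$, $t\ge0$, is a continuous local martingale with quadratic variation $\langle M(f)\rangle_t=\int_0^tds\int_{\mathbb{R}}\sigma(X_s((-\infty,x]))f(x)^2X_s(dx)$. *)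

(* Defs.v *)
From HB Require Import structures.
From mathcomp Require Import all_boot all_order all_algebra.
From mathcomp Require Import all_classical all_reals all_analysis.

Set Implicit Arguments.
Unset Strict Implicit.
Unset Printing Implicit Defensive.

Import Order.TTheory GRing.Theory Num.Theory.
Import numFieldNormedType.Exports.

Local Open Scope classical_set_scope.
Local Open Scope ring_scope.

(* All processes are indexed by R but only their values at times t >= 0 are
   constrained.  Measurable sets of R are its Borel sets. *)

Definition finite_measureR (R : realType) :=
  {finite_measure set (measurableTypeR R) -> \bar R}.

HB.instance Definition _ (R : realType) := gen_eqMixin (finite_measureR R).
HB.instance Definition _ (R : realType) := gen_choiceMixin (finite_measureR R).

Definition bounded_continuous (R : realType) :=
  {f : R -> R | continuous f /\ [bounded f x | x in [set: R]]}.

HB.instance Definition _ (R : realType) := gen_eqMixin (bounded_continuous R).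

Definition pairing (R : realType) (m : finite_measureR R) :
  {ptws bounded_continuous R -> R} :=
  fun f => \int[m]_x (sval f x).

(* Finite Borel measures on R with the topology of weak convergence: the
   coarsest one making m |-> \int f dm continuous for f bounded continuous. *)
Definition MR (R : realType) := initial_topology (@pairing R).

Definition C2b (R : realType) (f : R -> R) :=
  [/\ (forall x, derivable f x 1),
      (forall x, derivable f^`()%classic x 1),
      continuous f^`(2)%classic &
      [/\ [bounded f x | x in [set: R]],
          [bounded f^`()%classic x | x in [set: R]] &
          [bounded f^`(2)%classic x | x in [set: R]]]].

Section Processes.
Context {R : realType} {d : measure_display} {Omega : measurableType d}.
Variables (P : probability Omega R) (F : R -> set_system Omega).

Definition usual_conditions :=
  [/\ measure_is_complete P,
      (forall t, 0 <= t -> sigma_algebra [set: Omega] (F t) /\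
                           F t `<=` measurable),
      (forall s t, 0 <= s -> s <= t -> F s `<=` F t),
      (forall N, P.-negligible N -> F 0 N) &
      (forall t, 0 <= t -> \bigcap_(s in `]t, +oo[) F s `<=` F t)].

Definition adapted (M : R -> Omega -> R) :=
  forall t, 0 <= t -> forall B : set R, measurable B -> F t (M t @^-1` B).

Definition continuous_paths (T : topologicalType) (Y : R -> Omega -> T) :=
  {ae P, forall w, {within `[0, +oo[, continuous (fun t => Y t w)}}.

Definition stopping_time (tau : Omega -> \bar R) :=
  (forall w, 0 <= tau w)%E /\
  forall t, 0 <= t -> F t [set w | (tau w <= t%:E)%E].

Definition stopped (M : R -> Omega -> R) (tau : Omega -> \bar R) :
  R -> Omega -> R := fun t w => M (fine (mine t%:E (tau w))) w.

(* The last clause is E[M_t | F_s] = M_s a.s., written without conditional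
   expectation. *)
Definition martingale (M : R -> Omega -> R) :=
  [/\ adapted M,
      (forall t, 0 <= t -> P.-integrable [set: Omega] (EFin \o M t)) &
      (forall s t, 0 <= s -> s <= t -> forall A, F s A ->
         (\int[P]_(w in A) (M t w)%:E = \int[P]_(w in A) (M s w)%:E)%E)].

(* Localization is required of M - M 0, so M 0 need not be integrable. *)
Definition continuous_local_martingale (M : R -> Omega -> R) :=
  [/\ adapted M,
      continuous_paths M &
      exists tau : nat -> Omega -> \bar R,
        [/\ (forall n, stopping_time (tau n)),
            {ae P, forall w, nondecreasing_seq (tau ^~ w) /\
                             (tau n w @[n --> \oo] --> +oo%E)} &
            (forall n, martingale (fun t w => stopped M (tau n) t w - M 0 w))]].

(* Q is (a version of) <M>: the continuous adapted nondecreasing process null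
   at 0 that compensates the square of the local martingale M. *)
Definition quadratic_variation (M Q : R -> Omega -> R) :=
  [/\ adapted Q,
      continuous_paths Q,
      {ae P, forall w, Q 0 w = 0 /\
        forall s t, 0 <= s -> s <= t -> Q s w <= Q t w} &
      continuous_local_martingale
        (fun t w => (M t w - M 0 w) ^+ 2 - Q t w)].

Definition ISBM_martingale (X : R -> Omega -> MR R) (f : R -> R) :
  R -> Omega -> R := fun t w =>
  \int[X t w]_x f x - \int[X 0 w]_x f x -
  2^-1 * \int[lebesgue_measure]_(s in `[0, t]) \int[X s w]_x (f^`(2)%classic x).

Definition ISBM_bracket (sigma : R -> R) (X : R -> Omega -> MR R)
    (f : R -> R) : R -> Omega -> R := fun t w =>
  \int[lebesgue_measure]_(s in `[0, t])
    \int[X s w]_x (sigma (fine (X s w `]-oo, x]%classic)) * f x ^+ 2).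

(* Adaptedness is with respect to the Borel sigma-field of MR R, the one
   generated by the weakly open sets. *)
Definition interacting_superBM (sigma : R -> R) (X : R -> Omega -> MR R) :=
  [/\ (forall t, 0 <= t -> forall B : set (MR R), <<s open >> B ->
         F t (X t @^-1` B)),
      continuous_paths X &
      (forall f : R -> R, C2b f ->
         continuous_local_martingale (ISBM_martingale X f) /\
         quadratic_variation (ISBM_martingale X f) (ISBM_bracket sigma X f))].

End Processes.

Section Extinction.
Context {R : realType}.

Definition sigma0 (sigma : R -> R) (x : R) : R :=
  \int[lebesgue_measure]_(y in `[0, x]) sigma y.

Definition extinction_time (Omega : Type) (X : R -> Omega -> MR R)
    (w : Omega) : \bar R :=
  ereal_inf [set t%:E | t in [set t | 0 <= t /\ X t w [set: R] = 0%E]].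

End Extinction.

(* Main.v *)
Require Import Defs.
From mathcomp Require Import all_boot all_order all_algebra.
From mathcomp Require Import all_classical all_reals all_analysis.
From mathcomp Require Import measurable_realfun ring lra.

(* The total mass [U t = X_t(1)] is a continuous local martingale whose quadratic
   variation grows at rate [\int sigma(X_t((-oo, x])) X_t(dx)].  The processes
   [X_t(cos(k x))] and [X_t(sin(k x))] have drift [- k ^ 2 / 2] times themselves, so
   an energy estimate bounds the expectation of their time-integrated squares by
   [C / k ^ 2]; summing over [k], for almost every [t] the Fourier coefficients of
   [X_t] vanish at infinity, and Fejer's kernel shows that [X_t] has no atoms.
   Hence [x |-> X_t((-oo, x])] maps [X_t] to Lebesgue measure on [[0, U t]], and the
   quadratic variation of [U] grows at rate [sigma0 (U t)].

   (i) When [sigma0 x >= c * x ^ gam] with [1 < gam < 2], the function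
   [x ^ (2 - gam)] gives a bound on the mean exit time of [U] from [(a, b)] that
   does not depend on [a]; so [U] vanishes in finite time unless it reaches [b],
   which has probability at most [m / b].
   (ii) When [sigma0 x <= C * x ^ 2], the mean of [- ln U] grows at most linearly
   in time, so [U] does not approach 0 in bounded time.

   Ito's formula is replaced by third-order Taylor sums along time grids, where
   only optional stopping of bounded martingales is needed. *)

Set Implicit Arguments.
Unset Strict Implicit.
Unset Printing Implicit Defensive.

Import Order.TTheory GRing.Theory Num.Theory.
Import numFieldNormedType.Exports.

Local Open Scope classical_set_scope.
Local Open Scope ring_scope.

(** * Taylor inequalities *)

Section TaylorInequalities.
Context {R : realType}.
Implicit Types a b c x y r : R.

(** The bracket samples [sigma] along the distribution function of [X_t]. An atom would be weighted
    by a single value of [sigma], so the equation for [U] closes in terms of [sigma0 (U t)] only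
    once atoms are excluded, and the martingale problem itself has to exclude them. It does so for
    almost every time only; this suffices because the bracket is a time integral. As the inner
    integral is not known to be measurable in time, integrals are compared as suprema over simple
    functions. The threshold 2 is the exponent at which [x ^ 2] balances the second derivative of
    [ln]. In case (i) the exponent can be raised on bounded intervals, so [1 < gam] costs nothing.
    Vanishing once does not by itself give vanishing forever: absorption at 0 is a separate argument
    on the nonnegative local martingale [U]. All estimates are made up to exit times, where the
    processes are bounded. Levels, horizons and frequencies run over countable sets, so that one
    null set serves them all, and processes are replaced by versions with paths regular
    everywhere. *)

Lemma powR_bernoulli b r : 0 <= b <= 1 -> 0 < r -> r `^ b <= 1 + b * (r - 1).
Proof.
move=> /andP[b0 b1] r0; set u := ln r.
have er : r = expR u by rewrite /u lnK.
have -> : r `^ b = expR (b * u) by rewrite /powR gt_eqF.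
have h1 := expR_ge1Dx (u * (1 - b)).
have h2 := expR_ge1Dx (- (u * b)).
(* The tangent bound [1 + x <= expR x] at [- (u * b)] and at [u * (1 - b)], with weights [1 - b] and
   [b] for which the linear terms cancel. *)
have h : 1 <= (1 - b) * expR (- (u * b)) + b * expR (u * (1 - b)).
  have := ler_wpM2l b0 h1.
  have b1' : 0 <= 1 - b by rewrite subr_ge0.
  by have := ler_wpM2l b1' h2; lra.
have e0 : 0 <= expR (b * u) by exact: expR_ge0.
have := ler_wpM2l e0 h; rewrite mulr1 mulrDr.
have -> : expR (b * u) * ((1 - b) * expR (- (u * b))) = 1 - b.
  by rewrite mulrCA -expRD (_ : b * u + _ = 0) ?expR0 ?mulr1//; ring.
have -> : expR (b * u) * (b * expR (u * (1 - b))) = b * r.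
  by rewrite mulrCA -expRD er; congr (_ * expR _); ring.
by move=> /le_trans; apply; lra.
Qed.

(* Squaring Bernoulli's inequality for the square root of [r] produces the second-order term. *)
Lemma powR_taylor2 b r : 0 <= b <= 1 -> 0 < r ->
  r `^ b <= 1 + b * (r - 1) - b * (1 - b) / 6 * (r - 1) ^+ 2 +
    b * (1 - b) / 6 * `|r - 1| ^+ 3.
Proof.
move=> b01 r0; have /andP[b0 b1] := b01.
pose s := Num.sqrt r.
have s0 : 0 < s by rewrite sqrtr_gt0.
have rs : r = s ^+ 2 by rewrite sqr_sqrtr// ltW.
have h1 := powR_bernoulli b01 s0.
have es : r `^ b = (s `^ b) ^+ 2.
  by rewrite rs expr2 powRM ?expr2// ltW.
have sb0 : 0 <= s `^ b by exact: powR_ge0.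
have h2 : r `^ b <= (1 + b * (s - 1)) ^+ 2.
  by rewrite es ler_pXn2r// nnegrE (le_trans sb0).
apply: (le_trans h2); set q := s - 1.
have eq1 : (1 + b * q) ^+ 2 = 1 + b * (r - 1) - b * (1 - b) * q ^+ 2.
  by rewrite rs /q; ring.
rewrite eq1 -lerBrDl.
have k0 : 0 <= b * (1 - b) by rewrite mulr_ge0// subr_ge0.
(* The 6 comes from [(s + 1) ^+ 2 <= 2 * (r + 1) <= 6] when [r <= 2]. When [r > 2], the square of
   [r - 1] is below its cube. *)
suff : (r - 1) ^+ 2 <= 6 * q ^+ 2 + `|r - 1| ^+ 3.
  by move=> /(ler_wpM2l k0); lra.
have er : r - 1 = q * (s + 1) by rewrite rs /q; ring.
case: (leP r 2) => r2.
  have h3 : (s + 1) ^+ 2 <= 6.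
    have : 0 <= (s - 1) ^+ 2 by exact: sqr_ge0.
    by move: r2; rewrite rs; nra.
  rewrite er exprMn mulrC.
  have := ler_wpM2r (sqr_ge0 q) h3.
  have : 0 <= `|q * (s + 1)| ^+ 3 by exact: exprn_ge0.
  by lra.
have : 1 <= `|r - 1| by rewrite ger0_norm; lra.
move=> h1'; have h : `|r - 1| ^+ 2 <= `|r - 1| ^+ 3.
  by rewrite exprS -[leLHS]mul1r ler_wpM2r// ?sqr_ge0// exprn_ge0.
rewrite real_normK ?num_real// in h.
have : 0 <= 6 * q ^+ 2 by rewrite mulr_ge0// sqr_ge0.
by move: h; lra.
Qed.

(** The bound [ln (x / y) <= x / y - 1] is followed by the exact third-order expansion of [x / y] in
    [y - x]. The quadratic coefficient is twice that of the Taylor expansion of [- ln], which only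
    affects a constant. *)
Lemma ln_taylor2 x y : 0 < x -> 0 < y ->
  ln x - ln y <= - x^-1 * (y - x) + (x^-1) ^+ 2 * (y - x) ^+ 2 +
    `|y - x| ^+ 3 / (x ^+ 2 * y).
Proof.
move=> x0 y0.
have h : ln x - ln y <= x / y - 1.
  rewrite -ln_div ?posrE//.
  have := expR_ge1Dx (ln (x / y)).
  by rewrite lnK ?posrE ?divr_gt0// addrC; lra.
apply: (le_trans h).
have -> : x / y - 1 = - x^-1 * (y - x) + (x^-1) ^+ 2 * (y - x) ^+ 2 -
    (y - x) ^+ 3 / (x ^+ 2 * y).
  by field; rewrite !gt_eqF.
have h3 : - (y - x) ^+ 3 <= `|y - x| ^+ 3 by rewrite -normrX -normrN ler_norm.
have i0 : 0 <= (x ^+ 2 * y)^-1 by rewrite invr_ge0 mulr_ge0 ?sqr_ge0// ltW.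
by rewrite lerD2l -mulNr ler_wpM2r.
Qed.

End TaylorInequalities.

(** * Expectations of bounded and integrable variables *)

Section Expectation.
Context {R : realType} {d : measure_display} {Omega : measurableType d}.
Variable P : probability Omega R.
Implicit Types f g : Omega -> R.

Definition intR (f : Omega -> R) := P.-integrable setT (EFin \o f).

(** The bound holds everywhere, so sums, products and powers stay in the class and are integrable.
    Stopped processes take this form. *)
Definition bmf (f : Omega -> R) :=
  measurable_fun setT f /\ exists B, forall w, `|f w| <= B.

Lemma intR_mf f : intR f -> measurable_fun setT f.
Proof. by move=> /measurable_int /measurable_EFinP. Qed.

Lemma intR_le f g : measurable_fun setT f -> (forall w, `|f w| <= g w) ->
  intR g -> intR f.
Proof.
move=> mf fg ig; apply: (@le_integrable _ _ _ P setT _ _ (EFin \o g)) => //.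
  exact/measurable_EFinP.
by move=> x _ /=; rewrite lee_fin (le_trans (fg x))// ler_norm.
Qed.

Lemma intR_ae f g : measurable_fun setT f -> {ae P, forall w, f w = g w} ->
  intR g -> intR f.
Proof.
move=> mf fg /[dup] /intR_mf mg /integrableP[_ ig].
apply/integrableP; split; first exact/measurable_EFinP.
rewrite (ae_eq_integral (fun w => `|(EFin \o g) w|)%E)//.
- by apply: measurableT_comp => //; exact/measurable_EFinP.
- by apply: measurableT_comp => //; exact/measurable_EFinP.
- by apply: filterS fg => w /= ->.
Qed.

Lemma intR_cst c : intR (fun=> c).
Proof. exact: finite_measure_integrable_cst. Qed.

Lemma bmf_int f : bmf f -> intR f.
Proof. by move=> [mf [B fB]]; exact: (intR_le mf fB (intR_cst B)). Qed.

Lemma intRD f g : intR f -> intR g -> intR (fun w => f w + g w).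
Proof. by move=> If Ig; exact: (integrableD measurableT If Ig). Qed.

Lemma intRZ c f : intR f -> intR (fun w => c * f w).
Proof. by move=> If; exact: (integrableZl measurableT c If). Qed.

Lemma intR_sum n (f : 'I_n -> Omega -> R) : (forall i, intR (f i)) ->
  intR (fun w => \sum_(i < n) f i w).
Proof.
elim: n f => [f _|n IH f If].
  by rewrite (_ : (fun _ => _) = fun=> 0); [exact: intR_cst|apply/funext=> w; rewrite big_ord0].
rewrite (_ : (fun _ => _) = fun w => \sum_(i < n) f (widen_ord (leqnSn n) i) w + f ord_max w).
  by apply: intRD => //; apply: IH.
by apply/funext => w; rewrite big_ord_recr.
Qed.

Lemma intR_bM f g : bmf f -> intR g -> intR (fun w => f w * g w).
Proof.
move=> [mf [B fB]] ig.
apply: (@intR_le _ (fun w => `|B| * `|g w|)).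
- by apply: measurable_funM => //; exact: intR_mf.
- by move=> w; rewrite normrM ler_wpM2r// (le_trans (fB w))// ler_norm.
- by apply: intRZ; exact: integrable_norm.
Qed.

Lemma bmf_cst c : bmf (fun=> c).
Proof. by split; [exact: measurable_cst|exists `|c|]. Qed.

Lemma bmfD f g : bmf f -> bmf g -> bmf (fun w => f w + g w).
Proof.
move=> [mf [B fB]] [mg [C gC]]; split; first exact: measurable_funD.
by exists (B + C) => w; rewrite (le_trans (ler_normD _ _))// lerD.
Qed.

Lemma bmfM f g : bmf f -> bmf g -> bmf (fun w => f w * g w).
Proof.
move=> [mf [B fB]] [mg [C gC]]; split; first exact: measurable_funM.
by exists (B * C) => w; rewrite normrM ler_pM.
Qed.

Lemma bmfN f : bmf f -> bmf (fun w => - f w).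
Proof.
move=> [mf [B fB]]; split; first exact: measurable_funN.
by exists B => w; rewrite normrN.
Qed.

Lemma bmfB f g : bmf f -> bmf g -> bmf (fun w => f w - g w).
Proof. by move=> hf hg; apply: bmfD => //; exact: bmfN. Qed.

Lemma bmfX f n : bmf f -> bmf (fun w => f w ^+ n).
Proof.
move=> hf; elim: n => [|n IH].
  by rewrite (_ : (fun _ => _) = fun=> 1); [exact: bmf_cst|apply/funext => w; rewrite expr0].
rewrite (_ : (fun _ => _) = fun w => f w * f w ^+ n); first exact: bmfM.
by apply/funext => w; rewrite exprS.
Qed.

Lemma bmf_norm f : bmf f -> bmf (fun w => `|f w|).
Proof.
move=> [mf [B fB]]; split; first exact: measurableT_comp.
by exists B => w; rewrite normr_id.
Qed.

Lemma bmf_indic A : measurable A -> bmf (\1_A : Omega -> R).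
Proof.
move=> mA; split; first exact: measurable_indic.
by exists 1 => w; rewrite indicE; case: (_ \in _); rewrite ?normr1 ?normr0.
Qed.

Lemma bmf_sum n (f : 'I_n -> Omega -> R) : (forall i, bmf (f i)) ->
  bmf (fun w => \sum_(i < n) f i w).
Proof.
elim: n f => [f _|n IH f If].
  by rewrite (_ : (fun _ => _) = fun=> 0); [exact: bmf_cst|apply/funext=> w; rewrite big_ord0].
rewrite (_ : (fun _ => _) = fun w => \sum_(i < n) f (widen_ord (leqnSn n) i) w + f ord_max w).
  by apply: bmfD => //; apply: IH.
by apply/funext => w; rewrite big_ord_recr.
Qed.

Definition Ex (f : Omega -> R) := \int[P]_w f w.

Lemma ExD f g : intR f -> intR g -> Ex (fun w => f w + g w) = Ex f + Ex g.
Proof. by move=> If Ig; rewrite /Ex RintegralD. Qed.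

Lemma ExB f g : intR f -> intR g -> Ex (fun w => f w - g w) = Ex f - Ex g.
Proof. by move=> If Ig; rewrite /Ex RintegralB. Qed.

Lemma ExZ c f : intR f -> Ex (fun w => c * f w) = c * Ex f.
Proof. by move=> If; rewrite /Ex RintegralZl. Qed.

Lemma Ex_cst c : Ex (fun=> c) = c.
Proof. by rewrite /Ex Rintegral_cst// [X in fine X]probability_setT mulr1. Qed.

Lemma Ex_sum n (f : 'I_n -> Omega -> R) : (forall i, intR (f i)) ->
  Ex (fun w => \sum_(i < n) f i w) = \sum_(i < n) Ex (f i).
Proof.
elim: n f => [f _|n IH f If].
  rewrite (_ : (fun _ => _) = fun=> 0) ?Ex_cst ?big_ord0//.
  by apply/funext=> w; rewrite big_ord0.
rewrite (_ : (fun _ => _) = fun w => \sum_(i < n) f (widen_ord (leqnSn n) i) w + f ord_max w).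
  by rewrite ExD ?IH ?big_ord_recr//; apply: intR_sum.
by apply/funext => w; rewrite big_ord_recr.
Qed.

Lemma Ex_ge0 f : (forall w, 0 <= f w) -> 0 <= Ex f.
Proof. by move=> f0; apply: Rintegral_ge0. Qed.

Lemma Ex_le f g : intR f -> intR g -> (forall w, f w <= g w) -> Ex f <= Ex g.
Proof. by move=> If Ig fg; apply: le_Rintegral. Qed.

Lemma Ex_indic A : measurable A -> Ex (\1_A : Omega -> R) = fine (P A).
Proof.
by move=> mA; rewrite /Ex /Rintegral integral_indic// setIT.
Qed.

Lemma Ex_ae f g : measurable_fun setT f -> measurable_fun setT g ->
  {ae P, forall w, f w = g w} -> Ex f = Ex g.
Proof.
move=> mf mg fg; rewrite /Ex /Rintegral; congr fine.
apply: ae_eq_integral => //; [exact/measurable_EFinP|exact/measurable_EFinP|].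
by apply: filterS fg => w /= ->.
Qed.

Lemma Ex_dct (f_ : nat -> Omega -> R) f g :
  (forall n, measurable_fun setT (f_ n)) -> measurable_fun setT f ->
  {ae P, forall w, f_ n w @[n --> \oo] --> f w} ->
  intR g -> (forall n w, `|f_ n w| <= g w) ->
  intR f /\ Ex (f_ n) @[n --> \oo] --> Ex f.
Proof.
move=> mf_ mf fcv ig fg.
have [If _ cvf] : [/\ P.-integrable setT (EFin \o f),
    (\int[P]_(x in setT) `|(EFin \o f_ n) x - (EFin \o f) x|)%E @[n --> \oo] --> 0%E &
    (\int[P]_(x in setT) (EFin \o f_ n) x)%E @[n --> \oo] --> (\int[P]_(x in setT) (EFin \o f) x)%E].
  apply: (@dominated_convergence _ _ _ P setT _ (fun n => EFin \o f_ n) (EFin \o f) (EFin \o g)) => //.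
  - by move=> n; exact/measurable_EFinP.
  - exact/measurable_EFinP.
  - by apply: filterS fcv => w cw _; apply/cvg_EFin; [near=> n|exact: cw].
  - by apply: aeW => /= w n _; rewrite lee_fin.
split => //.
apply: fine_cvg => /=.
rewrite /Ex /Rintegral fineK//; apply: integrable_fin_num => //.
Unshelve. all: by end_near. Qed.

Lemma Ex_bct (f_ : nat -> Omega -> R) f B :
  (forall n, measurable_fun setT (f_ n)) ->
  (forall w, f_ n w @[n --> \oo] --> f w) ->
  (forall n w, `|f_ n w| <= B) ->
  bmf f /\ Ex (f_ n) @[n --> \oo] --> Ex f.
Proof.
move=> mf_ fcv fB.
have mf : measurable_fun setT f by apply: (measurable_fun_cvg mf_).
have fle w : `|f w| <= B.
  have cn : `|f_ n w| @[n --> \oo] --> `|f w| by apply: cvg_norm; exact: fcv.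
  rewrite -(cvg_lim _ cn)//; apply: limr_le; first by apply/cvg_ex; exists `|f w|.
  exact: nearW.
split; first by split => //; exists B.
by apply: (proj2 (Ex_dct mf_ mf _ (intR_cst B) fB)); apply: aeW.
Qed.

End Expectation.

Section Indicators.
Context {R : realType} {Omega : Type}.

Lemma indic_if (A : set Omega) w : (\1_A w : R) = if w \in A then 1 else 0.
Proof. by rewrite indicE; case: (_ \in _). Qed.

Lemma indic_setb (b : Omega -> bool) w : (\1_[set w | b w] w : R) = if b w then 1 else 0.
Proof. by rewrite indicE; case: (boolP (b w)) => h; [rewrite mem_set|rewrite memNset//; exact/negP]. Qed.

Lemma indicI (A B : set Omega) w : (\1_(A `&` B) w : R) = \1_A w * \1_B w.
Proof. by rewrite !indicE in_setI; case: (w \in A); case: (w \in B); rewrite ?mulr0 ?mulr1. Qed.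

End Indicators.

Section Negligible.
Context {R : realType} {d : measure_display} {Omega : measurableType d}.
Variable P : probability Omega R.

(** Covers of probability at most [1 / (n + 1)] intersect in a null cover. Measurability is asked of
    the covers only: the exceptional events below involve uncountably many times. *)
Lemma negligible_small (A : set Omega) :
  (forall e : R, 0 < e -> exists B, [/\ measurable B, A `<=` B & (P B <= e%:E)%E]) ->
  P.-negligible A.
Proof.
move=> h.
have [B hB] := choice (fun n : nat => h n.+1%:R^-1 (ltac:(by rewrite invr_gt0))).
exists (\bigcap_n B n); split.
- by apply: bigcap_measurable => [|n _]; [exists 0%N|case: (hB n)].
- apply/eqP; rewrite eq_le measure_ge0 andbT; apply/lee_addgt0Pr => e e0; rewrite add0e.
  have [n _ hn] := near_infty_natSinv_lt (PosNum e0).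
  have [mB _ PB] := hB n.
  apply: (@le_trans _ _ (P (B n))).
    apply: le_measure; rewrite ?inE//.
      by apply: bigcap_measurable => [|k _]; [exists 0%N|case: (hB k)].
    by move=> w; apply.
  by rewrite (le_trans PB)// lee_fin ltW// (hn n (leqnn n)).
- by move=> w Aw n _; case: (hB n) => _ + _; apply.
Qed.

Lemma markov_le (f : Omega -> R) (c : R) : bmf f -> (forall w, 0 <= f w) -> 0 < c ->
  (P [set w | (c <= f w)%R] <= (Ex P f / c)%:E)%E.
Proof.
move=> bf f0 c0.
have mA : measurable [set w | c <= f w].
  rewrite (_ : [set w | _] = setT `&` f @^-1` `[c, +oo[); first exact: (proj1 bf).
  by apply/seteqP; split => w /=; rewrite in_itv/= andbT; [|case].
have -> : P [set w | c <= f w] = (Ex P (\1_[set w | c <= f w] : Omega -> R))%:E.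
  by rewrite Ex_indic// fineK// fin_num_measure.
rewrite lee_fin ler_pdivlMr// mulrC -ExZ; last by apply: bmf_int; exact: bmf_indic.
apply: Ex_le; [by apply: intRZ; apply: bmf_int; exact: bmf_indic|exact: bmf_int|].
by move=> w; rewrite indic_setb; case: ifP; rewrite ?mulr1 ?mulr0.
Qed.

(** Continuity from below. A bound uniform in a level or a horizon passes to the union of increasing
    events without being summed. *)
Lemma nondecreasing_bigcup_le (E : nat -> set Omega) (x : \bar R) :
  (forall n, measurable (E n)) -> (forall n, E n `<=` E n.+1) ->
  (forall n, P (E n) <= x)%E -> (P (\bigcup_n E n) <= x)%E.
Proof.
move=> mE ndE hE.
have ndE' : nondecreasing_seq E.
  by apply/nondecreasing_seqP => n; apply/subsetPset; exact: ndE.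
have cv := nondecreasing_cvg_mu (mu := P) mE (bigcupT_measurable E mE) ndE'.
rewrite -(cvg_lim _ cv)//; apply: lime_le; first by apply/cvg_ex; eexists; exact: cv.
by apply: nearW => n; exact: hE.
Qed.

End Negligible.

(** * Optional stopping *)

Section Grid.
Context {R : realType}.

Definition gridpt (s t : R) (n i : nat) : R := s + (t - s) * (i%:R / n.+1%:R).

Lemma gridpt0 s t n : gridpt s t n 0 = s.
Proof. by rewrite /gridpt mul0r mulr0 addr0. Qed.

Lemma gridpt_last s t n : gridpt s t n n.+1 = t.
Proof. by rewrite /gridpt divff ?pnatr_eq0// mulr1 addrC subrK. Qed.

Lemma gridpt_le s t n i j : s <= t -> (i <= j)%N -> gridpt s t n i <= gridpt s t n j.
Proof.
move=> st ij; rewrite /gridpt lerD2l ler_wpM2l ?subr_ge0//.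
by rewrite ler_pM2r ?invr_gt0 ?ltr0n// ler_nat.
Qed.

Lemma gridpt_ge s t n i : s <= t -> s <= gridpt s t n i.
Proof. by move=> st; rewrite -[leLHS](gridpt0 s t n) gridpt_le. Qed.

Lemma gridpt_le_end s t n i : s <= t -> (i <= n.+1)%N -> gridpt s t n i <= t.
Proof. by move=> st i_n; rewrite -[leRHS](gridpt_last s t n) gridpt_le. Qed.

Lemma gridptS s t n i : gridpt s t n i.+1 - gridpt s t n i = (t - s) / n.+1%:R.
Proof.
by rewrite /gridpt addrAC opprD addrA subrr add0r addrC -mulrBr -mulrBl -natr1 (addrC i%:R) addrK div1r.
Qed.

Lemma gridpt_near (s t x : R) n : s < x <= t ->
  exists i : nat, [/\ (i < n.+1)%N, gridpt s t n i < x & x <= gridpt s t n i.+1].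
Proof.
move=> /andP[sx xt]; have ts : 0 < t - s by rewrite subr_gt0 (lt_le_trans sx).
have ex : exists i, x <= gridpt s t n i.+1 by exists n; rewrite gridpt_last.
case: (ex_minnP ex) => i xi imin; exists i; split => //.
  by rewrite ltnS; apply: imin; rewrite gridpt_last.
case: i xi imin => [|i] xi imin; first by rewrite gridpt0.
by rewrite ltNge; apply/negP => /imin; rewrite ltnn.
Qed.

(** The cells are open on the left, so they partition []s, t]]; for a stopping time, membership in a
    cell is known at its right end. *)
Definition in_cell (s t : R) n (x : R) i :=
  (gridpt s t n i < x) && (x <= gridpt s t n i.+1).

(* For s < x, [p n] is the point of the n-th grid just above x. *)
Lemma grid_approx (s t x : R) : s <= t -> x <= t ->
  exists p : nat -> R, [/\ p n @[n --> \oo] --> x,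
    (forall n, x <= p n <= Num.max x t) &
    forall n (g : R -> R),
    \sum_(i < n.+1) (if in_cell s t n x i then g (gridpt s t n i.+1) else 0) =
    if s < x then g (p n) else 0].
Proof.
move=> st xt; case: (ltP s x) => [sx|xs]; last first.
  exists (fun=> x); split; [exact: cvg_cst|by move=> n; rewrite lexx le_max lexx|].
  move=> n g; rewrite big1// => i _; rewrite /in_cell ltNge (le_trans xs)//.
  exact: gridpt_ge.
have [i_ hi] := choice (fun n => gridpt_near n (introT andP (conj sx xt))).
exists (fun n => gridpt s t n (i_ n).+1).
have le1 n : 0 <= gridpt s t n (i_ n).+1 - x <= (t - s) / n.+1%:R.
  have [_ h1 h2] := hi n; rewrite subr_ge0 h2 /=.
  by rewrite -(gridptS s t n (i_ n)) lerD2l lerN2 ltW.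
split.
- rewrite -[X in _ --> X]addr0.
  rewrite (_ : (fun n => _) = fun n => x + (gridpt s t n (i_ n).+1 - x)); last first.
    by apply/funext => n; rewrite addrC subrK.
  apply: cvgD; first exact: cvg_cst.
  apply: (@squeeze_cvgr _ _ _ _ (fun=> 0) (fun n => (t - s) / n.+1%:R)).
  + exact: nearW.
  + exact: cvg_cst.
  + rewrite -[X in _ --> X](mulr0 (t - s)).
    by apply: cvgM; [exact: cvg_cst|exact: cvg_harmonic].
- move=> n; have [h0 h1 h2] := hi n; rewrite h2 /= le_max; apply/orP; right.
  exact: gridpt_le_end.
- move=> n g; have [h0 h1 h2] := hi n.
  rewrite (bigD1 (Ordinal h0))//= {1}/in_cell h1 h2 /= big1 ?addr0// => j jne.
  have {}jne : (j : nat) != i_ n.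
    by apply: contra jne => /eqP e; apply/eqP/val_inj.
  rewrite /in_cell; case: ltP => //= jx; case: leP => //= xj.
  move: jne; rewrite neq_ltn => /orP[ji|ij].
    by have := lt_le_trans h1 (le_trans xj (gridpt_le n st ji)); rewrite ltxx.
  by have := le_lt_trans h2 (le_lt_trans (gridpt_le n st ij) jx); rewrite ltxx.
Qed.

End Grid.

Section Filtration.
Context {R : realType} {d : measure_display} {Omega : measurableType d}.
Variables (P : probability Omega R) (F : R -> set_system Omega).
Hypothesis usualF : usual_conditions P F.
Implicit Types (s t : R) (f g T S : Omega -> R) (A B : set Omega).

(** [F t] is a bare family of sets; the measurable type it generates gives access to the closure
    properties of measurable functions. By [F_gen] nothing is added to [F t] when [0 <= t]. *)
Definition Fm (t : R) (f : Omega -> R) :=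
  measurable_fun (setT : set (g_sigma_algebraType (F t))) f.

Lemma F_sigma t : 0 <= t -> sigma_algebra setT (F t).
Proof. by case: usualF => _ /(_ t)+ _ _ _ => h /h[]. Qed.

Lemma F_meas t A : 0 <= t -> F t A -> measurable A.
Proof. by case: usualF => _ /(_ t)+ _ _ _ => h /h[] _; apply. Qed.

Lemma F_mono s t A : 0 <= s -> s <= t -> F s A -> F t A.
Proof. by case: usualF => _ _ h _ _ s0 st; apply: h. Qed.

Lemma F_gen t : 0 <= t -> <<s F t>> = F t.
Proof. by move=> t0; apply: sigma_algebra_id; exact: F_sigma. Qed.

Lemma F_measE t A : 0 <= t ->
  F t A <-> measurable (A : set (g_sigma_algebraType (F t))).
Proof. by move=> t0; rewrite /measurable/= F_gen. Qed.

Lemma F_neg t A : 0 <= t -> P.-negligible A -> F t A.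
Proof.
by case: usualF => _ _ h1 h2 _ t0 nA; apply: (h1 0) => //; exact: h2.
Qed.

Lemma F_I t A B : 0 <= t -> F t A -> F t B -> F t (A `&` B).
Proof. by move=> t0; rewrite !F_measE//; exact: measurableI. Qed.

Lemma F_C t A : 0 <= t -> F t A -> F t (~` A).
Proof. by move=> t0; rewrite !F_measE//; exact: measurableC. Qed.

Lemma F_T t : 0 <= t -> F t setT.
Proof. by move=> t0; rewrite !F_measE//; exact: measurableT. Qed.

Lemma F_cup t (A : nat -> set Omega) : 0 <= t -> (forall n, F t (A n)) ->
  F t (\bigcup_n A n).
Proof.
move=> t0 h; rewrite F_measE//; apply: bigcup_measurable => n _.
by rewrite -F_measE.
Qed.

Lemma F_cap t (A : nat -> set Omega) : 0 <= t -> (forall n, F t (A n)) ->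
  F t (\bigcap_n A n).
Proof.
move=> t0 h; rewrite F_measE//; apply: bigcap_measurable => [|n _]; first by exists 0%N.
by rewrite -F_measE.
Qed.

Lemma Fm_pre t f (B : set R) : 0 <= t -> Fm t f -> measurable B -> F t (f @^-1` B).
Proof. by move=> t0 mf mB; rewrite F_measE// -[X in measurable X]setTI; exact: mf. Qed.

Lemma FmP t f : 0 <= t -> (forall B : set R, measurable B -> F t (f @^-1` B)) -> Fm t f.
Proof. by move=> t0 h _ B mB; rewrite setTI -F_measE//; exact: h. Qed.

Lemma Fm_meas t f : 0 <= t -> Fm t f -> measurable_fun setT f.
Proof.
move=> t0 mf _ B mB; rewrite setTI; apply: (F_meas t0); exact: Fm_pre.
Qed.

Lemma Fm_mono s t f : 0 <= s -> s <= t -> Fm s f -> Fm t f.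
Proof.
move=> s0 st mf; apply: FmP => [|B mB]; first exact: le_trans st.
by apply: (F_mono s0 st); exact: Fm_pre.
Qed.

(** Null sets belong to every [F t], so a change on a null set preserves measurability. This is what
    allows versions with everywhere regular paths to stay adapted. *)
Lemma Fm_ae t f g : 0 <= t -> Fm t f -> {ae P, forall w, g w = f w} -> Fm t g.
Proof.
move=> t0 mf gf; apply: FmP => // B mB.
pose N := [set w | g w <> f w].
have FN A : A `<=` N -> F t A.
  by move=> AN; apply: F_neg => //; apply: negligibleS gf.
rewrite (_ : g @^-1` B = ((f @^-1` B) `&` ~` N) `|` ((g @^-1` B) `&` N)); last first.
  apply/seteqP; split => w /=.
    move=> gB; case: (pselect (N w)) => Nw; [by right|left; split => //].
    by have /contrapT <- := Nw.
  by move=> [[fB /contrapT ->]//|[]].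
rewrite F_measE//; apply: measurableU; rewrite -F_measE//; last exact: FN.
by apply: F_I => //; [exact: Fm_pre|apply: F_C => //; exact: FN].
Qed.

Lemma Fm_indic t A : 0 <= t -> F t A -> Fm t (\1_A).
Proof. by move=> t0; rewrite F_measE// => mA; exact: measurable_indic. Qed.

Definition rtime (T : Omega -> R) :=
  (forall w, 0 <= T w) /\ forall t, 0 <= t -> F t [set w | T w <= t].

Lemma rtime_meas T : rtime T -> measurable_fun setT T.
Proof.
move=> [T0 FT] mT; apply: (measurability _ (RGenOInfty.measurableE R)) => //.
move=> _ [_ [x ->] <-]; rewrite setTI.
rewrite (_ : _ @^-1` _ = ~` [set w | T w <= x]); last first.
  apply/seteqP; split => w /=; rewrite in_itv/= andbT; first by rewrite ltNge => /negP.
  by move/negP; rewrite -ltNge.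
apply: measurableC; case: (leP 0 x) => x0; first by apply: (F_meas x0); exact: FT.
rewrite (_ : [set w | _] = set0)//; apply/seteqP; split => w //= Tx.
by have := le_trans (T0 w) Tx; rewrite leNgt x0.
Qed.

Lemma rtime_gt T t : rtime T -> 0 <= t -> F t [set w | t < T w].
Proof.
move=> [T0 FT] t0; rewrite (_ : [set w | _] = ~` [set w | T w <= t]).
  by apply: F_C => //; exact: FT.
by apply/seteqP; split => w /=; [rewrite ltNge => /negP|move/negP; rewrite -ltNge].
Qed.

Lemma rtime_min T S : rtime T -> rtime S -> rtime (fun w => Num.min (T w) (S w)).
Proof.
move=> [T0 FT] [S0 FS]; split => [w|t t0]; first by rewrite le_min T0 S0.
rewrite (_ : [set w | _] = [set w | T w <= t] `|` [set w | S w <= t]).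
  by rewrite F_measE//; apply: measurableU; rewrite -F_measE//; [exact: FT|exact: FS].
apply/seteqP; split => w /=; first by rewrite ge_min => /orP.
by move=> /orP; rewrite ge_min.
Qed.

Lemma rtime_cst (c : R) : 0 <= c -> rtime (fun=> c).
Proof.
move=> c0; split => // t t0; case: (leP c t) => ct.
  by rewrite (_ : [set w | _] = setT); [exact: F_T|apply/seteqP; split].
rewrite (_ : [set w | _] = ~` setT); first by apply: F_C => //; exact: F_T.
by apply/seteqP; split => w //=; move=> h; apply: h.
Qed.

Lemma stopping_rtime (tau : Omega -> \bar R) (c : R) : 0 <= c ->
  stopping_time F tau -> rtime (fun w => fine (mine c%:E (tau w))).
Proof.
move=> c0 [tau0 Ft].
have e w t : (fine (mine c%:E (tau w)) <= t) = (c <= t) || (tau w <= t%:E)%E.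
  have := tau0 w; case: (tau w) => [x| |]//=.
    by rewrite -EFin_min/= lee_fin => _; rewrite lee_fin ge_min.
  by rewrite miney/= orbF.
split => [w|t t0].
  have := tau0 w; case: (tau w) => [x| |]//=; last by rewrite miney/=.
  by rewrite lee_fin -EFin_min/= le_min c0.
rewrite (_ : [set w | _] = [set w : Omega | c <= t] `|` [set w | (tau w <= t%:E)%E]).
  rewrite F_measE//; apply: measurableU; rewrite -F_measE//; last exact: Ft.
  by have [_] := rtime_cst c0; exact.
by apply/seteqP; split => w /=; rewrite e; [move=> /orP|move/orP].
Qed.

End Filtration.

Section OptionalStopping.
Context {R : realType} {d : measure_display} {Omega : measurableType d}.
Variables (P : probability Omega R) (F : R -> set_system Omega).
Hypothesis usualF : usual_conditions P F.
Implicit Types (s t : R) (f g T S : Omega -> R) (A B : set Omega).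
Implicit Types (N : R -> Omega -> R).

Lemma in_cell_F s t n i T : 0 <= s -> s <= t -> (i < n.+1)%N -> rtime F T ->
  F (gridpt s t n i.+1) [set w | in_cell s t n (Num.min (T w) t) i].
Proof.
move=> s0 st i_n rT.
have g0 j : 0 <= gridpt s t n j by rewrite (le_trans s0)// gridpt_ge.
have le_t : gridpt s t n i.+1 <= t by exact: gridpt_le_end.
have rT' : rtime F (fun w => Num.min (T w) t).
  apply: (rtime_min usualF) => //; apply: (rtime_cst usualF) => //.
  exact: le_trans st.
rewrite (_ : [set w | _] = [set w | gridpt s t n i < Num.min (T w) t] `&`
    [set w | Num.min (T w) t <= gridpt s t n i.+1]); last first.
  by apply/seteqP; split => w /=; rewrite /in_cell => /andP.
apply: (F_I usualF) => //; last by case: rT' => _; exact.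
apply: (F_mono usualF (g0 i)); first by exact: gridpt_le.
exact: (rtime_gt usualF).
Qed.

(** [Num.min T t] is approximated from above by points of the grid on [[0, t]], which do not exceed
    [t]; continuity of the paths gives the limit. *)
Lemma stopped_Fm N T t : (forall w, continuous (N^~ w)) ->
  (forall r, 0 <= r -> Fm F r (N r)) -> rtime F T -> 0 <= t ->
  Fm F t (fun w => N (Num.min (T w) t) w).
Proof.
move=> cN aN rT t0.
(* The cells of the grid miss the point 0, hence the first term. *)
pose Y n w := \1_[set w | Num.min (T w) t <= 0] w * N 0 w +
  \sum_(i < n.+1) \1_[set w | in_cell 0 t n (Num.min (T w) t) i] w * N (gridpt 0 t n i.+1) w.
have g0 n i : 0 <= gridpt 0 t n i by exact: gridpt_ge.
have rT' : rtime F (fun w => Num.min (T w) t).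
  by apply: (rtime_min usualF) => //; exact: (rtime_cst usualF).
apply: (@measurable_fun_cvg _ (g_sigma_algebraType (F t)) R setT Y) => [n|w _].
  apply: measurable_funD.
    apply: measurable_funM; last exact: (Fm_mono usualF _ _ (aN 0 _)).
    apply: (Fm_indic usualF) => //; apply: (F_mono usualF (lexx 0)) => //.
    by case: rT' => _; apply.
  rewrite (_ : (fun w => _) = fun w => \sum_(i <- enum 'I_n.+1) (\1_[set w | in_cell 0 t n (Num.min (T w) t) i] w * N (gridpt 0 t n i.+1) w)); last by apply/funext => w; rewrite big_enum.
  apply: measurable_sum => i.
  have le_t : gridpt 0 t n i.+1 <= t by apply: gridpt_le_end.
  apply: measurable_funM; last by apply: (Fm_mono usualF _ le_t) => //; exact: aN.
  apply: (Fm_indic usualF) => //; apply: (F_mono usualF _ le_t) => //.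
  exact: in_cell_F.
have le_t : Num.min (T w) t <= t by rewrite ge_min lexx orbT.
have [p [cp _ hp]] := grid_approx t0 le_t.
have eY n : Y n w = N (if 0 < Num.min (T w) t then p n else 0) w.
  rewrite /Y indic_setb; under eq_bigr do rewrite indic_setb.
  under eq_bigr do rewrite (fun_if (fun x => x * _)) mul1r mul0r.
  rewrite (hp n (N^~ w)); case: ltP => _; first by rewrite mul0r add0r.
  by rewrite mul1r addr0.
rewrite (_ : Y^~ w = fun n => N (if 0 < Num.min (T w) t then p n else 0) w); last exact/funext.
have [h|h] := ltP 0 (Num.min (T w) t).
  exact: (cvg_comp p (N^~ w) cp (cN w _)).
have -> : Num.min (T w) t = 0.
  by apply/eqP; rewrite eq_le h le_min t0 andbT; case: rT => ->.
exact: cvg_cst.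
Qed.

Definition mg N := forall s t A, 0 <= s -> s <= t -> F s A ->
  Ex P (fun w => \1_A w * N s w) = Ex P (fun w => \1_A w * N t w).

Lemma bmf_FA s A : 0 <= s -> F s A -> bmf (\1_A : Omega -> R).
Proof. by move=> s0 FA; apply: bmf_indic; exact: (F_meas usualF s0). Qed.

Lemma ost_bounded N T s t (B : R) : (forall w, continuous (N^~ w)) ->
  (forall r, 0 <= r -> Fm F r (N r)) -> (forall r, 0 <= r -> intR P (N r)) ->
  mg N -> rtime F T -> 0 <= s -> s <= t ->
  (forall w r, 0 <= r -> r <= t -> `|N (Num.min (T w) r) w| <= B) ->
  forall A, F s A -> Ex P (fun w => \1_A w * N (Num.min (T w) s) w) =
                     Ex P (fun w => \1_A w * N (Num.min (T w) t) w).
Proof.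
move=> cN aN iN mN rT s0 st NB A FA.
have [->//|sNt] := eqVneq s t; have {sNt}st' : s < t by rewrite lt_neqAle sNt.
have t0 : 0 <= t := le_trans s0 st.
have B0 : 0 <= B.
  have [w _] : exists w : Omega, True.
    apply/not_existsP => h.
    have : P setT = 0%E by rewrite (_ : setT = set0) ?measure0//; apply/seteqP; split => w // _; exact: (h w).
    by rewrite probability_setT => /eqP; rewrite onee_eq0.
  exact: le_trans (NB w 0 (lexx 0) t0).
pose A' := A `&` [set w | s < T w].
have FA' : F s A' by apply: (F_I usualF) => //; exact: (rtime_gt usualF).
pose Ts r w := Num.min (T w) r.
have mNs r : 0 <= r -> measurable_fun setT (fun w => N (Ts r w) w).
  by move=> r0; apply: (Fm_meas usualF r0); exact: stopped_Fm.
have bNs r : 0 <= r -> r <= t -> bmf (fun w => N (Ts r w) w).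
  by move=> r0 rt; split; [exact: mNs|exists B => w; exact: NB].
suff key : Ex P (fun w => \1_A' w * N (Ts t w) w) = Ex P (fun w => \1_A' w * N t w).
  pose A'' := A `&` [set w | T w <= s].
  have FA'' : F s A'' by apply: (F_I usualF) => //; case: rT => _; apply.
  have split_A w : (\1_A w : R) = \1_A' w + \1_A'' w.
    rewrite !indicI !indic_setb; case: ltP; rewrite ?(mulr1,mulr0,addr0,add0r)//.
  have dec r : 0 <= r -> r <= t -> Ex P (fun w => \1_A w * N (Ts r w) w) =
     Ex P (fun w => \1_A' w * N (Ts r w) w) + Ex P (fun w => \1_A'' w * N (Ts r w) w).
    move=> r0 rt; rewrite -ExD; first by congr Ex; apply/funext => w; rewrite split_A mulrDl.
      by apply: bmf_int; apply: bmfM; [exact: (bmf_FA s0)|exact: bNs].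
    by apply: bmf_int; apply: bmfM; [exact: (bmf_FA s0)|exact: bNs].
  rewrite [LHS](dec s s0 st) [RHS](dec t t0 (lexx t)) key -(mN s t A')//; congr (_ + _);
    congr (Ex _ _); apply/funext => w.
    rewrite /A' indicI indic_setb /Ts; case: ltP => h; last by rewrite mulr0 !mul0r.
    by [].
  rewrite /A'' indicI indic_setb /Ts; case: leP => h; last by rewrite mulr0 !mul0r.
  by rewrite ?min_l// (le_trans h).
(* A grid point may overshoot [T], where [N] has no bound. Cutting at [K] keeps the sums dominated,
   and since the stopped value is at most [B < K], the cut is eventually inactive on every path. *)
pose K := B + 1.
pose E n i := (A `&` [set w | in_cell s t n (Ts t w) i]) `&` [set w | `|N (gridpt s t n i.+1) w| <= K].
have g0 n i : 0 <= gridpt s t n i by rewrite (le_trans s0)// gridpt_ge.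
have FE n (i : 'I_n.+1) : F (gridpt s t n i.+1) (E n i).
  apply: (F_I usualF) => //; first apply: (F_I usualF) => //.
  - by apply: (F_mono usualF s0) => //; exact: gridpt_ge.
  - exact: in_cell_F.
  - rewrite (_ : [set w | _] = N (gridpt s t n i.+1) @^-1` `[- K, K]).
      by apply: (Fm_pre usualF) => //; exact: aN.
    by apply/seteqP; split => w /=; rewrite in_itv/= -ler_norml.
have mE n (i : 'I_n.+1) : measurable (E n i) by apply: (F_meas usualF (g0 n i.+1)).
(* [Y n] and [I n * N t] have the same mean, cell by cell. On [A'] the first tends to the stopped
   value and the second to [N t]. *)
pose Y n w := \sum_(i < n.+1) \1_(E n i) w * N (gridpt s t n i.+1) w.
pose I n w : R := \sum_(i < n.+1) \1_(E n i) w.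
have EY n : Ex P (Y n) = Ex P (fun w => I n w * N t w).
  rewrite /Y Ex_sum; last first.
    by move=> i; apply: intR_bM; [exact: bmf_indic|exact: iN].
  rewrite (_ : (fun w => I n w * _) = fun w => \sum_(i < n.+1) \1_(E n i) w * N t w); last first.
    by apply/funext => w; rewrite mulr_suml.
  rewrite Ex_sum; last by move=> i; apply: intR_bM; [exact: bmf_indic|exact: iN].
  by apply: eq_bigr => i _; apply: mN => //; exact: gridpt_le_end.
have lim w : exists p : nat -> R, [/\ p n @[n --> \oo] --> Ts t w,
   (forall n, Y n w = \1_A' w * (if `|N (p n) w| <= K then N (p n) w else 0)) &
   (forall n, I n w = \1_A' w * (if `|N (p n) w| <= K then 1 else 0))].
  have le_t : Ts t w <= t by rewrite ge_min lexx orbT.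
  have [p [cp _ hp]] := grid_approx st le_t.
  have e : (\1_[set w | s < T w] w : R) = if s < Ts t w then 1 else 0.
    by rewrite indic_setb lt_min st' andbT.
  have key n (g : R -> R) : \sum_(i < n.+1) \1_(E n i) w * g (gridpt s t n i.+1) =
      \1_A' w * (if `|N (p n) w| <= K then g (p n) else 0).
    under eq_bigr do rewrite /E !indicI !indic_setb.
    transitivity (\1_A w * \sum_(i < n.+1) if in_cell s t n (Ts t w) i then
       (if `|N (gridpt s t n i.+1) w| <= K then g (gridpt s t n i.+1) else 0) else 0).
      rewrite mulr_sumr; apply: eq_bigr => i _.
      by do 2!case: ifP => _; rewrite ?(mulr0,mul0r,mulr1).
    rewrite (hp n (fun r => if `|N r w| <= K then g r else 0)) /A' indicI e.
    by case: ifP; rewrite ?(mulr1, mulr0, mul0r).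
  exists p; split => // n; first exact: (key n (N^~ w)).
  by rewrite /I -(key n (fun=> 1)); apply: eq_bigr => i _; rewrite mulr1.
have near_K w (p : nat -> R) : p n @[n --> \oo] --> Ts t w ->
    \forall n \near \oo, `|N (p n) w| <= K.
  move=> cp.
  have cNp : `|N (p n) w| @[n --> \oo] --> `|N (Ts t w) w|.
    by apply: cvg_norm; exact: (cvg_comp p (N^~ w) cp (cN w _)).
  have : `|N (Ts t w) w| < K by rewrite (le_lt_trans (NB w t t0 (lexx t)))// ltrDl.
  by move/(cvgr_lt _ cNp); apply: filterS => n /ltW.
have mY n : measurable_fun setT (Y n).
  apply: intR_mf (P) _ _; apply: intR_sum => i.
  by apply: intR_bM; [exact: bmf_indic|exact: iN].
have cY w : Y n w @[n --> \oo] --> \1_A' w * N (Ts t w) w.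
  have [p [cp hY _]] := lim w.
  rewrite (_ : Y^~ w = fun n => \1_A' w * (if `|N (p n) w| <= K then N (p n) w else 0)); last exact/funext.
  apply: cvgMr; apply: cvg_trans (cvg_comp p (N^~ w) cp (cN w _)).
  apply: near_eq_cvg; have := near_K w p cp; apply: filterS => n /= h.
  by rewrite h.
have cI w : I n w * N t w @[n --> \oo] --> \1_A' w * N t w.
  have [p [cp _ hI]] := lim w; apply: cvgMl.
  rewrite (_ : I^~ w = fun n => \1_A' w * (if `|N (p n) w| <= K then 1 else 0)); last exact/funext.
  rewrite -[X in _ --> X]mulr1; apply: cvgMr; apply: cvg_near_cst.
  by have := near_K w p cp; apply: filterS => n /= ->.
have i1 (C : set Omega) w : `|\1_C w : R| <= 1.
  by rewrite indic_if; case: ifP; rewrite ?normr1 ?normr0.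
have [_ l1] : bmf (fun w => \1_A' w * N (Ts t w) w) /\
    Ex P (Y n) @[n --> \oo] --> Ex P (fun w => \1_A' w * N (Ts t w) w).
  apply: (@Ex_bct _ _ _ P Y _ K) => // n w; have [p [_ -> _]] := lim w.
  rewrite normrM -[leRHS]mul1r ler_pM//; case: ifP => //; rewrite normr0.
  by move=> _; rewrite addr_ge0.
have [_ l2] : intR P (fun w => \1_A' w * N t w) /\
    Ex P (fun w => I n w * N t w) @[n --> \oo] --> Ex P (fun w => \1_A' w * N t w).
  apply: (@Ex_dct _ _ _ P (fun n w => I n w * N t w) _ (fun w => `|N t w|)).
  - move=> n; apply: measurable_funM; last exact: (intR_mf (iN t t0)).
    by apply: (proj1 (bmf_sum _)) => i; exact: bmf_indic.
  - apply: measurable_funM; last exact: (intR_mf (iN t t0)).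
    exact: (proj1 (bmf_FA s0 FA')).
  - by apply: aeW => w; exact: cI.
  - by apply: integrable_norm => //; exact: iN.
  - move=> n w; have [p [_ _ ->]] := lim w.
    rewrite normrM -[leRHS]mul1r ler_wpM2r// normrM -[leRHS]mul1r ler_pM//.
    by case: ifP; rewrite ?normr1 ?normr0.
by rewrite (_ : (fun n => Ex P (Y n)) = fun n => Ex P (fun w => I n w * N t w)) in l1;
  [rewrite -(cvg_lim _ l1)// -(cvg_lim _ l2)|apply/funext => n; exact: EY].
Qed.

End OptionalStopping.

Section LocalMartingale.
Context {R : realType} {d : measure_display} {Omega : measurableType d}.
Variables (P : probability Omega R) (F : R -> set_system Omega).
Hypothesis usualF : usual_conditions P F.
Implicit Types (s t : R) (f g T S : Omega -> R) (A B : set Omega).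
Implicit Types (N M : R -> Omega -> R).

Lemma minfine_continuous (x : \bar R) : (0 <= x)%E ->
  continuous (fun t : R => fine (mine t%:E x)).
Proof.
case: x => [x| |]// _.
  rewrite (_ : (fun t => _) = fun t => Num.min t x).
    move=> t; apply: continuous_min; first exact: cvg_id.
    exact: cvg_cst.
  by apply/funext => t; rewrite -EFin_min.
rewrite (_ : (fun t => _) = id); first by move=> t; exact: cvg_id.
by apply/funext => t; rewrite miney.
Qed.

Lemma minfine_bounds (x : \bar R) t : (0 <= x)%E -> 0 <= t ->
  0 <= fine (mine t%:E x) <= t.
Proof.
case: x => [x| |]// x0 t0; last by rewrite miney/= t0 lexx.
by rewrite -EFin_min/= le_min ge_min t0 lexx/= -lee_fin x0.
Qed.

Lemma minfine_min (x : \bar R) t s : (0 <= x)%E ->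
  fine (mine (Num.min s t)%:E x) = Num.min s (fine (mine t%:E x)).
Proof. by case: x => [x| |]// x0; rewrite ?miney// -!EFin_min/= minA. Qed.

Lemma adapted_version M N : adapted F M ->
  {ae P, forall w, forall t, 0 <= t -> N t w = M t w} ->
  forall t, 0 <= t -> Fm F t (N t).
Proof.
move=> aM NM t t0; apply: (Fm_ae usualF t0 (f := M t)).
  by apply: (FmP usualF) => // B; exact: aM.
by apply: filterS NM => w; exact.
Qed.

(* [N] is a version of the local martingale [M] with everywhere continuous paths. *)
Lemma local_martingale_stopped M N T s t (B : R) :
  continuous_local_martingale P F M -> (forall w, continuous (N^~ w)) ->
  {ae P, forall w, forall t, 0 <= t -> N t w = M t w} ->
  (forall w, N 0 w = 0) -> rtime F T -> 0 <= s -> s <= t ->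
  (forall w r, 0 <= r -> r <= t -> `|N (Num.min (T w) r) w| <= B) ->
  forall A, F s A -> Ex P (fun w => \1_A w * N (Num.min (T w) s) w) =
                     Ex P (fun w => \1_A w * N (Num.min (T w) t) w).
Proof.
move=> [aM cM [tau [st_tau tau_oo mM]]] cN NM N0 rT s0 st NB A FA.
have t0 : 0 <= t := le_trans s0 st.
have aN := adapted_version aM NM.
(* Stopping at the localizing time [tau n] gives a version of a true martingale, still bounded by
   [B] up to [T]. On almost every path it agrees with [N] up to [T] and [t] for large [n], so
   dominated convergence removes the localization. *)
pose L n r w := N (fine (mine r%:E (tau n w))) w.
have tau0 n w : (0 <= tau n w)%E by case: (st_tau n).
have cL n w : continuous (L n ^~ w).
  move=> r; apply: (@continuous_comp _ _ _ (fun r : R => fine (mine r%:E (tau n w))) (N^~ w)).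
    exact: minfine_continuous.
  exact: cN.
have aL n r : 0 <= r -> Fm F r (L n r).
  move=> r0; rewrite (_ : L n r = fun w => N (Num.min (fine (mine r%:E (tau n w))) r) w).
    by apply: (stopped_Fm usualF) => //; exact: (stopping_rtime usualF).
  apply/funext => w; rewrite /L [in RHS]min_l//.
  by have /andP[] := minfine_bounds (tau0 n w) r0.
have LM n : {ae P, forall w, forall r, 0 <= r -> L n r w = stopped M (tau n) r w - M 0 w}.
  apply: filterS NM => w NMw r r0; rewrite -NMw// N0 subr0 /stopped -NMw//.
  by have /andP[] := minfine_bounds (tau0 n w) r0.
have mLM n r : 0 <= r -> measurable_fun setT (fun w => stopped M (tau n) r w - M 0 w).
  by move=> r0; apply: intR_mf (P) _ _; case: (mM n) => _ /(_ r r0).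
have iL n r : 0 <= r -> intR P (L n r).
  move=> r0; apply: (@intR_ae _ _ _ P _ (fun w => stopped M (tau n) r w - M 0 w)) => //.
  - exact: (Fm_meas usualF r0 (aL n r r0)).
  - by apply: filterS (LM n) => w /= -> //.
  - by case: (mM n) => _ /(_ r r0).
have mL n : mg P F (L n).
  move=> r q C r0 rq FC; have q0 := le_trans r0 rq.
  have mC : measurable C by exact: (F_meas usualF r0).
  have e u : 0 <= u -> Ex P (fun w => \1_C w * L n u w) =
      fine (\int[P]_(w in C) (stopped M (tau n) u w - M 0 w)%:E).
    move=> u0.
    rewrite (@Ex_ae _ _ _ P _ (fun w => \1_C w * (stopped M (tau n) u w - M 0 w))).
    - rewrite /Ex [in RHS]integral_mkcond /Rintegral; congr (fine _).
      by apply: eq_integral => w _; rewrite /patch indicE; case: ifP => _ /=; rewrite ?mul1r ?mul0r.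
    - by apply: measurable_funM; [exact: measurable_indic|exact: (Fm_meas usualF u0 (aL n u u0))].
    - by apply: measurable_funM; [exact: measurable_indic|exact: mLM].
    - by apply: filterS (LM n) => w ->.
  by rewrite (e r r0) (e q q0); case: (mM n) => _ _ h; congr fine; rewrite (h r q r0 rq C FC).
have step n : Ex P (fun w => \1_A w * L n (Num.min (T w) s) w) =
    Ex P (fun w => \1_A w * L n (Num.min (T w) t) w).
  apply: (ost_bounded usualF (cL n) (aL n) (iL n) (mL n) rT s0 st (B := B) _ FA) => w r r0 rt.
  rewrite /L minfine_min//; have /andP[h1 h2] := minfine_bounds (tau0 n w) r0.
  by apply: NB => //; exact: le_trans rt.
have lim_L r : 0 <= r -> r <= t -> Ex P (fun w => \1_A w * L n (Num.min (T w) r) w) @[n --> \oo] -->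
    Ex P (fun w => \1_A w * N (Num.min (T w) r) w).
  move=> r0 rt.
  have mN : measurable_fun setT (fun w => N (Num.min (T w) r) w).
    by exact: (Fm_meas usualF r0 (stopped_Fm usualF cN aN rT r0)).
  have mA : measurable A by exact: (F_meas usualF s0).
  apply: (proj2 (@Ex_dct _ _ _ P (fun n w => \1_A w * L n (Num.min (T w) r) w) _ (fun=> B) _ _ _ _ _)).
  - move=> n; apply: measurable_funM; first exact: measurable_indic.
    exact: (Fm_meas usualF r0 (stopped_Fm usualF (cL n) (aL n) rT r0)).
  - by apply: measurable_funM; [exact: measurable_indic|exact: mN].
  - apply: filterS tau_oo => w [_ tw]; apply: cvg_near_cst.
    have T0 : 0 <= Num.min (T w) r by rewrite le_min r0 andbT; case: rT.
    have : \forall n \near \oo, ((Num.min (T w) r)%:E <= tau n w)%E.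
      by apply: (cvgey_ge tw).
    by apply: filterS => n h; rewrite /L min_l.
  - exact: intR_cst.
  - move=> n w; rewrite normrM indic_if.
    have h : `|L n (Num.min (T w) r) w| <= B.
      rewrite /L minfine_min//; have /andP[h1 h2] := minfine_bounds (tau0 n w) r0.
      by apply: NB => //; exact: le_trans rt.
    by case: ifP; rewrite ?normr1 ?mul1r// normr0 mul0r (le_trans _ h).
have l1 := lim_L s s0 st; have l2 := lim_L t t0 (lexx t).
rewrite (funext step) in l1.
exact: (cvg_unique _ l1 l2).
Qed.

End LocalMartingale.

(** * Increments of bounded martingales *)

Section BoundedMartingale.
Context {R : realType} {d : measure_display} {Omega : measurableType d}.
Variables (P : probability Omega R) (F : R -> set_system Omega).
Hypothesis usualF : usual_conditions P F.
Implicit Types (s t : R) (f g T S Y phi : Omega -> R) (A : set Omega).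
Implicit Types (V N M Q : R -> Omega -> R).

(** An affine change brings [phi] into [[0, 1]], where it is a limit of step functions constant on
    events of [F s]. *)
Lemma Ex_Fm0 s phi Y : 0 <= s -> Fm F s phi -> bmf phi -> bmf Y ->
  (forall A, F s A -> Ex P (fun w => \1_A w * Y w) = 0) ->
  Ex P (fun w => phi w * Y w) = 0.
Proof.
move=> s0 mphi [mphi' [B phiB]] bY hY.
pose C := `|B| + 1; have C0 : 0 < C by rewrite ltr_wpDl.
have phiC w : `|phi w| <= C.
  by rewrite (le_trans (phiB w))// (le_trans (ler_norm _))// lerDl.
pose psi w := (phi w + C) / (2 * C).
have psi01 w : 0 <= psi w <= 1.
  have := phiC w; rewrite ler_norml => /andP[h1 h2].
  rewrite /psi ler_pdivlMr ?mulr_gt0// ler_pdivrMr ?mulr_gt0// mul0r mul1r.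
  by rewrite mulr2n mulrDl mul1r lerD2r h2 andbT -lerBlDr sub0r.
have FY : Ex P Y = 0.
  rewrite -(hY setT); last exact: (F_T usualF).
  by congr Ex; apply/funext => w; rewrite indicT mul1r.
suff h : Ex P (fun w => psi w * Y w) = 0.
  have bpsi : bmf psi.
    split; last by exists 1 => w; have /andP[h1 h2] := psi01 w; rewrite ger0_norm.
    by apply: measurable_funM; [apply: measurable_funD|exact: measurable_cst].
  rewrite (_ : (fun w => _) = fun w => 2 * C * (psi w * Y w) - C * Y w).
    rewrite ExB; [|by apply: intRZ; apply: bmf_int; exact: bmfM|by apply: intRZ; exact: bmf_int].
    rewrite ExZ; last by apply: bmf_int; exact: bmfM.
    by rewrite ExZ ?FY ?h ?mulr0 ?subr0//; exact: bmf_int.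
  apply/funext => w; rewrite /psi.
  have : C != 0 by rewrite gt_eqF.
  by move=> ?; field.
have FC n (i : 'I_n.+1) : F s [set w | in_cell 0 1 n (psi w) i].
  have mpsi : Fm F s psi.
    by apply: measurable_funM; [apply: measurable_funD => //; exact: measurable_cst|exact: measurable_cst].
  rewrite (_ : [set w | _] = psi @^-1` `]gridpt 0 1 n i, gridpt 0 1 n i.+1]).
    by apply: (Fm_pre usualF) => //; exact: measurable_itv.
  by apply/seteqP; split => w /=; rewrite in_itv.
have mC n (i : 'I_n.+1) : measurable [set w | in_cell 0 1 n (psi w) i] by exact: (F_meas usualF s0).
pose Z n w := \sum_(i < n.+1) gridpt 0 1 n i.+1 * (\1_[set w | in_cell 0 1 n (psi w) i] w * Y w).
have bZ1 n (i : 'I_n.+1) : bmf (fun w => \1_[set w | in_cell 0 1 n (psi w) i] w * Y w).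
  by apply: bmfM => //; exact: bmf_indic.
have EZ n : Ex P (Z n) = 0.
  rewrite /Z Ex_sum => [|i]; last by apply: intRZ; exact: bmf_int.
  by rewrite big1// => i _; rewrite ExZ ?hY ?mulr0//; exact: bmf_int.
have limZ w : exists p : nat -> R, [/\ p n @[n --> \oo] --> psi w, (forall n, 0 <= p n <= 1) &
     forall n, Z n w = p n * Y w].
  have /andP[p0 p1] := psi01 w.
  have [p [cp bp hp]] := grid_approx ler01 p1.
  exists (fun n => if 0 < psi w then p n else 0); split.
  - case: ltP => // h; have -> : psi w = 0 by apply/eqP; rewrite eq_le h.
    exact: cvg_cst.
  - move=> n; case: ifP => _; last by rewrite lexx ler01.
    by have /andP[h1 h2] := bp n; rewrite (le_trans p0 h1) (le_trans h2)// ge_max p1 lexx.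
  - move=> n; rewrite /Z -(hp n id) mulr_suml; apply: eq_bigr => i _.
    by rewrite indic_setb mulrA; case: ifP; rewrite ?mulr1 ?mulr0.
have [mY [B' YB']] := bY.
have [_ l1] : bmf (fun w => psi w * Y w) /\
    Ex P (Z n) @[n --> \oo] --> Ex P (fun w => psi w * Y w).
  apply: (@Ex_bct _ _ _ P Z _ B').
  - by move=> n; apply: (proj1 (bmf_sum _)) => i; apply: bmfM; [exact: bmf_cst|].
  - move=> w; have [p [cp _ hp]] := limZ w.
    rewrite (_ : Z^~ w = fun n => p n * Y w); last exact/funext.
    exact: cvgMl.
  - move=> n w; have [p [_ bp ->]] := limZ w.
    have /andP[h1 h2] := bp n; rewrite normrM ger0_norm// -[leRHS]mul1r ler_pM//.
by rewrite (funext EZ) in l1; rewrite -(cvg_lim _ l1)// lim_cst.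
Qed.

(** A bounded martingale on [[0, t0]], with the martingale identity tested on events; [bmg_incr]
    extends it to bounded multipliers. *)
Definition bmg (t0 : R) N :=
  [/\ (forall t, 0 <= t -> t <= t0 -> Fm F t (N t)),
      (exists B, forall t w, 0 <= t -> t <= t0 -> `|N t w| <= B) &
      (forall s t A, 0 <= s -> s <= t -> t <= t0 -> F s A ->
         Ex P (fun w => \1_A w * N s w) = Ex P (fun w => \1_A w * N t w))].

Lemma bmg_bmf t0 N t : bmg t0 N -> 0 <= t -> t <= t0 -> bmf (N t).
Proof.
move=> [mN [B NB] _] t_ge0 tt0; split; first exact: (Fm_meas usualF t_ge0 (mN t t_ge0 tt0)).
by exists B => w; exact: NB.
Qed.

Lemma bmg_incr t0 N s t phi : bmg t0 N -> 0 <= s -> s <= t -> t <= t0 ->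
  Fm F s phi -> bmf phi -> Ex P (fun w => phi w * (N t w - N s w)) = 0.
Proof.
move=> bN s0 st tt0 mphi bphi.
have bt : bmf (N t) by apply: (bmg_bmf bN) => //; exact: le_trans st.
have bs : bmf (N s) by apply: (bmg_bmf bN) => //; exact: le_trans tt0.
apply: (Ex_Fm0 s0) => //; first exact: bmfB.
move=> A FA; case: bN => _ _ hN.
rewrite (_ : (fun w => _) = fun w => \1_A w * N t w - \1_A w * N s w); last first.
  by apply/funext => w; rewrite mulrBr.
have bA := bmf_FA usualF s0 FA.
by rewrite ExB ?(hN s t A)// ?subrr//; apply: bmf_int; exact: bmfM.
Qed.

(** [(N t - N s) ^ 2] differs from [N t ^ 2 - N s ^ 2] by [2 * N s * (N t - N s)], which has mean 0
    against an [F s]-measurable multiplier. *)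
Lemma bmg_incr_sq t0 N Q s t phi : bmg t0 N -> bmg t0 (fun t w => N t w ^+ 2 - Q t w) ->
  0 <= s -> s <= t -> t <= t0 -> Fm F s phi -> bmf phi ->
  Ex P (fun w => phi w * (N t w - N s w) ^+ 2) = Ex P (fun w => phi w * (Q t w - Q s w)).
Proof.
move=> bN bQ s0 st tt0 mphi bphi.
have t_ge0 := le_trans s0 st; have ss0 := le_trans st tt0.
have bt : bmf (N t) by apply: (bmg_bmf bN).
have bs : bmf (N s) by apply: (bmg_bmf bN).
have bQt : bmf (Q t).
  rewrite (_ : Q t = fun w => N t w ^+ 2 - (N t w ^+ 2 - Q t w)).
    by apply: bmfB; [exact: bmfX|exact: (bmg_bmf bQ)].
  by apply/funext => w; ring.
have bQs : bmf (Q s).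
  rewrite (_ : Q s = fun w => N s w ^+ 2 - (N s w ^+ 2 - Q s w)).
    by apply: bmfB; [exact: bmfX|exact: (bmg_bmf bQ)].
  by apply/funext => w; ring.
have e1 := bmg_incr bQ s0 st tt0 mphi bphi.
have e2 : Ex P (fun w => (phi w * N s w) * (N t w - N s w)) = 0.
  apply: (bmg_incr bN) => //; last exact: bmfM.
  by apply: measurable_funM => //; case: bN => + _ _; apply.
rewrite (_ : (fun w => phi w * (Q t w - Q s w)) = fun w => phi w * (N t w - N s w) ^+ 2 -
  (phi w * (N t w ^+ 2 - Q t w - (N s w ^+ 2 - Q s w)) -
   2 * ((phi w * N s w) * (N t w - N s w)))); last first.
  by apply/funext => w; ring.
have b1 : bmf (fun w => phi w * (N t w ^+ 2 - Q t w - (N s w ^+ 2 - Q s w))).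
  by apply: bmfM => //; apply: bmfB; apply: bmfB => //; exact: bmfX.
have b2 : bmf (fun w => 2 * (phi w * N s w * (N t w - N s w))).
  by apply: bmfM; [exact: bmf_cst|apply: bmfM; [exact: bmfM|exact: bmfB]].
rewrite [RHS]ExB; first last.
- by apply: bmf_int; apply: bmfB.
- by apply: bmf_int; apply: bmfM => //; apply: bmfX; exact: bmfB.
rewrite ExB; [|exact: bmf_int..].
by rewrite ExZ ?e1 ?e2 ?mulr0 ?subr0//; apply: bmf_int; apply: bmfM; [exact: bmfM|exact: bmfB].
Qed.

End BoundedMartingale.

(** * An Ito inequality *)

Lemma unif_continuous_segment {R : realType} (a b : R) (f : R -> R) :
  continuous f -> forall e : R, 0 < e -> exists2 dl : R, 0 < dl &
  forall x y, a <= x <= b -> `|x - y| < dl -> `|f x - f y| < e.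
Proof.
move=> cf e e0.
have /compact_near_coveringP cov := @segment_compact R a b.
have := cov R 0^'+ (fun dl x => forall y, `|x - y| < dl -> `|f x - f y| < e) _.
move=> /(_ _)[].
  move=> x _; have e20 : 0 < e / 2 by rewrite divr_gt0.
  have /cvgrPdist_lt/(_ _ e20) := cf x.
  move=> /nbhs_ballP[r /= r0 hr].
  exists (ball x (r / 2), [set dl | dl < r / 2]) => /=.
    split; first by apply: nbhsx_ballx; rewrite divr_gt0.
    by apply: nbhs_right_lt; rewrite divr_gt0.
  move=> [x' dl]/= [xx' dlr] y x'y.
  have h1 : `|f x - f x'| < e / 2.
    by apply: hr; apply: lt_trans xx' _; rewrite ltr_pdivrMr// ltr_pMr// ltr1n.
  have h2 : `|f x - f y| < e / 2.
    apply: hr; rewrite /ball/=; rewrite (_ : x - y = (x - x') + (x' - y)); last by ring.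
    rewrite (le_lt_trans (ler_normD _ _))// (splitr r) ltrD//; exact: lt_trans dlr.
  rewrite (_ : f x' - f y = (f x - f y) - (f x - f x')); last by ring.
  by rewrite (le_lt_trans (ler_normB _ _))// (splitr e) ltrD.
move=> dl /= dl0 h.
exists (dl / 2); first by rewrite divr_gt0.
move=> x y xab xy.
apply: (h (dl / 2)) => //=; last by rewrite divr_gt0.
by rewrite sub0r normrN gtr0_norm ?divr_gt0// ltr_pdivrMr// ltr_pMr// ltr1n.
Qed.

Section TaylorSums.
Context {R : realType} {d : measure_display} {Omega : measurableType d}.
Variables (P : probability Omega R) (F : R -> set_system Omega).
Hypothesis usualF : usual_conditions P F.
Variables (t0 L : R) (N Q : R -> Omega -> R).
Hypothesis t0_ge0 : 0 <= t0.
Hypothesis L_ge0 : 0 <= L.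
Hypothesis bN : bmg P F t0 N.
Hypothesis bQ : bmg P F t0 (fun t w => N t w ^+ 2 - Q t w).
Hypothesis QL : forall w s t, 0 <= s -> s <= t -> t <= t0 ->
  0 <= Q t w - Q s w <= L * (t - s).

Local Notation pt := (gridpt 0 t0).

Let dN n i w := N (pt n i.+1) w - N (pt n i) w.
Let sq n k w := \sum_(i < k) dN n i w ^+ 2.
Let mesh n := t0 / n.+1%:R.

Let pt_ge0 n i : 0 <= pt n i. Proof. exact: gridpt_ge. Qed.

Let pt_le n i : (i <= n.+1)%N -> pt n i <= t0.
Proof. by move=> ?; exact: gridpt_le_end. Qed.

Let pt_leS n i : pt n i <= pt n i.+1. Proof. exact: gridpt_le. Qed.

Let mN n i : (i <= n.+1)%N -> Fm F (pt n i) (N (pt n i)).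
Proof. by move=> ?; case: bN => + _ _; apply=> //; exact: pt_le. Qed.

Let bNi n i : (i <= n.+1)%N -> bmf (N (pt n i)).
Proof. by move=> ?; apply: (bmg_bmf usualF bN) => //; exact: pt_le. Qed.

Let bdN n i : (i <= n)%N -> bmf (dN n i).
Proof. by move=> ?; apply: bmfB; apply: bNi => //; exact: ltnW. Qed.

Let bsq n k : (k <= n.+1)%N -> bmf (sq n k).
Proof.
move=> kn; apply: bmf_sum => i; apply: bmfX; apply: bdN.
by rewrite -ltnS (leq_trans (ltn_ord i)).
Qed.

Let msq n k : (k <= n.+1)%N -> Fm F (pt n k) (sq n k).
Proof.
elim: k => [_|k IH kn].
  rewrite (_ : sq n 0 = fun=> 0); first exact: measurable_cst.
  by apply/funext => w; rewrite /sq big_ord0.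
rewrite (_ : sq n k.+1 = fun w => sq n k w + dN n k w ^+ 2); last first.
  by apply/funext => w; rewrite /sq big_ord_recr.
have kn' := ltnW kn.
apply: measurable_funD.
  by apply: (Fm_mono usualF (pt_ge0 n k) (pt_leS n k)); exact: IH.
apply: measurable_funX; apply: measurable_funB; first exact: mN.
by apply: (Fm_mono usualF (pt_ge0 n k) (pt_leS n k)); exact: mN.
Qed.

Lemma Ex_sq_incr n i phi : (i <= n)%N -> Fm F (pt n i) phi -> bmf phi ->
  Ex P (fun w => phi w * dN n i w ^+ 2) =
  Ex P (fun w => phi w * (Q (pt n i.+1) w - Q (pt n i) w)).
Proof.
move=> i_n mphi bphi; apply: (bmg_incr_sq usualF bN bQ) => //.
exact: pt_le.
Qed.

Lemma Q_bmf t : 0 <= t -> t <= t0 -> bmf (Q t).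
Proof.
move=> ht tt0; rewrite (_ : Q t = fun w => N t w ^+ 2 - (N t w ^+ 2 - Q t w)).
  by apply: bmfB; [apply: bmfX; exact: (bmg_bmf usualF bN)|exact: (bmg_bmf usualF bQ)].
by apply/funext => w; ring.
Qed.

Lemma Ex_sq_incr_le n i phi : (i <= n)%N -> Fm F (pt n i) phi -> bmf phi ->
  (forall w, 0 <= phi w) ->
  Ex P (fun w => phi w * dN n i w ^+ 2) <= L * mesh n * Ex P phi.
Proof.
move=> i_n mphi bphi phi0; rewrite Ex_sq_incr// -ExZ; last exact: bmf_int.
have h1 : bmf (Q (pt n i.+1)) by apply: Q_bmf => //; exact: pt_le.
have h2 : bmf (Q (pt n i)) by apply: Q_bmf => //; apply: pt_le; exact: ltnW.
apply: Ex_le.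
- by apply: bmf_int; apply: bmfM => //; exact: bmfB.
- by apply: bmf_int; apply: bmfM => //; exact: bmf_cst.
- move=> w; have /andP[_ h] := QL w (pt_ge0 n i) (pt_leS n i) (@pt_le n i.+1 i_n).
  by rewrite mulrC ler_wpM2r// (le_trans h)// gridptS subr0.
Qed.


Let meshM n k : (k <= n.+1)%N -> mesh n * k%:R <= t0.
Proof.
move=> kn; rewrite /mesh -mulrA ler_piMr// mulrC ler_pdivrMr ?ltr0n// mul1r.
by rewrite ler_nat.
Qed.

Lemma Ex_sq_le n k : (k <= n.+1)%N -> Ex P (sq n k) <= L * (mesh n * k%:R).
Proof.
elim: k => [_|k IH kn].
  rewrite (_ : sq n 0 = fun=> 0) ?Ex_cst ?mulr0//.
  by apply/funext => w; rewrite /sq big_ord0.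
rewrite (_ : sq n k.+1 = fun w => sq n k w + 1 * dN n k w ^+ 2); last first.
  by apply/funext => w; rewrite /sq big_ord_recr mul1r.
rewrite ExD; first last.
- by apply: intRZ; apply: bmf_int; apply: bmfX; exact: bdN.
- by apply: bmf_int; apply: bsq; exact: ltnW.
rewrite -natr1 mulrDr mulr1 mulrDr lerD ?IH//; first exact: ltnW.
have := @Ex_sq_incr_le n k (fun=> 1) kn (measurable_cst _) (bmf_cst _) (fun=> ler01).
by rewrite Ex_cst mulr1.
Qed.

(** Induction on the number of increments: the cross term is at most [L * mesh n] times the mean of
    [sq n k], and the fourth power at most [W ^ 2] times the square. The bound is uniform in [n] and
    gives uniform integrability of the sums of squares. *)
Lemma Ex_sqsq_le (W : R) : (forall s t w, 0 <= s -> s <= t0 -> 0 <= t -> t <= t0 ->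
    `|N t w - N s w| <= W) ->
  forall n k, (k <= n.+1)%N ->
  Ex P (fun w => sq n k w ^+ 2) <= L * (mesh n * k%:R) * (2 * L * t0 + W ^+ 2).
Proof.
move=> NW n; elim => [_|k IH kn].
  rewrite (_ : (fun w => _) = fun=> 0) ?Ex_cst ?(mulr0, mul0r)//.
  by apply/funext => w; rewrite /sq big_ord0 expr0n.
have kn' := ltnW kn.
have dW w : dN n k w ^+ 2 <= W ^+ 2.
  rewrite -[leLHS](@real_normK _ (dN n k w)) ?num_real// ler_pXn2r ?nnegrE//.
    by apply: NW => //; [exact: (@pt_le n k)|exact: (@pt_le n k.+1)].
  by apply: le_trans (NW 0 0 w _ _ _ _).
have bd := @bdN n k kn; have bs := bsq kn'.
rewrite (_ : (fun w => _) = fun w => sq n k w ^+ 2 +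
   (2 * (sq n k w * dN n k w ^+ 2) + (dN n k w ^+ 2) * dN n k w ^+ 2)); last first.
  by apply/funext => w; rewrite /sq big_ord_recr/=; ring.
have bsd : bmf (fun w => sq n k w * dN n k w ^+ 2) by apply: bmfM => //; exact: bmfX.
have bdd : bmf (fun w => dN n k w ^+ 2 * dN n k w ^+ 2) by apply: bmfM; exact: bmfX.
rewrite ExD; first last.
- by apply: intRD; [apply: intRZ|]; exact: bmf_int.
- by apply: bmf_int; exact: bmfX.
rewrite ExD; [|by apply: intRZ; exact: bmf_int|exact: bmf_int].
rewrite ExZ; last exact: bmf_int.
have h1 : Ex P (fun w => sq n k w * dN n k w ^+ 2) <= L * mesh n * (L * t0).
  apply: le_trans (@Ex_sq_incr_le n k _ kn (msq kn') bs _) _.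
    by move=> w; apply: sumr_ge0 => i _; exact: sqr_ge0.
  rewrite ler_wpM2l ?mulr_ge0//.
  by rewrite (le_trans (Ex_sq_le kn'))// ler_wpM2l// meshM.
have h2 : Ex P (fun w => dN n k w ^+ 2 * dN n k w ^+ 2) <= W ^+ 2 * (L * mesh n).
  apply: (@le_trans _ _ (Ex P (fun w => W ^+ 2 * (1 * dN n k w ^+ 2)))).
    apply: Ex_le; first exact: bmf_int.
      by apply: intRZ; apply: intRZ; apply: bmf_int; exact: bmfX.
    by move=> w; rewrite mul1r ler_wpM2r ?sqr_ge0.
  rewrite ExZ; last by apply: intRZ; apply: bmf_int; exact: bmfX.
  rewrite ler_wpM2l ?sqr_ge0//.
  have := @Ex_sq_incr_le n k (fun=> 1) kn (measurable_cst _) (bmf_cst _) (fun=> ler01).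
  by rewrite Ex_cst mulr1.
rewrite -natr1; have := IH kn'.
by move: h1 h2; lra.
Qed.

Hypothesis cN : forall w, continuous (N^~ w).

Lemma osc_small w (e : R) : 0 < e -> \forall n \near \oo, forall i, (i <= n)%N ->
  `|dN n i w| <= e.
Proof.
move=> e0; have [dl dl0 h] := unif_continuous_segment 0 t0 (@cN w) e0.
have : (t0 / n.+1%:R) @[n --> \oo] --> (0 : R).
  rewrite -[X in _ --> X](mulr0 t0).
  by apply: cvgM; [exact: cvg_cst|exact: cvg_harmonic].
move/cvgr_lt/(_ dl dl0); apply: filterS => n hn i i_n.
rewrite distrC ltW// h//; first by rewrite pt_ge0 pt_le// ltnW.
by rewrite distrC ger0_norm ?subr_ge0// gridptS subr0.
Qed.

(** The increments become small on each path, but at a rate depending on the path. The second moment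
    of the sums of squares controls what happens on the exceptional event. *)
Lemma Ex_cube_cvg0 : Ex P (fun w => \sum_(i < n.+1) `|dN n i w| ^+ 3) @[n --> \oo] --> (0 : R).
Proof.
have [B NB] : exists B, forall t w, 0 <= t -> t <= t0 -> `|N t w| <= B by case: bN.
pose W := 2 * `|B| + 1.
have NW s t w : 0 <= s -> s <= t0 -> 0 <= t -> t <= t0 -> `|N t w - N s w| <= W.
  move=> s0 st0 t_ge0 tt0; rewrite (le_trans (ler_normB _ _))//.
  have := NB t w t_ge0 tt0; have := NB s w s0 st0; have := ler_norm B.
  by rewrite /W; lra.
have W0 : 0 < W by rewrite /W ltr_wpDl// mulr_ge0.
pose C n w := \sum_(i < n.+1) `|dN n i w| ^+ 3.
have bC n : bmf (C n).
  by apply: bmf_sum => i; apply: bmfX; apply: bmf_norm; apply: bdN; rewrite -ltnS.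
have bS n : bmf (sq n n.+1) by exact: bsq.
pose K := L * t0 * (2 * L * t0 + W ^+ 2).
have ES n : Ex P (sq n n.+1) <= L * t0.
  by rewrite (le_trans (Ex_sq_le (leqnn _)))// ler_wpM2l// meshM.
have ESS n : Ex P (fun w => sq n n.+1 w ^+ 2) <= K.
  rewrite (le_trans (Ex_sqsq_le NW (leqnn _)))// /K ler_wpM2r//.
    by rewrite addr_ge0 ?sqr_ge0// !mulr_ge0.
  by rewrite ler_wpM2l// meshM.
have K0 : 0 <= K by rewrite /K !mulr_ge0// addr_ge0 ?sqr_ge0// !mulr_ge0.
have sq0 n w : 0 <= sq n n.+1 w by apply: sumr_ge0 => i _; exact: sqr_ge0.
have CW n w : C n w <= W * sq n n.+1 w.
  rewrite /C /sq mulr_sumr; apply: ler_sum => i _.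
  rewrite exprS real_normK ?num_real// ler_wpM2r ?sqr_ge0//.
  by apply: NW => //; apply: pt_le; [exact: ltnW|].
apply/cvgrPdist_le => e e0.
(* [e1] here and [th] below make each of the three terms of [pointwise] have mean at most [e / 4];
   the added 1 avoids dividing by 0. *)
pose e1 := e / (4 * (L * t0 + 1)).
have Lt0 : 0 <= L * t0 by rewrite mulr_ge0.
have e10 : 0 < e1 by rewrite divr_gt0// mulr_gt0// ltr_wpDl.
pose th := e / (2 * W * (K + 1)).
have th0 : 0 < th by rewrite divr_gt0// !mulr_gt0// ltr_wpDl.
(* The event where the grid is still too coarse for the path; by uniform continuity every path
   leaves it for large [n]. *)
pose J n := [set w | e1 * sq n n.+1 w < C n w].
have mJ n : measurable (J n).
  rewrite (_ : J n = setT `&` (fun w => C n w - e1 * sq n n.+1 w) @^-1` `]0, +oo[).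
    apply: (proj1 (bmfB (bC n) (bmfM (bmf_cst e1) (bS n)))) => //.
  by apply/seteqP; split => w; rewrite /J /= in_itv/= andbT subr_gt0 //; case.
have bJ n : bmf (\1_(J n) : Omega -> R) by exact: bmf_indic.
have J0 : Ex P (\1_(J n) : Omega -> R) @[n --> \oo] --> (0 : R).
  rewrite -[X in _ --> X](Ex_cst P).
  apply: (proj2 (@Ex_bct _ _ _ P (fun n => \1_(J n)) _ 1 _ _ _)).
  - by move=> n; exact: (proj1 (bJ n)).
  - move=> w; apply: cvg_near_cst; have := osc_small w e10; apply: filterS => n hn.
    rewrite /J indic_setb ltNge (_ : (_ <= _) = true)//.
    rewrite /C /sq mulr_sumr; apply: ler_sum => i _.
    by rewrite exprS real_normK ?num_real// ler_wpM2r ?sqr_ge0// hn// -ltnS.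
  - by move=> n w; rewrite indic_if; case: ifP; rewrite ?normr1 ?normr0.
have near_J : \forall n \near \oo, Ex P (\1_(J n) : Omega -> R) <= e * th / (2 * W).
  have : 0 < e * th / (2 * W) by rewrite divr_gt0// mulr_gt0.
  by move=> /(cvgr_lt _ J0); apply: filterS => n /ltW.
apply: filterS near_J => n hJ.
have C0 w : 0 <= C n w by apply: sumr_ge0 => i _; exact: exprn_ge0.
rewrite sub0r normrN ger0_norm; last exact: Ex_ge0.
(* C <= e1 S + W S 1_J, and S 1_J <= (1_J / th + th S^2) / 2 *)
have pointwise w : C n w <= e1 * sq n n.+1 w +
    (W / (2 * th) * \1_(J n) w + W * th / 2 * sq n n.+1 w ^+ 2).
  have amgm : 0 <= W / (2 * th) * (1 - th * sq n n.+1 w) ^+ 2.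
    by rewrite mulr_ge0 ?sqr_ge0// ltW// divr_gt0// mulr_gt0.
  rewrite /J indic_setb; case: ltP => h.
    rewrite (le_trans (CW n w))//.
    have -> : W / (2 * th) * 1 + W * th / 2 * sq n n.+1 w ^+ 2 =
        W * sq n n.+1 w + W / (2 * th) * (1 - th * sq n n.+1 w) ^+ 2.
      by have := lt0r_neq0 th0; move=> ?; field.
    by have := mulr_ge0 (ltW e10) (sq0 n w); move: amgm; lra.
  rewrite (le_trans h)// lerDl mulr0 add0r mulr_ge0 ?sqr_ge0//.
  by rewrite ltW// divr_gt0// mulr_gt0.
apply: (@le_trans _ _ (e1 * Ex P (sq n n.+1) + (W / (2 * th) * Ex P (\1_(J n) : Omega -> R) +
    W * th / 2 * Ex P (fun w => sq n n.+1 w ^+ 2)))).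
  have i1 : intR P (fun w => e1 * sq n n.+1 w) by apply: intRZ; exact: bmf_int.
  have i2 : intR P (fun w => W / (2 * th) * \1_(J n) w) by apply: intRZ; exact: bmf_int.
  have i3 : intR P (fun w => W * th / 2 * sq n n.+1 w ^+ 2).
    by apply: intRZ; exact/bmf_int/bmfX.
  rewrite -!ExZ; [|exact/bmf_int/bmfX|exact: bmf_int|exact: bmf_int].
  rewrite -(ExD i2 i3) -(ExD i1 (intRD i2 i3)).
  by apply: Ex_le; [exact: bmf_int (bC n)|exact: intRD i1 (intRD i2 i3)|exact: pointwise].
have t1 : e1 * Ex P (sq n n.+1) <= e / 4.
  rewrite (le_trans (ler_wpM2l (ltW e10) (ES n)))// /e1 mulrAC ler_pdivrMr.
    by move: e0; lra.
  by rewrite mulr_gt0// ltr_wpDl.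
have t2 : W / (2 * th) * Ex P (\1_(J n) : Omega -> R) <= e / 4.
  apply: le_trans (ler_wpM2l _ hJ) _; first by rewrite ltW// divr_gt0// mulr_gt0.
  rewrite le_eqVlt; apply/orP; left; apply/eqP.
  by have := lt0r_neq0 th0; have := lt0r_neq0 W0 => ? ?; field; apply/andP.
have t3 : W * th / 2 * Ex P (fun w => sq n n.+1 w ^+ 2) <= e / 4.
  apply: le_trans (ler_wpM2l _ (ESS n)) _; first by rewrite ltW// divr_gt0// mulr_gt0.
  have -> : W * th / 2 * K = e * K / (4 * (K + 1)).
    have := lt0r_neq0 W0; have : K + 1 != 0 by rewrite gt_eqF// ltr_wpDl.
    by rewrite /th => ? ?; field; apply/andP.
  rewrite ler_pdivrMr; first by move: e0; lra.
  by rewrite mulr_gt0// ltr_wpDl.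
by move: t1 t2 t3 e0; lra.
Qed.

Let telescope_gridpt n (f : R -> R) :
  f t0 - f 0 = \sum_(i < n.+1) (f (pt n i.+1) - f (pt n i)).
Proof.
rewrite -(big_mkord xpredT (fun i => f (pt n i.+1) - f (pt n i))) telescope_sumr//.
by rewrite gridpt_last gridpt0.
Qed.

(* The inequality half of Ito's formula. *)
Lemma ito_le (a b D K : R) (g p q : R -> R) (tau : R -> Omega -> R) :
  (forall w t, 0 <= t -> t <= t0 -> a <= N t w <= b) ->
  measurable_fun setT g -> measurable_fun setT p -> measurable_fun setT q ->
  (exists B, forall x, a <= x <= b -> [/\ `|g x| <= B, `|p x| <= B & `|q x| <= B]) ->
  0 <= K ->
  (forall x y, a <= x <= b -> a <= y <= b ->
    g y - g x <= p x * (y - x) + q x * (y - x) ^+ 2 + K * `|y - x| ^+ 3) ->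
  (forall t, 0 <= t -> t <= t0 -> bmf (tau t)) ->
  (forall w, exists2 dl : R, 0 < dl & forall s t, 0 <= s -> s <= t -> t <= t0 -> t - s < dl ->
     q (N s w) * (Q t w - Q s w) <= D * (tau t w - tau s w)) ->
  Ex P (fun w => g (N t0 w)) - Ex P (fun w => g (N 0 w)) <=
    D * (Ex P (tau t0) - Ex P (tau 0)).
Proof.
move=> Nab mg_ mp mq [B gB] K0 taylor btau Dloc.
have Nab' n i w : (i <= n.+1)%N -> a <= N (pt n i) w <= b.
  by move=> i_n; apply: Nab => //; exact: pt_le.
have bcomp (f : R -> R) t : measurable_fun setT f -> (forall x, a <= x <= b -> `|f x| <= B) ->
    0 <= t -> t <= t0 -> bmf (fun w => f (N t w)).
  move=> mf fB ht tt0; split; last by exists B => w; apply: fB; exact: Nab.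
  by apply: measurableT_comp => //; exact: (proj1 (bmg_bmf usualF bN ht tt0)).
have bg t : 0 <= t -> t <= t0 -> bmf (fun w => g (N t w)).
  by apply: bcomp => // x /gB[].
have bp t : 0 <= t -> t <= t0 -> bmf (fun w => p (N t w)).
  by apply: bcomp => // x /gB[].
have bq t : 0 <= t -> t <= t0 -> bmf (fun w => q (N t w)).
  by apply: bcomp => // x /gB[].
have bpt (f : R -> Omega -> R) n i : (forall t, 0 <= t -> t <= t0 -> bmf (f t)) ->
    (i <= n.+1)%N -> bmf (f (pt n i)) by move=> h i_n; apply: h => //; exact: pt_le.
have bQ' t : 0 <= t -> t <= t0 -> bmf (Q t) by exact: Q_bmf.
pose dQ n i w := Q (pt n i.+1) w - Q (pt n i) w.
have bdQ n (i : 'I_n.+1) : bmf (dQ n i).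
  by apply: bmfB; apply: bpt => //; exact: ltnW.
have bpN n (i : 'I_n.+1) : bmf (fun w => p (N (pt n i) w)).
  by apply: (bpt (fun t w => p (N t w))) => //; exact: ltnW.
have bqN n (i : 'I_n.+1) : bmf (fun w => q (N (pt n i) w)).
  by apply: (bpt (fun t w => q (N t w))) => //; exact: ltnW.
have bdN' n (i : 'I_n.+1) : bmf (dN n i) by apply: bdN; rewrite -ltnS.
pose A n w := \sum_(i < n.+1) q (N (pt n i) w) * dQ n i w.
pose C n w := \sum_(i < n.+1) `|dN n i w| ^+ 3.
have bC n : bmf (C n) by apply: bmf_sum => i; apply: bmfX; exact: bmf_norm.
have bA n : bmf (A n) by apply: bmf_sum => i; apply: bmfM.
pose Z n w := \sum_(i < n.+1) p (N (pt n i) w) * dN n i w.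
pose Y n w := \sum_(i < n.+1) q (N (pt n i) w) * dN n i w ^+ 2.
(* First-order terms are martingale increments multiplied by a factor known at the left end of the
   step. *)
have EZ n : Ex P (Z n) = 0.
  rewrite /Z Ex_sum => [|i]; last by apply: bmf_int; exact: bmfM.
  rewrite big1// => i _; apply: (bmg_incr usualF bN) => //; first exact: (@pt_le n i.+1).
  by apply: measurableT_comp => //; apply: mN; exact: ltnW.
have EY n : Ex P (Y n) = Ex P (A n).
  rewrite /Y /A !Ex_sum; [|by move=> i; apply: bmf_int; apply: bmfM => //; exact: bmfX..].
  apply: eq_bigr => i _; apply: Ex_sq_incr => //; first by rewrite -ltnS.
  by apply: measurableT_comp => //; apply: mN; exact: ltnW.
have bZ n : bmf (Z n) by apply: bmf_sum => i; exact: bmfM.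
have bY n : bmf (Y n) by apply: bmf_sum => i; apply: bmfM => //; exact: bmfX.
have step n : Ex P (fun w => g (N t0 w)) - Ex P (fun w => g (N 0 w)) <=
    Ex P (A n) + K * Ex P (C n).
  have -> : Ex P (A n) + K * Ex P (C n) = Ex P (fun w => Z n w + Y n w + K * C n w).
    rewrite ExD; [|by apply: intRD; exact: bmf_int|by apply: intRZ; exact: bmf_int].
    by rewrite ExD ?ExZ ?EZ ?add0r ?EY//; exact: bmf_int.
  rewrite -ExB; [|by apply: bmf_int; exact: bg..].
  apply: Ex_le.
  - by apply: bmf_int; apply: bmfB; exact: bg.
  - by apply: intRD; [apply: intRD; exact: bmf_int|apply: intRZ; exact: bmf_int].
  - move=> w; rewrite (telescope_gridpt n (fun t => g (N t w))).
    rewrite /Z /Y /C mulr_sumr -!big_split/=; apply: ler_sum => i _.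
    by apply: taylor; apply: Nab' => //; exact: ltnW.
pose dtau w := tau t0 w - tau 0 w.
have bdtau : bmf dtau by apply: bmfB; exact: btau.
(* [q * dQ] is compared with the clock [tau] only for meshes below a threshold that depends on the
   path. The positive part [E n] is bounded and eventually 0 on each path, so its mean tends to
   0. *)
pose E n w := Num.max (A n w - D * dtau w) 0.
have A_le n w : `|A n w| <= `|B| * (L * t0).
  rewrite /A (le_trans (ler_norm_sum _ _ _))//.
  have -> : `|B| * (L * t0) = \sum_(i < n.+1) `|B| * (L * mesh n).
    rewrite sumr_const card_ord -[RHS]mulr_natr -!mulrA; congr (_ * (_ * _)).
    by rewrite mulVf ?mulr1// pnatr_eq0.
  apply: ler_sum => i _; rewrite normrM ler_pM//.
    have [_ _ h] := gB _ (Nab' n i w (ltnW (ltn_ord i))).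
    by rewrite (le_trans h)// ler_norm.
  have /andP[h1 h2] := QL w (pt_ge0 n i) (pt_leS n i) (@pt_le n i.+1 (ltn_ord i)).
  by rewrite ger0_norm// (le_trans h2)// gridptS subr0.
have [_ [B2 dB2]] := bdtau.
have E_le n w : `|E n w| <= `|B| * (L * t0) + `|D| * B2.
  have h2 : `|D * dtau w| <= `|D| * B2 by rewrite normrM ler_wpM2l.
  have h3 : `|A n w - D * dtau w| <= `|B| * (L * t0) + `|D| * B2.
    by rewrite (le_trans (ler_normB _ _))// lerD.
  by rewrite /E maxEle; case: ifP => _; rewrite ?normr0// (le_trans (normr_ge0 _) h3).
have E0 : Ex P (E n) @[n --> \oo] --> (0 : R).
  rewrite -[X in _ --> X](Ex_cst P).
  apply: (proj2 (@Ex_bct _ _ _ P E _ (`|B| * (L * t0) + `|D| * B2) _ _ _)).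
  - move=> n; apply: measurable_maxr; last exact: measurable_cst.
    exact: (proj1 (bmfB (bA n) (bmfM (bmf_cst D) bdtau))).
  - move=> w; apply: cvg_near_cst; have [dl dl0 h] := Dloc w.
    have : (t0 / n.+1%:R) @[n --> \oo] --> (0 : R).
      rewrite -[X in _ --> X](mulr0 t0).
      by apply: cvgM; [exact: cvg_cst|exact: cvg_harmonic].
    move/cvgr_lt/(_ dl dl0); apply: filterS => n hn.
    apply/eqP; rewrite /E eq_le le_max lexx orbT andbT ge_max lexx andbT subr_le0.
    rewrite /A /dtau (telescope_gridpt n (fun t => tau t w)).
    rewrite mulr_sumr; apply: ler_sum => i _; apply: h => //; first exact: (@pt_le n i.+1).
    by rewrite gridptS subr0.
  - exact: E_le.
have bE n : bmf (E n).
  split; last by exists (`|B| * (L * t0) + `|D| * B2); exact: E_le.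
  apply: measurable_maxr; last exact: measurable_cst.
  exact: (proj1 (bmfB (bA n) (bmfM (bmf_cst D) bdtau))).
have step2 n : Ex P (fun w => g (N t0 w)) - Ex P (fun w => g (N 0 w)) - D * Ex P dtau <=
    Ex P (E n) + K * Ex P (C n).
  rewrite lerBlDr (le_trans (step n))// addrAC lerD2r -ExZ; last exact: bmf_int.
  rewrite -ExD; [|exact: bmf_int|by apply: intRZ; exact: bmf_int].
  apply: Ex_le; first exact: bmf_int.
    by apply: intRD; [exact: bmf_int|apply: intRZ; exact: bmf_int].
  by move=> w; rewrite -lerBlDr /E le_max lexx.
have lim0 : Ex P (E n) + K * Ex P (C n) @[n --> \oo] --> (0 : R).
  rewrite -[X in _ --> X](_ : 0 + K * 0 = 0); last by rewrite mulr0 addr0.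
  apply: cvgD => //; apply: cvgMr; exact: Ex_cube_cvg0.
have -> : Ex P (tau t0) - Ex P (tau 0) = Ex P dtau.
  by rewrite /dtau ExB//; exact/bmf_int/btau.
rewrite -subr_le0 -[leRHS](cvg_lim _ lim0)//; apply: limr_ge; first by apply/cvg_ex; exists 0.
exact: nearW.
Qed.

End TaylorSums.

(** * Hitting times of continuous adapted processes *)

Section HittingTime.
Context {R : realType} {d : measure_display} {Omega : measurableType d}.
Variables (P : probability Omega R) (F : R -> set_system Omega).
Hypothesis usualF : usual_conditions P F.
Variables (Y : R -> Omega -> R) (t0 : R).
Hypothesis cY : forall w, continuous (Y ^~ w).
Hypothesis aY : forall t : R, 0 <= t -> Fm F t (Y t).
Hypothesis t0_ge0 : 0 <= t0.

(** Including [t0] caps the hitting time there and keeps the infimum over a nonempty set. *)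
Definition hit_set w : set R := [set t | 0 <= t <= t0 /\ (0 <= Y t w \/ t = t0)].

Definition hit w : R := inf (hit_set w).

Let hit_has_inf w : has_inf (hit_set w).
Proof.
split; first by exists t0; split; [rewrite t0_ge0 lexx|right].
by exists 0 => t [/andP[]].
Qed.

Lemma hit_ge0 w : 0 <= hit w.
Proof.
by apply: lb_le_inf; [case: (hit_has_inf w)|move=> t [/andP[]]].
Qed.

Lemma hit_le w : hit w <= t0.
Proof.
apply: ge_inf; first by case: (hit_has_inf w).
by split; [rewrite t0_ge0 lexx|right].
Qed.

Lemma hit_lt_neg w s : 0 <= s -> s < hit w -> Y s w < 0.
Proof.
move=> s0 sh; rewrite ltNge; apply/negP => Ys.
have : hit w <= s.
  apply: ge_inf; first by case: (hit_has_inf w).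
  by split; [rewrite s0 (le_trans (ltW sh) (hit_le w))|left].
by rewrite leNgt sh.
Qed.

(** At the hitting time itself the sign follows by continuity from the left, or from the assumption
    at time 0 when the hitting is immediate. *)
Lemma hit_le_npos w s : Y 0 w <= 0 -> 0 <= s -> s <= hit w -> Y s w <= 0.
Proof.
move=> Y0 s0; rewrite le_eqVlt => /predU1P[->|]; last by move=> /(hit_lt_neg s0)/ltW.
have [<-//|h0] := eqVneq 0 (hit w).
have {}h0 : 0 < hit w by rewrite lt_neqAle h0 hit_ge0.
have cw : Y (hit w - hit w * n.+1%:R^-1) w @[n --> \oo] --> Y (hit w) w.
  apply: (cvg_comp (fun n : nat => hit w - hit w * n.+1%:R^-1) (Y^~ w) _ (@cY w _)).
  suff : hit w - hit w * n.+1%:R^-1 @[n --> \oo] --> hit w by [].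
  rewrite -[X in _ --> X]subr0; apply: cvgB; first exact: cvg_cst.
  rewrite -[X in _ --> X](mulr0 (hit w)); apply: cvgMr.
  exact: cvg_harmonic.
rewrite -(cvg_lim _ cw)//; apply: limr_le; first by apply/cvg_ex; exists (Y (hit w) w).
apply: nearW => n; apply/ltW/hit_lt_neg.
  by rewrite subr_ge0 ler_pdivrMr ?ltr0n// ler_peMr ?ler1n ?ltW.
by rewrite ltrBlDr ltrDl mulr_gt0// invr_gt0 ltr0n.
Qed.

Lemma hit_lt_end w : hit w < t0 -> 0 <= Y (hit w) w.
Proof.
move=> ht; rewrite leNgt; apply/negP => Yh.
have /cvgr_lt/(_ 0 Yh) := @cY w (hit w).
move=> /nbhs_ballP[r /= r0 hr].
pose r' := Num.min r (t0 - hit w).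
have r'0 : 0 < r' by rewrite lt_min r0 subr_gt0.
have [t [/andP[h1 h2] ht']] : exists2 t, hit_set w t & t < hit w + r'.
  have [t ? ?] := inf_adherent r'0 (hit_has_inf w).
  by exists t.
move=> tlt.
have tge : hit w <= t.
  by apply: ge_inf; [case: (hit_has_inf w)|split => //; rewrite h1].
case: ht' => [Yt|tt0].
  have : Y t w < 0.
    apply: hr; rewrite /ball/= distrC ger0_norm ?subr_ge0//.
    by rewrite ltrBlDl (lt_le_trans tlt)// lerD2l ge_min lexx.
  by rewrite ltNge Yt.
move: tlt; rewrite tt0 ltNge => /negP; apply.
by rewrite -lerBrDl ge_min lexx orbT.
Qed.

(** For [r < t0], compactness of [[0, r]] shows that a nonnegative value is attained exactly when,
    for every [m], some grid point carries a value above [- 1 / (m + 1)]. Only countably many times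
    up to [r] are involved. *)
Lemma hit_rtime : rtime F hit.
Proof.
split=> [w|r r0]; first exact: hit_ge0.
case: (leP t0 r) => [t0r|rt0].
  rewrite (_ : [set w | _] = setT); first exact: (F_T usualF).
  by apply/seteqP; split => w //= _; rewrite (le_trans (hit_le w)).
rewrite (_ : [set w | _] = \bigcap_m \bigcup_n \bigcup_(i in [set i : nat | (i <= n.+1)%N])
    [set w | - m.+1%:R^-1 < Y (gridpt 0 r n i) w]).
  apply: (F_cap usualF) => // m; apply: (F_cup usualF) => // n.
  rewrite (F_measE usualF)//; apply: bigcup_measurable => i /= i_n.
  rewrite -(F_measE usualF)//.
  have le_r : gridpt 0 r n i <= r by exact: gridpt_le_end.
  have g0 : 0 <= gridpt 0 r n i by exact: gridpt_ge.
  apply: (F_mono usualF g0 le_r).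
  rewrite (_ : [set w | _] = Y (gridpt 0 r n i) @^-1` `]- m.+1%:R^-1, +oo[).
    by apply: (Fm_pre usualF) => //; exact: aY.
  by apply/seteqP; split => w /=; rewrite in_itv/= andbT.
apply/seteqP; split => w /=.
  move=> hr m _.
  have ht : hit w < t0 by exact: le_lt_trans rt0.
  have Yh := hit_lt_end ht.
  have [h0|h0] := eqVneq 0 (hit w).
    exists 0%N => //; exists 0%N => //=; rewrite gridpt0 h0 (lt_le_trans _ Yh)//.
  have {}h0 : 0 < hit w by rewrite lt_neqAle h0 hit_ge0.
  have hr' : hit w <= r by [].
  have m0 : - m.+1%:R^-1 < Y (hit w) w by rewrite (lt_le_trans _ Yh)// oppr_lt0 invr_gt0.
  have /cvgr_gt/(_ _ m0) := @cY w (hit w); move=> /nbhs_ballP[e /= e0 he].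
  have mesh0 : (r - 0) / n.+1%:R @[n --> \oo] --> (0 : R).
    rewrite -[X in _ --> X](mulr0 (r - 0)).
    by apply: cvgM; [exact: cvg_cst|exact: cvg_harmonic].
  have [n _ hn] := cvgr_lt _ mesh0 _ e0.
  have [i [i_n h1 h2]] := @gridpt_near _ 0 r (hit w) n (introT andP (conj h0 hr')).
  exists n => //; exists i.+1 => //=; apply: he; rewrite /ball/= distrC ger0_norm ?subr_ge0//.
  rewrite (le_lt_trans _ (hn n (leqnn n)))//= -(gridptS 0 r n i).
  by rewrite lerD2l lerN2 ltW.
move=> h; have [c c_in hc] := @EVT_max R (Y^~ w) 0 r r0 (continuous_subspaceT (@cY w)).
have Yc : 0 <= Y c w.
  rewrite leNgt; apply/negP => Yc.
  have Yc' : 0 < - Y c w by rewrite oppr_gt0.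
  have [n nY] : exists n : nat, n.+1%:R^-1 < - Y c w.
    by have [n _ hn] := near_infty_natSinv_lt (PosNum Yc'); exists n; exact: (hn n (leqnn n)).
  have [k _ [i /= i_k hi]] := h n I.
  have : Y (gridpt 0 r k i) w <= Y c w.
    by apply: hc; rewrite in_itv/= gridpt_ge//= gridpt_le_end.
  move=> /(lt_le_trans hi); rewrite ltrNl => /(lt_trans nY); rewrite ltxx.
  by [].
move: c_in; rewrite in_itv/= => /andP[c0 cr].
apply: (le_trans _ cr); apply: ge_inf; first by case: (hit_has_inf w).
by split; [rewrite c0 (le_trans cr (ltW rt0))|left].
Qed.

End HittingTime.

(** * A scalar extinction criterion *)

Section Core.
Context {R : realType} {d : measure_display} {Omega : measurableType d}.
Variables (P : probability Omega R) (F : R -> set_system Omega).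
Hypothesis usualF : usual_conditions P F.
Variables (m : R) (U Q M M2 : R -> Omega -> R) (S : R -> R).
Hypothesis m_gt0 : 0 < m.
Hypothesis cU : forall w, continuous (U ^~ w).
Hypothesis U0 : forall w, U 0 w = m.
Hypothesis U_ge0 : forall t w, 0 <= U t w.
Hypothesis Mloc : continuous_local_martingale P F M.
Hypothesis UM : {ae P, forall w, forall t, 0 <= t -> U t w - m = M t w}.
Hypothesis M2loc : continuous_local_martingale P F M2.
Hypothesis UM2 : {ae P, forall w, forall t, 0 <= t -> (U t w - m) ^+ 2 - Q t w = M2 t w}.
Hypothesis cQ : forall w, continuous (Q ^~ w).
Hypothesis Q0 : forall w, Q 0 w = 0.
Hypothesis S_ge0 : forall x : R, 0 <= x -> 0 <= S x.
(* [Q] plays the role of the integral of [S (U r)] for [r] in [0, t]. *)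
Hypothesis Q_ge : forall w s t lo, 0 <= s -> s <= t -> 0 <= lo ->
  (forall r, s <= r <= t -> lo <= U r w) -> S lo * (t - s) <= Q t w - Q s w.
Hypothesis Q_le : forall w s t hi, 0 <= s -> s <= t ->
  (forall r, s <= r <= t -> U r w <= hi) -> Q t w - Q s w <= S hi * (t - s).

Let Um_Fm (t : R) : 0 <= t -> Fm F t (fun w => U t w - m).
Proof.
move=> t0; case: Mloc => aM _ _.
exact: (adapted_version usualF aM (N := fun t w => U t w - m) UM).
Qed.

Lemma U_Fm (t : R) : 0 <= t -> Fm F t (U t).
Proof.
move=> t0; rewrite (_ : U t = fun w => (U t w - m) + m); last by apply/funext => w; rewrite subrK.
by apply: measurable_funD; [exact: Um_Fm|exact: measurable_cst].
Qed.

Section Exit.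
Variables (a b t0 : R).
Hypothesis am : a < m.
Hypothesis mb : m < b.
Hypothesis t0_ge0 : 0 <= t0.

Let Y t w := Num.max (a - U t w) (U t w - b).

(** First exit of [U] from []a, b[], capped at [t0]; taking the larger of [a - U] and [U - b]
    reduces two-sided exit to one hitting time. *)
Definition exit_time := hit Y t0.

Let T := exit_time.

Let cY w : continuous (Y ^~ w).
Proof.
suff : continuous (fun t => Num.max (a - U t w) (U t w - b)) by [].
move=> t; apply: (@continuous_max _ _ (fun t => a - U t w) (fun t => U t w - b)).
  by apply: cvgB; [exact: cvg_cst|exact: cU].
by apply: cvgB; [exact: cU|exact: cvg_cst].
Qed.

Let aY (t : R) : 0 <= t -> Fm F t (Y t).
Proof.
move=> ht; apply: measurable_maxr.
  by apply: measurable_funB; [exact: measurable_cst|exact: U_Fm].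
by apply: measurable_funB; [exact: U_Fm|exact: measurable_cst].
Qed.

Lemma exit_time_rtime : rtime F T.
Proof. exact: (hit_rtime usualF). Qed.

Lemma exit_time_ge0 w : 0 <= T w. Proof. exact: hit_ge0. Qed.

Lemma exit_time_le w : T w <= t0. Proof. exact: hit_le. Qed.

Lemma before_exit w s : 0 <= s -> s < T w -> a < U s w < b.
Proof.
move=> s0 sT; have := hit_lt_neg t0_ge0 s0 sT.
by rewrite /Y gt_max !subr_lt0 => /andP[-> ->].
Qed.

Lemma upto_exit w s : 0 <= s -> s <= T w -> a <= U s w <= b.
Proof.
move=> s0 sT; have : Y 0 w <= 0 by rewrite /Y ge_max !subr_le0 U0 !ltW.
move=> /(hit_le_npos cY t0_ge0)/(_ s0 sT).
by rewrite /Y ge_max !subr_le0.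
Qed.

Lemma at_exit w : T w < t0 -> U (T w) w <= a \/ b <= U (T w) w.
Proof.
move=> /(hit_lt_end cY t0_ge0); rewrite /Y le_max !subr_ge0 => /orP[]; first by left.
by right.
Qed.

Lemma stopped_bounds w t : 0 <= t -> a <= U (Num.min (T w) t) w <= b.
Proof.
move=> ht; apply: upto_exit; first by rewrite le_min ht exit_time_ge0.
by rewrite ge_min lexx.
Qed.

Lemma stopped_Q_bounds w s t : 0 <= s -> s <= t ->
  0 <= Q (Num.min (T w) t) w - Q (Num.min (T w) s) w <= S b * (t - s).
Proof.
move=> s0 st.
have T0 := exit_time_ge0 w.
have h0 : 0 <= Num.min (T w) s by rewrite le_min s0 T0.
have h1 : Num.min (T w) s <= Num.min (T w) t by rewrite le_min !ge_min lexx st !orbT.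
have h2 : Num.min (T w) t - Num.min (T w) s <= t - s.
  by case: (leP (T w) s); case: (leP (T w) t); lra.
have b0 : 0 <= b by rewrite ltW// (lt_trans _ mb).
apply/andP; split.
  have := Q_ge h0 h1 (lexx 0) (fun r _ => U_ge0 r w).
  by apply: le_trans; rewrite mulr_ge0 ?subr_ge0// S_ge0.
apply: le_trans (ler_wpM2l (S_ge0 b0) h2).
apply: Q_le => // r /andP[r1 r2].
have rT : r <= T w by rewrite (le_trans r2)// ge_min lexx.
by have /andP[] := upto_exit (le_trans h0 r1) rT.
Qed.

Let V t w := U (Num.min (T w) t) w - m.

Lemma stopped_bmg : bmg P F t0 V.
Proof.
have cN w : continuous ((fun t w => U t w - m)^~ w).
  by move=> t; apply: cvgB; [exact: cU|exact: cvg_cst].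
have VB t w : 0 <= t -> `|V t w| <= `|a| + `|b| + `|m|.
  move=> ht; have /andP[h1 h2] := stopped_bounds w ht; rewrite /V.
  rewrite (le_trans (ler_normB _ _))// lerD2r ler_norml.
  have := ler_norm a; have := ler_norm (- a); have := ler_norm b; have := ler_norm (- b).
  by rewrite !normrN => ? ? ? ?; apply/andP; split; lra.
split.
- by move=> t ht _; apply: (stopped_Fm usualF cN Um_Fm exit_time_rtime ht).
- by exists (`|a| + `|b| + `|m|) => t w ht _; exact: VB.
- move=> s t A s0 st tt0 FA.
  apply: (local_martingale_stopped usualF Mloc cN UM _ exit_time_rtime s0 st _ FA (B := `|a| + `|b| + `|m|)).
    by move=> w; rewrite U0 subrr.
  by move=> w r r0 _; exact: VB.
Qed.

Lemma stopped_sq_bmg : bmg P F t0 (fun t w => V t w ^+ 2 - Q (Num.min (T w) t) w).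
Proof.
pose N t w := (U t w - m) ^+ 2 - Q t w.
have cN w : continuous (N ^~ w).
  move=> t; apply: cvgB; last exact: cQ.
  rewrite (_ : (fun x => _) = fun x => (U x w - m) * (U x w - m)); last by apply/funext => x; rewrite expr2.
  by rewrite expr2; apply: cvgM; apply: cvgB; (exact: cU || exact: cvg_cst).
pose B := (`|a| + `|b| + `|m|) ^+ 2 + S b * t0.
have NB t w : 0 <= t -> t <= t0 -> `|N (Num.min (T w) t) w| <= B.
  move=> ht tt0.
  have /andP[q1 q2] := stopped_Q_bounds w (lexx 0) ht.
  have e0 : Num.min (T w) 0 = 0 by rewrite min_r// exit_time_ge0.
  rewrite e0 Q0 !subr0 in q1 q2.
  rewrite (le_trans (ler_normB _ _))// lerD//.
    rewrite normrX ler_pXn2r ?nnegrE ?addr_ge0//.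
    have /andP[h1 h2] := stopped_bounds w ht.
    rewrite (le_trans (ler_normB _ _))// lerD2r ler_norml.
    have := ler_norm a; have := ler_norm (- a); have := ler_norm b; have := ler_norm (- b).
    by rewrite !normrN => ? ? ? ?; apply/andP; split; lra.
  rewrite ger0_norm// (le_trans q2)// ler_wpM2l// S_ge0//.
  by rewrite ltW// (lt_trans _ mb).
have aN : forall t : R, 0 <= t -> Fm F t (N t).
  by case: M2loc => aM _ _; exact: (adapted_version usualF aM UM2).
split.
- by move=> t ht _; apply: (stopped_Fm usualF cN aN exit_time_rtime ht).
- by exists B => t w ht tt0; exact: NB.
- move=> s t A s0 st tt0 FA.
  apply: (local_martingale_stopped usualF M2loc cN UM2 _ exit_time_rtime s0 st _ FA (B := B)).
    by move=> w; rewrite /N U0 subrr expr0n Q0 subrr.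
  by move=> w r r0 rt; apply: NB => //; exact: le_trans tt0.
Qed.

Lemma Ex_exit : Ex P (fun w => U (T w) w) = m.
Proof.
have [mV bV hV] := stopped_bmg.
have := hV 0 t0 setT (lexx 0) t0_ge0 (lexx t0) (F_T usualF (lexx 0)).
rewrite (_ : (fun w => \1_setT w * V 0 w) = fun=> 0); last first.
  by apply/funext => w; rewrite /V min_r ?exit_time_ge0// U0 subrr mulr0.
rewrite Ex_cst (_ : (fun w => \1_setT w * V t0 w) = fun w => U (T w) w - m); last first.
  by apply/funext => w; rewrite indicT mul1r /V min_l// exit_time_le.
have bUT : bmf (fun w => U (T w) w).
  rewrite (_ : (fun w => _) = fun w => V t0 w + m).
    by apply: bmfD; [exact: (bmg_bmf usualF stopped_bmg)|exact: bmf_cst].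
  by apply/funext => w; rewrite /V subrK min_l// exit_time_le.
rewrite ExB ?Ex_cst; [|exact: bmf_int|exact: intR_cst].
by move=> /esym/eqP; rewrite subr_eq0 => /eqP.
Qed.

(** The bounded martingale is the stopped [U - m], hence the shift of the test functions by [m]. The
    clock is [Num.min T t], whose total increment is [T]. *)
Lemma ito_exit (D K : R) (g p q : R -> R) :
  measurable_fun setT g -> measurable_fun setT p -> measurable_fun setT q ->
  (exists B, forall x, a <= x <= b -> [/\ `|g x| <= B, `|p x| <= B & `|q x| <= B]) ->
  0 <= K ->
  (forall x y, a <= x <= b -> a <= y <= b ->
    g y - g x <= p x * (y - x) + q x * (y - x) ^+ 2 + K * `|y - x| ^+ 3) ->
  (forall w, exists2 dl : R, 0 < dl & forall s t, 0 <= s -> s <= t -> t <= T w -> t - s < dl ->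
     q (U s w) * (Q t w - Q s w) <= D * (t - s)) ->
  Ex P (fun w => g (U (T w) w)) - g m <= D * Ex P T.
Proof.
move=> mg_ mp mq [B gB] K0 taylor Dloc.
pose sh (f : R -> R) x := f (x + m).
have msh (f : R -> R) : measurable_fun setT f -> measurable_fun setT (sh f).
  by move=> mf; apply: measurableT_comp => //; apply: measurable_funD.
have Sb0 : 0 <= S b by rewrite S_ge0// ltW// (lt_trans _ mb).
have mT : measurable_fun setT T by exact: (rtime_meas usualF exit_time_rtime).
have := @ito_le _ _ _ P F usualF t0 (S b) V (fun t w => Q (Num.min (T w) t) w)
  t0_ge0 Sb0 stopped_bmg stopped_sq_bmg _ _ (a - m) (b - m) D K (sh g) (sh p) (sh q)
  (fun t w => Num.min (T w) t).
have e1 : (fun w => sh g (V t0 w)) = fun w => g (U (T w) w).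
  by apply/funext => w; rewrite /sh /V subrK min_l// exit_time_le.
have e2 : (fun w => sh g (V 0 w)) = fun=> g m.
  by apply/funext => w; rewrite /sh /V subrK min_r ?exit_time_ge0// U0.
have e3 : (fun w => Num.min (T w) t0) = T.
  by apply/funext => w; rewrite min_l// exit_time_le.
have e4 : (fun w => Num.min (T w) 0) = fun=> 0.
  by apply/funext => w; rewrite min_r ?exit_time_ge0.
rewrite e1 e2 e3 e4 !Ex_cst subr0; apply => //; try exact: msh.
- by move=> w s t s0 st _; exact: stopped_Q_bounds.
- move=> w t; apply: cvgB; last exact: cvg_cst.
  apply: (@continuous_comp _ _ _ (fun t => Num.min (T w) t) (U^~ w)); last exact: cU.
  by apply: continuous_min; [exact: cvg_cst|exact: cvg_id].
- by move=> w t ht _; rewrite /V !lerD2r; exact: stopped_bounds.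
- exists B => x; rewrite -lerBlDr opprK => /andP[h1 h2]; apply: gB.
  by rewrite -lerBlDr h1 h2.
- move=> x y /andP[x1 x2] /andP[y1 y2].
  have -> : y - x = (y + m) - (x + m) by ring.
  by apply: taylor; apply/andP; split; lra.
- move=> t ht _; split; first by apply: measurable_minr => //; exact: measurable_cst.
  exists t => w; rewrite ger0_norm; first by rewrite ge_min lexx orbT.
  by rewrite le_min ht exit_time_ge0.
- move=> w; have [dl dl0 h] := Dloc w; exists dl => // s t s0 st tt0 ts.
  rewrite /sh /V subrK.
  have T0 := exit_time_ge0 w.
  have h0 : 0 <= Num.min (T w) s by rewrite le_min s0 T0.
  have h1 : Num.min (T w) s <= Num.min (T w) t by rewrite le_min !ge_min lexx st !orbT.
  have h2 : Num.min (T w) t - Num.min (T w) s <= t - s.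
    by case: (leP (T w) s); case: (leP (T w) t); lra.
  by apply: h => //; [rewrite ge_min lexx|exact: le_lt_trans ts].
Qed.

End Exit.

(* The second derivative of [x `^ (2 - gam)] is proportional to [- x `^ (- gam)], so its
   product with [S x >= c * x `^ gam] is below a negative constant independent of [a]. *)
Lemma exit_mean_le (c gam a b t0 : R) : 1 < gam < 2 -> 0 < c ->
  (forall x : R, 0 < x -> x <= b -> c * x `^ gam <= S x) ->
  0 < a -> a < m -> m < b -> 0 <= t0 ->
  (2 - gam) * (gam - 1) / 6 * c * 2^-1 `^ gam * Ex P (exit_time a b t0) <= m `^ (2 - gam).
Proof.
move=> /andP[gam1 gam2] c0 Sc a0 am mb t0_ge0.
set be := 2 - gam; set k := be * (gam - 1) / 6.
have be01 : 0 <= be <= 1 by rewrite /be; lra.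
have k0 : 0 < k by rewrite /k divr_gt0// mulr_gt0 /be ?subr_gt0.
have ek : k = be * (1 - be) / 6 by rewrite /k /be; field.
have b0 : 0 < b := lt_trans m_gt0 mb.
pose g (x : R) := x `^ be.
(* Inverses are written as powers with exponent -1, so their measurability is that of powers. *)
pose p (x : R) := be * (x `^ be * x `^ (-1)).
pose q (x : R) := - k * (x `^ be * (x `^ (-1)) ^+ 2).
pose K := k * (b `^ be * (a^-1) ^+ 3).
have mpow e : measurable_fun [set: R] (fun x : R => x `^ e) by exact: measurable_powR.
have pow_le x : 0 < x -> x <= b -> x `^ be <= b `^ be.
  move=> x0 xb; apply: ge0_ler_powR => //; rewrite ?nnegrE; [by case/andP: be01|exact: ltW|exact: ltW].
have inv_le x : a <= x -> 0 <= x^-1 <= a^-1.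
  move=> ax; rewrite invr_ge0 (le_trans (ltW a0) ax)/= lef_pV2//.
  by rewrite posrE (lt_le_trans a0).
have k_le : k <= 1.
  have : be * (gam - 1) <= 1 by rewrite -[leRHS]mulr1 ler_pM// /be; lra.
  by rewrite /k; lra.
have := @ito_exit a b t0 am mb t0_ge0 (- (k * c * 2^-1 `^ gam)) K g p q.
rewrite -/(g m); set ET := Ex P (exit_time a b t0) => /(_ _ _ _ _ _ _ _)h.
suff : Ex P (fun w => g (U (exit_time a b t0 w) w)) - g m <= - (k * c * 2^-1 `^ gam) * ET.
  have : 0 <= Ex P (fun w => g (U (exit_time a b t0 w) w)) by apply: Ex_ge0 => w; exact: powR_ge0.
  by rewrite /g; lra.
apply: h.
- exact: mpow.
- by apply: measurable_funM; [exact: measurable_cst|apply: measurable_funM].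
- apply: measurable_funM; first exact: measurable_cst.
  by apply: measurable_funM => //; exact: measurable_funX.
- exists (b `^ be + b `^ be * a^-1 + b `^ be * (a^-1) ^+ 2) => x /andP[ax xb].
  have x0 : 0 < x by exact: lt_le_trans ax.
  have B0 : 0 <= b `^ be := powR_ge0 _ _.
  have X0 : 0 <= x `^ be := powR_ge0 _ _.
  have /andP[i0 i1] := inv_le x ax.
  have A0 : 0 <= a^-1 by exact: le_trans i1.
  have h1 := pow_le x x0 xb.
  have h2 : x `^ be * x^-1 <= b `^ be * a^-1 by exact: ler_pM.
  have h3 : x `^ be * x^-1 ^+ 2 <= b `^ be * a^-1 ^+ 2.
    by apply: ler_pM => //; [exact: sqr_ge0|rewrite ler_pXn2r// nnegrE].
  have n2 : 0 <= x `^ be * x^-1 by rewrite mulr_ge0.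
  have n3 : 0 <= x `^ be * x^-1 ^+ 2 by rewrite mulr_ge0// sqr_ge0.
  have N2 := le_trans n2 h2; have N3 := le_trans n3 h3.
  have /andP[be0 be1] := be01.
  rewrite /g /p /q (powR_inv1 (ltW x0)); split.
  + by rewrite ger0_norm//; lra.
  + rewrite ger0_norm ?mulr_ge0//.
    have : be * (x `^ be / x) <= 1 * (b `^ be / a) by exact: ler_pM.
    by lra.
  + rewrite mulNr normrN (ger0_norm (mulr_ge0 (ltW k0) n3)).
    have : k * (x `^ be * x^-1 ^+ 2) <= 1 * (b `^ be * a^-1 ^+ 2) by apply: ler_pM => //; exact: ltW.
    by lra.
- by rewrite /K mulr_ge0 ?(ltW k0)// mulr_ge0 ?powR_ge0// exprn_ge0// invr_ge0 ltW.
(* The Taylor inequality is scale invariant: it is applied to the ratio [y / x] and multiplied by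
   the power of [x]. The condition [a <= x] bounds the cubic coefficient by [K]. *)
- move=> x y /andP[ax xb] /andP[ay yb].
  have x0 : 0 < x by exact: lt_le_trans ax.
  have y0 : 0 < y by exact: lt_le_trans ay.
  have r0 : 0 < y / x by rewrite divr_gt0.
  have := powR_taylor2 be01 r0; rewrite -ek => ht.
  have ey : y `^ be = x `^ be * (y / x) `^ be.
    by rewrite -powRM ?(ltW x0) ?(ltW r0)//; congr (_ `^ _); field; exact: lt0r_neq0.
  have er : y / x - 1 = (y - x) * x^-1 by field; exact: lt0r_neq0.
  have X0 : 0 <= x `^ be := powR_ge0 _ _.
  have := ler_wpM2l X0 ht; rewrite -ey er normrM exprMn => ht2.
  have h3 : k * (x `^ be * (`|y - x| ^+ 3 * `|x^-1| ^+ 3)) <= K * `|y - x| ^+ 3.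
    rewrite /K -mulrA ler_wpM2l ?(ltW k0)// mulrCA mulrC ler_wpM2r ?exprn_ge0//.
    have /andP[i0 i1] := inv_le x ax.
    apply: ler_pM; rewrite ?exprn_ge0//; first exact: pow_le.
    by rewrite ger0_norm// ler_pXn2r// nnegrE// (le_trans i0).
  rewrite /g /p /q (powR_inv1 (ltW x0)).
  by move: ht2 h3; lra.
(* Over short times [U] keeps at least half of its value, because this value is at least [a]; hence
   the power of [2^-1] in the constant. *)
- move=> w; have a20 : 0 < a / 2 by rewrite divr_gt0.
  have [dl dl0 hdl] := unif_continuous_segment 0 t0 (@cU w) a20.
  exists dl => // s t s0 st tT ts.
  have sT := le_trans st tT.
  have /andP[aU Ub] := upto_exit am mb t0_ge0 s0 sT.
  have U_gt0 : 0 < U s w by exact: lt_le_trans aU.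
  have lo r : s <= r <= t -> U s w / 2 <= U r w.
    move=> /andP[sr rt].
    have : `|U s w - U r w| < a / 2.
      apply: hdl; first by rewrite s0 (le_trans sT)// exit_time_le.
      by rewrite distrC ger0_norm ?subr_ge0// (le_lt_trans _ ts)// lerD2r.
    by rewrite ltr_norml => /andP[_ h1]; lra.
  have U2 : 0 < U s w / 2 by rewrite divr_gt0.
  have h1 := Q_ge s0 st (ltW U2) lo.
  have U2b : U s w / 2 <= b by lra.
  have h2 := Sc _ U2 U2b.
  have ts0 : 0 <= t - s by rewrite subr_ge0.
  have h3 := le_trans (ler_wpM2r ts0 h2) h1.
  rewrite /q powR_inv1 ?(ltW U_gt0)//.
  have X0 : 0 <= U s w `^ be * (U s w)^-1 ^+ 2 by rewrite mulr_ge0 ?powR_ge0 ?sqr_ge0.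
  have h4 : U s w `^ be * (U s w)^-1 ^+ 2 * (c * (U s w / 2) `^ gam * (t - s)) =
      c * 2^-1 `^ gam * (t - s).
    rewrite powRM ?invr_ge0 ?(ltW U_gt0)//.
    have e2 : U s w `^ be * U s w `^ gam = U s w ^+ 2.
      rewrite -powRD; last by apply/implyP => _; rewrite gt_eqF.
      by rewrite (_ : be + gam = 2%:R) ?powR_mulrn ?(ltW U_gt0)// /be; ring.
    transitivity ((U s w `^ be * U s w `^ gam) * (U s w)^-1 ^+ 2 * (c * 2^-1 `^ gam * (t - s))).
      by ring.
    by rewrite e2 -exprMn divff ?gt_eqF// expr1n mul1r.
  have h5 := ler_wpM2l X0 h3; rewrite h4 in h5.
  have := ler_wpM2l (ltW k0) h5.
  by lra.
Qed.

(** The second derivative [x ^ -2] of [- ln] cancels the growth [C * x ^ 2]. Over short times [U] at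
    most doubles, which turns [C] into [4 * C] and calls for the growth bound up to [2 * b]. On the
    right, [a] enters only through the exit time, itself at most [t0]. *)
Lemma exit_mean_ln (C a b t0 : R) : 0 <= C ->
  (forall x : R, 0 < x -> x <= 2 * b -> S x <= C * x ^+ 2) ->
  0 < a -> a < m -> m < b -> 0 <= t0 ->
  Ex P (fun w => - ln (U (exit_time a b t0 w) w)) + ln m <= 4 * C * Ex P (exit_time a b t0).
Proof.
move=> C0 SC a0 am mb t0_ge0.
have b0 : 0 < b := lt_trans m_gt0 mb.
pose g (x : R) := - ln x.
pose p (x : R) := - x `^ (-1).
pose q (x : R) := (x `^ (-1)) ^+ 2.
pose K := (a^-1) ^+ 3.
have inv_le x : a <= x -> 0 <= x^-1 <= a^-1.
  move=> ax; rewrite invr_ge0 (le_trans (ltW a0) ax)/= lef_pV2//.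
  by rewrite posrE (lt_le_trans a0).
have minv : measurable_fun [set: R] (fun x : R => x `^ (-1)) by exact: measurable_powR.
rewrite -[X in _ + X]opprK.
apply: (@ito_exit a b t0 am mb t0_ge0 (4 * C) K g p q).
- by apply: measurable_funN; exact: measurable_ln.
- exact: measurable_funN.
- exact: measurable_funX.
- exists (`|ln a| + `|ln b| + a^-1 + (a^-1) ^+ 2) => x /andP[ax xb].
  have x0 : 0 < x by exact: lt_le_trans ax.
  have /andP[i0 i1] := inv_le x ax.
  have A0 : 0 <= a^-1 by exact: le_trans i1.
  have A2 : 0 <= a^-1 ^+ 2 by exact: sqr_ge0.
  have h2 : x^-1 ^+ 2 <= a^-1 ^+ 2 by rewrite ler_pXn2r// nnegrE.
  have l1 : ln a <= ln x by rewrite ler_ln ?posrE.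
  have l2 : ln x <= ln b by rewrite ler_ln ?posrE.
  have := ler_norm (ln b); have := ler_norm (- ln a); rewrite normrN.
  have := normr_ge0 (ln a); have := normr_ge0 (ln b) => n1 n2 n3 n4.
  rewrite /g /p /q (powR_inv1 (ltW x0)); split.
  + by rewrite normrN ler_norml; apply/andP; split; lra.
  + by rewrite normrN ger0_norm//; lra.
  + by rewrite ger0_norm ?sqr_ge0//; lra.
- by rewrite /K exprn_ge0// invr_ge0 ltW.
- move=> x y /andP[ax xb] /andP[ay yb].
  have x0 : 0 < x by exact: lt_le_trans ax.
  have y0 : 0 < y by exact: lt_le_trans ay.
  have := ln_taylor2 x0 y0.
  rewrite /g /p /q (powR_inv1 (ltW x0)) => ht.
  suff : `|y - x| ^+ 3 / (x ^+ 2 * y) <= K * `|y - x| ^+ 3 by lra.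
  rewrite mulrC ler_wpM2r ?exprn_ge0// /K invfM -exprVn !exprS !expr0 !mulr1 mulrA.
  have /andP[i0 i1] := inv_le x ax; have /andP[j0 j1] := inv_le y ay.
  by apply: ler_pM => //; [rewrite mulr_ge0|apply: ler_pM].
- move=> w; have a20 : 0 < a / 2 by rewrite divr_gt0.
  have [dl dl0 hdl] := unif_continuous_segment 0 t0 (@cU w) a20.
  exists dl => // s t s0 st tT ts.
  have sT := le_trans st tT.
  have /andP[aU Ub] := upto_exit am mb t0_ge0 s0 sT.
  have U_gt0 : 0 < U s w by exact: lt_le_trans aU.
  have hi r : s <= r <= t -> U r w <= 2 * U s w.
    move=> /andP[sr rt].
    have : `|U s w - U r w| < a / 2.
      apply: hdl; first by rewrite s0 (le_trans sT)// exit_time_le.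
      by rewrite distrC ger0_norm ?subr_ge0// (le_lt_trans _ ts)// lerD2r.
    by rewrite ltr_norml => /andP[h1 _]; lra.
  have h1 := Q_le s0 st hi.
  have U2 : 0 < 2 * U s w by rewrite mulr_gt0.
  have U2b : 2 * U s w <= 2 * b by rewrite ler_wpM2l.
  have h2 := SC _ U2 U2b.
  have ts0 : 0 <= t - s by rewrite subr_ge0.
  have h3 := le_trans h1 (ler_wpM2r ts0 h2).
  rewrite /q powR_inv1 ?(ltW U_gt0)//.
  have := ler_wpM2l (sqr_ge0 (U s w)^-1) h3.
  rewrite (_ : (U s w)^-1 ^+ 2 * (C * (2 * U s w) ^+ 2 * (t - s)) = 4 * C * (t - s))//.
  by field; exact: lt0r_neq0.
Qed.

Let mU (a b t0 : R) : a < m -> m < b -> 0 <= t0 -> bmf (fun w => U (exit_time a b t0 w) w).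
Proof.
move=> am mb t0_ge0.
rewrite (_ : (fun w => _) = fun w => (U (Num.min (exit_time a b t0 w) t0) w - m) + m).
  apply: bmfD; last exact: bmf_cst.
  exact: (bmg_bmf usualF (stopped_bmg am mb t0_ge0)).
by apply/funext => w; rewrite subrK min_l// exit_time_le.
Qed.

Let mT (a b t0 : R) : 0 <= t0 -> bmf (exit_time a b t0).
Proof.
move=> t0_ge0; split; first exact: (rtime_meas usualF (exit_time_rtime a b t0_ge0)).
by exists t0 => w; rewrite ger0_norm ?exit_time_ge0// exit_time_le.
Qed.

Let exit_of (a b t0 t : R) w : 0 <= t0 -> 0 <= t -> ~~ (a < U t w < b) -> exit_time a b t0 w <= t.
Proof.
move=> t0_ge0 ht; apply: contraR; rewrite -ltNge => tT.
exact: (before_exit t0_ge0 ht tT).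
Qed.

Let not_leN1 t w : U t w <= -1 -> False.
Proof. by have := U_ge0 t w; lra. Qed.

(* The level [-1] is never reached, so [exit_time (-1) b] is the hitting time of [b]. *)
Lemma reach_le (b : R) : m < b -> exists B, [/\ measurable B,
  [set w | exists2 t, 0 <= t & b <= U t w] `<=` B & (P B <= (m / b)%:E)%E].
Proof.
move=> mb; have b0 : 0 < b := lt_trans m_gt0 mb.
have N1m : -1 < m by rewrite (lt_trans _ m_gt0)// ltrN10.
pose T n := exit_time (-1) b n%:R.
have n0 n : 0 <= n%:R :> R by [].
(* The level [b] is reached by the horizon [n]. Each event has probability at most [m / b] by
   Markov's inequality and [Ex_exit], and the events increase with [n]. *)
pose E n := [set w | b <= U (T n w) w].
have mE n : measurable (E n).
  rewrite (_ : E n = setT `&` (fun w => U (T n w) w) @^-1` `[b, +oo[); first exact: (proj1 (mU N1m mb (n0 n))).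
  by apply/seteqP; split => w /=; rewrite /E /= in_itv/= andbT; [|case].
exists (\bigcup_n E n); split.
- exact: bigcup_measurable.
- move=> w [t ht bU]; pose n := (Num.truncn t).+1.
  have tn : t < n%:R by rewrite /n truncnS_gt.
  exists n => //; rewrite /E /=.
  have Tt : T n w <= t by apply: exit_of => //; rewrite negb_and -leNgt -leNgt bU orbT.
  have [h|//] := at_exit (n0 n) (le_lt_trans Tt tn).
  by case: (not_leN1 h).
- apply: nondecreasing_bigcup_le.
  + exact: mE.
  + move=> n w; rewrite /E /= => bU.
    have Tn : T n.+1 w <= T n w.
      apply: exit_of => //; first exact: exit_time_ge0.
      by rewrite negb_and -leNgt -leNgt bU orbT.
    have lt_n : T n.+1 w < n.+1%:R.
      by rewrite (le_lt_trans Tn)// (le_lt_trans (exit_time_le _ _ (n0 n) w))// ltr_nat.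
    have [h|//] := at_exit (n0 n.+1) lt_n.
    by case: (not_leN1 h).
  + move=> n; rewrite -(Ex_exit N1m mb (n0 n)).
    by apply: markov_le => //; exact: mU.
Qed.

Lemma U_bounded w (t0 : R) : 0 <= t0 -> exists2 n : nat, m < n%:R & forall r, 0 <= r <= t0 -> U r w < n%:R.
Proof.
move=> t0_ge0.
have [c _ hc] := @EVT_max R (U^~ w) 0 t0 t0_ge0 (continuous_subspaceT (@cU w)).
exists (Num.truncn (Num.max m (U c w))).+1.
  by rewrite (le_lt_trans _ (truncnS_gt _))// le_max lexx.
move=> r r_in; rewrite (le_lt_trans _ (truncnS_gt _))// le_max hc ?orbT//.
Qed.

(** A path that neither vanishes nor reaches [b] has a positive minimum on [[0, n]], so for some [j]
    it stays in []a j, b[] up to time [n]. Since the mean exit time is at most [H] for every [j],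
    this has probability at most [H / n]. *)
Lemma extinct_ae (gam : R) : 1 < gam < 2 ->
  (forall b : R, 0 < b -> exists2 c : R, 0 < c &
     forall x : R, 0 < x -> x <= b -> c * x `^ gam <= S x) ->
  {ae P, forall w, exists2 t, 0 <= t & U t w = 0}.
Proof.
move=> gam12 hS; apply: negligible_small => e e0.
(* The second summand makes [m / b <= e / 2], the first [m < b]. The horizon [n] takes care of the
   other [e / 2]. *)
pose b := 2 * m + 2 * m / e.
have me0 : 0 < 2 * m / e by rewrite divr_gt0// mulr_gt0.
have mb : m < b by rewrite /b; have := m_gt0; lra.
have b0 : 0 < b := lt_trans m_gt0 mb.
have mbe : m / b <= e / 2.
  rewrite ler_pdivrMr// /b mulrDr.
  have -> : e / 2 * (2 * m / e) = m by field; exact: lt0r_neq0.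
  by rewrite lerDr mulr_ge0// ltW// ?divr_gt0// mulr_gt0.
have [B1 [mB1 AB1 PB1]] := reach_le mb.
have [c c0 hc] := hS b b0.
pose kap := (2 - gam) * (gam - 1) / 6 * c * 2^-1 `^ gam.
have kap0 : 0 < kap.
  have /andP[g1 g2] := gam12.
  by rewrite mulr_gt0 ?powR_gt0 ?invr_gt0// mulr_gt0// divr_gt0// mulr_gt0// subr_gt0.
pose H := m `^ (2 - gam) / kap.
have H0 : 0 < H by rewrite divr_gt0// powR_gt0.
pose n : nat := (Num.truncn (2 * H / e)).+1.
have n_gt0 : 0 < n%:R :> R by rewrite ltr0n.
have n0 := ltW n_gt0.
have Hn : H / n%:R <= e / 2.
  rewrite ler_pdivrMr// mulrC -ler_pdivrMr ?divr_gt0// invf_div mulrA (mulrC H) ltW//.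
  exact: truncnS_gt.
(* The offset 2 gives [a 0 < m]. The intervals []a j, b[] grow with [j], and so do the events
   [G j]. *)
pose a (j : nat) := m / j.+2%:R.
have a0 j : 0 < a j by rewrite divr_gt0.
have am j : a j < m by rewrite ltr_pdivrMr// ltr_pMr// ltr1n.
pose G j := [set w | n%:R <= exit_time (a j) b n%:R w].
have mG j : measurable (G j).
  rewrite (_ : G j = setT `&` exit_time (a j) b n%:R @^-1` `[n%:R, +oo[); first exact: (proj1 (mT _ _ n0)).
  by apply/seteqP; split => w /=; rewrite /G /= in_itv/= andbT; [|case].
exists (B1 `|` \bigcup_j G j); split.
- by apply: measurableU => //; exact: bigcup_measurable.
- move=> w /= noext.
  have Upos t : 0 <= t -> 0 < U t w.
    by move=> ht; rewrite lt_neqAle U_ge0 andbT; apply/negP => /eqP h; apply: noext; exists t.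
  have [[t ht bU]|nreach] := pselect (exists2 t, 0 <= t & b <= U t w); first by left; apply: AB1; exists t.
  right.
  have [z z_in hz] := @EVT_min R (U^~ w) 0 n%:R n0 (continuous_subspaceT (@cU w)).
  have z0 : 0 < U z w by apply: Upos; move: z_in; rewrite in_itv/= => /andP[].
  pose j := Num.truncn (m / U z w).
  have aj : a j < U z w.
    rewrite ltr_pdivrMr// mulrC -ltr_pdivrMr// (lt_trans (truncnS_gt _))//.
    by rewrite ltr_nat.
  exists j => //; rewrite /G /= leNgt; apply/negP => Tn.
  have T0 := exit_time_ge0 (a j) b n0 w.
  case: (at_exit n0 Tn) => h.
    have : U z w <= U (exit_time (a j) b n%:R w) w.
      by apply: hz; rewrite in_itv/= T0 ltW.
    by move=> /le_trans/(_ h); rewrite leNgt aj.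
  by apply: nreach; exists (exit_time (a j) b n%:R w).
- apply: le_trans; first by apply: measureU2 => //; exact: bigcup_measurable.
  rewrite (splitr e) EFinD leeD//; first by rewrite (le_trans PB1)// lee_fin.
  apply: nondecreasing_bigcup_le => // j.
    move=> w; rewrite /G /= => h; rewrite leNgt; apply/negP => Tn.
    have T0 := exit_time_ge0 (a j.+1) b n0 w.
    have := before_exit n0 T0 (lt_le_trans Tn h) => /andP[h1 h2].
    case: (at_exit n0 Tn) => h3; last by have := lt_le_trans h2 h3; rewrite ltxx.
    have := lt_le_trans h1 h3; rewrite /a ltr_pM2l// ltf_pV2 ?posrE// ltr_nat.
    by rewrite !ltnS ltnNge leqnSn.
  apply: (le_trans (@markov_le _ _ _ P (exit_time (a j) b n%:R) n%:R (mT _ _ n0) _ n_gt0)).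
    by move=> w; exact: exit_time_ge0.
  rewrite lee_fin (le_trans _ Hn)// ler_pM2r ?invr_gt0// /H ler_pdivlMr// mulrC.
  exact: exit_mean_le.
Qed.

(* The exit times of (0, b) and of (-1, b) give the same mean [m] by optional
   stopping, and [U] at the latter dominates [U] at the former: they agree a.s. *)
Lemma absorbed_ae : {ae P, forall w, forall s t, 0 <= s -> s <= t -> U s w = 0 -> U t w = 0}.
Proof.
have N1m : -1 < m by rewrite (lt_trans _ m_gt0)// ltrN10.
(* Rational times and integer levels [k] leave only countably many exceptional events. *)
pose q (i j : nat) : R := i%:R / j.+1%:R.
have q0 i j : 0 <= q i j by rewrite divr_ge0.
have h1 i j k : {ae P, forall w, m < k%:R ->
    U (exit_time (-1) k%:R (q i j) w) w = U (exit_time 0 k%:R (q i j) w) w}.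
  case: (ltP m k%:R) => mk; last by apply: aeW.
  pose D w := U (exit_time (-1) k%:R (q i j) w) w - U (exit_time 0 k%:R (q i j) w) w.
  (* If the two exit times differ, the exit from []0, k[] is the earlier one and occurs at the level
     0, below which [U] never goes. *)
  have D0 w : 0 <= D w.
    rewrite /D subr_ge0; set T1 := exit_time (-1) _ _ w; set T0 := exit_time 0 _ _ w.
    have T0_ge0 : 0 <= T0 by exact: exit_time_ge0.
    case: (ltgtP T0 T1) => [lt01|lt10|->//].
      have Tq : T0 < q i j by rewrite (lt_le_trans lt01)// exit_time_le.
      have [h|h] := at_exit (q0 i j) Tq.
        by rewrite (le_trans h).
      have /andP[_ h2] := before_exit (q0 i j) T0_ge0 lt01.
      by have := lt_le_trans h2 h; rewrite ltxx.
    have T1_ge0 : 0 <= T1 by exact: exit_time_ge0.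
    have Tq : T1 < q i j by rewrite (lt_le_trans lt10)// exit_time_le.
    have /andP[u0 uk] := before_exit (q0 i j) T1_ge0 lt10.
    have [h|h] := at_exit (q0 i j) Tq.
      by case: (not_leN1 h).
    by have := lt_le_trans uk h; rewrite ltxx.
  have bD : bmf D by apply: bmfB; exact: mU.
  have ED : Ex P D = 0.
    by rewrite ExB ?Ex_exit ?subrr//; apply: bmf_int; exact: mU.
  suff : {ae P, forall w, D w = 0}.
    by apply: filterS => w /eqP; rewrite subr_eq0 => /eqP.
  apply: negligible_small => e e0.
  exists (\bigcup_n [set w | n.+1%:R^-1 <= D w]); split.
  - apply: bigcup_measurable => n _.
    rewrite (_ : [set w | _] = setT `&` D @^-1` `[n.+1%:R^-1, +oo[); first exact: (proj1 bD).
    by apply/seteqP; split => w /=; rewrite in_itv/= andbT; [|case].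
  - move=> w Dw; have Dw0 : 0 < D w by rewrite lt_neqAle D0 andbT eq_sym; exact/eqP.
    have [n _ hn] := near_infty_natSinv_lt (PosNum Dw0).
    by exists n => //=; rewrite ltW// (hn n (leqnn n)).
  - apply: nondecreasing_bigcup_le => n.
    + rewrite (_ : [set w | _] = setT `&` D @^-1` `[n.+1%:R^-1, +oo[); first exact: (proj1 bD).
      by apply/seteqP; split => w /=; rewrite in_itv/= andbT; [|case].
    + by move=> w /=; apply: le_trans; rewrite lef_pV2 ?posrE// ler_nat.
    + have n0 : 0 < n.+1%:R^-1 :> R by rewrite invr_gt0.
      by rewrite (le_trans (@markov_le _ _ _ P _ _ bD D0 n0))// ED mul0r lee_fin ltW.
have h2 : {ae P, forall w i j k, m < k%:R ->
    U (exit_time (-1) k%:R (q i j) w) w = U (exit_time 0 k%:R (q i j) w) w}.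
  by apply: ae_foralln => i; apply: ae_foralln => j; apply: ae_foralln => k; exact: h1.
apply: filterS h2 => w hw s t s0 st Us.
have [<-//|st'] := eqVneq s t; have {st'}lt_st : s < t by rewrite lt_neqAle st'.
apply/eqP; apply/negPn/negP => Ut.
have {}Ut : 0 < U t w by rewrite lt_neqAle eq_sym Ut U_ge0.
have /cvgr_gt/(_ _ Ut) := @cU w t; move=> /nbhs_ballP[e /= e0 he].
have [j _ hj] := near_infty_natSinv_lt (PosNum e0).
have {hj} := hj j (leqnn j) => /= hj.
(* The first multiple of [1 / (j + 1)] after [t], where [U] is still positive. With [k] above the
   path up to there, the exit from []-1, k[] occurs only at the cap, whereas the exit from []0, k[]
   occurs by time [s], at the value 0. *)
pose i := (Num.truncn (t * j.+1%:R)).+1.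
have tq : t < q i j by rewrite ltr_pdivlMr// truncnS_gt.
have qt : q i j <= t + j.+1%:R^-1.
  rewrite /q ler_pdivrMr// mulrDl mulVf ?pnatr_eq0// /i -natr1 lerD2r.
  by rewrite truncn_le// mulr_ge0// (le_trans s0).
have Uq : 0 < U (q i j) w.
  apply: he; rewrite /ball/= distrC ger0_norm ?subr_ge0 ?(ltW tq)//.
  by rewrite (le_lt_trans _ hj)// lerBlDl.
have [k mk hk] := U_bounded w (q0 i j).
have T1 : exit_time (-1) k%:R (q i j) w = q i j.
  apply/eqP; rewrite eq_le exit_time_le//= leNgt; apply/negP => h.
  have T0 := exit_time_ge0 (-1) k%:R (q0 i j) w.
  case: (at_exit (q0 i j) h) => h3.
    by case: (not_leN1 h3).
  have : 0 <= exit_time (-1) k%:R (q i j) w <= q i j by rewrite T0 ltW.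
  by move=> /hk /lt_le_trans/(_ h3); rewrite ltxx.
have Ts : exit_time 0 k%:R (q i j) w <= s by apply: exit_of => //; rewrite Us ltxx.
have Tq : exit_time 0 k%:R (q i j) w < q i j by rewrite (le_lt_trans Ts)// (lt_trans lt_st).
have T0 := exit_time_ge0 0 k%:R (q0 i j) w.
have := hw i j k mk; rewrite T1 => e1.
case: (at_exit (q0 i j) Tq) => h3.
  by move: Uq; rewrite e1 ltNge h3.
have : 0 <= exit_time 0 k%:R (q i j) w <= q i j by rewrite T0 ltW.
by move=> /hk /lt_le_trans/(_ h3); rewrite ltxx.
Qed.

(** At the exit from []a, k[], the variable [f], that is [ln k - ln U], is nonnegative with mean at
    most [H], whatever [a]. A path below [k] that hits 0 by time [n] has to exit at [a], where
    [f >= H / e]; by Markov's inequality this has probability at most [e]. *)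
Lemma positive_ae :
  (forall b : R, 0 < b -> exists2 C : R, 0 <= C &
     forall x : R, 0 < x -> x <= b -> S x <= C * x ^+ 2) ->
  {ae P, forall w, forall t, 0 <= t -> 0 < U t w}.
Proof.
move=> hS.
suff h (n k : nat) : {ae P, forall w, m < k%:R -> (forall r, 0 <= r <= n%:R -> U r w < k%:R) ->
    forall s, 0 <= s <= n%:R -> 0 < U s w}.
  have h2 : {ae P, forall w (n k : nat), m < k%:R -> (forall r, 0 <= r <= n%:R -> U r w < k%:R) ->
      forall s, 0 <= s <= n%:R -> 0 < U s w}.
    by apply: ae_foralln => n; apply: ae_foralln => k; exact: h.
  apply: filterS h2 => w hw t ht.
  pose n := (Num.truncn t).+1.
  have [k mk hk] := U_bounded w (ler0n R n).
  by apply: (hw n k mk hk); rewrite ht ltW// truncnS_gt.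
case: (ltP m k%:R) => mk; last by apply: aeW.
have n0 : 0 <= n%:R :> R by [].
have b0 : 0 < k%:R :> R := lt_trans m_gt0 mk.
have [C C0 hC] : exists2 C : R, 0 <= C & forall x : R, 0 < x -> x <= 2 * k%:R -> S x <= C * x ^+ 2.
  by apply: hS; rewrite mulr_gt0.
pose H := ln k%:R - ln m + 4 * C * n%:R.
have H0 : 0 < H.
  rewrite ltr_wpDr ?mulr_ge0// subr_gt0 ltr_ln ?posrE//.
apply: negligible_small => e e0.
(* The second argument makes [ln k - ln a >= H / e], the first [a < m]. *)
pose a := Num.min (m / 2) (k%:R * expR (- (H / e))).
have a0 : 0 < a by rewrite lt_min divr_gt0//= mulr_gt0// expR_gt0.
have am : a < m by rewrite gt_min ltr_pdivrMr// ltr_pMr// ltr1n.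
pose T := exit_time a k%:R n%:R.
pose f w := ln k%:R - ln (U (T w) w).
have Tk w : a <= U (T w) w <= k%:R.
  by apply: (upto_exit am mk n0); [exact: exit_time_ge0|].
have f0 w : 0 <= f w.
  have /andP[h1 h2] := Tk w; rewrite subr_ge0 ler_ln ?posrE//.
  exact: lt_le_trans h1.
have bln : bmf (fun w => - ln (U (T w) w)).
  split; first by apply: measurable_funN; apply: measurableT_comp; [exact: measurable_ln|exact: (proj1 (mU am mk n0))].
  exists (`|ln a| + `|ln k%:R|) => w; have /andP[h1 h2] := Tk w.
  have U_gt0 := lt_le_trans a0 h1.
  have l1 : ln a <= ln (U (T w) w) by rewrite ler_ln ?posrE.
  have l2 : ln (U (T w) w) <= ln k%:R by rewrite ler_ln ?posrE.
  have := ler_norm (ln (k%:R : R)); have := ler_norm (- ln a); rewrite normrN.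
  have := normr_ge0 (ln a); have := normr_ge0 (ln (k%:R : R)) => n1 n2 n3 n4.
  by rewrite normrN ler_norml; apply/andP; split; lra.
have bf : bmf f by apply: bmfD => //; exact: bmf_cst.
have Ef : Ex P f <= H.
  rewrite /f ExD; [|exact: intR_cst|exact: bmf_int].
  rewrite Ex_cst.
  have := exit_mean_ln C0 hC a0 am mk n0; rewrite -/T => hT.
  have hT2 : Ex P T <= n%:R.
    rewrite -(Ex_cst P n%:R); apply: Ex_le; [exact/bmf_int/mT|exact: intR_cst|].
    by move=> w; exact: exit_time_le.
  have C40 : 0 <= 4 * C by rewrite mulr_ge0.
  by have := ler_wpM2l C40 hT2; rewrite /H; lra.
have lnka : H / e <= ln k%:R - ln a.
  have : ln a <= ln (k%:R * expR (- (H / e))).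
    by rewrite ler_ln ?posrE ?mulr_gt0 ?expR_gt0// ge_min lexx orbT.
  rewrite lnM ?posrE ?expR_gt0// expRK; lra.
have He0 : 0 < H / e by rewrite divr_gt0.
exists [set w | H / e <= f w]; split.
- rewrite (_ : [set w | _] = setT `&` f @^-1` `[H / e, +oo[); first exact: (proj1 bf).
  by apply/seteqP; split => w /=; rewrite in_itv/= andbT; [|case].
- move=> w /= /not_implyP[_ /not_implyP[hk]].
  move=> /existsNP[s /not_implyP[/andP[s0 sn] /negP]]; rewrite -leNgt => Us.
  have Ts : T w <= s.
    by apply: exit_of => //; rewrite negb_and -leNgt (le_trans Us)// ltW.
  have Ua : U (T w) w <= a.
    have [Tn|] := ltP (T w) n%:R; last first.
      move=> nT; have -> : T w = s by apply/eqP; rewrite eq_le Ts (le_trans sn).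
      by rewrite (le_trans Us)// ltW.
    have [//|h] := at_exit n0 Tn.
    have : 0 <= T w <= n%:R by rewrite exit_time_ge0//= ltW.
    by move=> /hk/lt_le_trans/(_ h); rewrite ltxx.
  rewrite (le_trans lnka)// /f lerD2l lerN2 ler_ln ?posrE//.
  by have /andP[h1 _] := Tk w; exact: lt_le_trans h1.
- rewrite (le_trans (@markov_le _ _ _ P _ _ bf f0 He0))// lee_fin ler_pdivrMr// mulrC divfK ?gt_eqF//.
Qed.

End Core.

(** * Energy estimate *)

Section SegmentIntegral.
Context {R : realType}.
Implicit Types (f g : R -> R) (a b u v : R).
Local Notation leb := (@lebesgue_measure R).

Definition sint f a b : R := \int[leb]_(x in `[a, b]) f x.

Lemma sint_integrable f a b : continuous f ->
  leb.-integrable `[a, b] (EFin \o f).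
Proof.
move=> cf; apply: continuous_compact_integrable; first exact: segment_compact.
exact: continuous_subspaceT.
Qed.

Lemma sint_diff f u v : continuous f -> 0 <= u -> u <= v ->
  sint f 0 v - sint f 0 u = sint f u v.
Proof.
move=> cf u0 uv; rewrite /sint.
have := @Rintegral_itvB R f (BLeft 0) (BRight v) u (sint_integrable 0 v cf).
rewrite !bnd_simp u0 uv => /(_ isT isT) e.
rewrite e Rintegral_itv_obnd_cbnd//.
apply: (@integrableS _ _ _ leb `[u, v]) => //; last exact: sint_integrable.
by apply: subset_itvr; rewrite bnd_simp.
Qed.

Lemma sintxx f a : sint f a a = 0.
Proof. by rewrite /sint set_itv1 Rintegral_set1. Qed.

Lemma sint_bound f u v (C : R) : continuous f -> u <= v ->
  (forall x, u <= x <= v -> `|f x| <= C) -> `|sint f u v| <= C * (v - u).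
Proof.
move=> cf uv fC.
have iC : leb.-integrable `[u, v] (EFin \o (fun=> C)).
  by apply: sint_integrable => x; exact: cvg_cst.
have i1 := sint_integrable u v cf.
apply: (le_trans (le_normr_Rintegral _ i1)) => //.
have -> : C * (v - u) = \int[leb]_(x in `[u, v]) C.
  rewrite Rintegral_cst//; congr (_ * _).
  apply/esym; apply: (etrans (congr1 fine (lebesgue_measure_itv `[u, v]))).
  by rewrite /= lte_fin; case: (ltgtP u v) uv => //= -> _; rewrite subrr.
apply: le_Rintegral => //.
  exact: (integrable_norm i1).
Qed.

Lemma sintB f g u v : continuous f -> continuous g ->
  sint f u v - sint g u v = sint (fun x => f x - g x) u v.
Proof. by move=> cf cg; rewrite /sint -RintegralB//; exact: sint_integrable. Qed.

Lemma sintZ f (c : R) u v : continuous f -> c * sint f u v = sint (fun x => c * f x) u v.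
Proof. by move=> cf; rewrite /sint -RintegralZl//; exact: sint_integrable. Qed.

(** The difference is the integral of [f * (f - f u)]. Summed over a grid, it turns the sum of [f]
    against the increments of its primitive into the integral of [f ^ 2]. *)
Lemma sint_sq_approx f u v (B e : R) : continuous f -> 0 <= u -> u <= v ->
  (forall x, u <= x <= v -> `|f x| <= B) -> (forall x, u <= x <= v -> `|f x - f u| <= e) ->
  `|(sint (fun x => f x ^+ 2) 0 v - sint (fun x => f x ^+ 2) 0 u) -
    f u * (sint f 0 v - sint f 0 u)| <= B * e * (v - u).
Proof.
move=> cf u0 uv fB fe.
have cf2 : continuous (fun x => f x ^+ 2).
  rewrite (_ : (fun x => _) = fun x => f x * f x); last by apply/funext => x; rewrite expr2.
  by move=> x; apply: cvgM; exact: cf.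
have cuf : continuous (fun x => f u * f x).
  by move=> x; apply: cvgMr; exact: cf.
have cd : continuous (fun x => f x ^+ 2 - f u * f x).
  by move=> x; apply: cvgB; [exact: cf2|exact: cuf].
rewrite (sint_diff cf2 u0 uv) (sint_diff cf u0 uv) (sintZ _ _ _ cf) (sintB _ _ cf2 cuf).
apply: (sint_bound cd uv) => x x_in.
rewrite (_ : f x ^+ 2 - f u * f x = f x * (f x - f u)); last by ring.
by rewrite normrM ler_pM// ?fB ?fe.
Qed.

Lemma sint_continuous f : continuous f -> forall u0 : R, 0 <= u0 ->
  forall e : R, 0 < e -> exists2 dl : R, 0 < dl & forall u v, 0 <= u -> u <= v -> v <= u0 ->
   v - u < dl -> forall x, u <= x <= v -> `|f x - f u| <= e.
Proof.
move=> cf u0 u00 e e0; have [dl dl0 h] := unif_continuous_segment 0 u0 cf e0.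
exists dl => // u v u_ge0 uv vu0 uvdl x /andP[ux xv].
apply/ltW/h; first by rewrite (le_trans u_ge0 ux) (le_trans xv).
by rewrite ger0_norm ?subr_ge0// (le_lt_trans _ uvdl)// lerD2r.
Qed.

End SegmentIntegral.

Section Energy.
Context {R : realType} {d : measure_display} {Omega : measurableType d}.
Variables (P : probability Omega R) (F : R -> set_system Omega).
Hypothesis usualF : usual_conditions P F.
Variables (Z N Q M M2 : R -> Omega -> R) (T : Omega -> R) (t0 b c L : R).
Hypothesis t0_ge0 : 0 <= t0.
Hypothesis c_gt0 : 0 < c.
Hypothesis b_ge0 : 0 <= b.
Hypothesis L_ge0 : 0 <= L.
Hypothesis cZ : forall w, continuous (Z ^~ w).
Hypothesis cN : forall w, continuous (N ^~ w).
Hypothesis cQ : forall w, continuous (Q ^~ w).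
Hypothesis aZ : forall t : R, 0 <= t -> Fm F t (Z t).
Hypothesis N0 : forall w, N 0 w = 0.
Hypothesis Q0 : forall w, Q 0 w = 0.
Hypothesis Mloc : continuous_local_martingale P F M.
Hypothesis NM : {ae P, forall w, forall t, 0 <= t -> N t w = M t w}.
Hypothesis M2loc : continuous_local_martingale P F M2.
Hypothesis NM2 : {ae P, forall w, forall t, 0 <= t -> N t w ^+ 2 - Q t w = M2 t w}.
Hypothesis T_rtime : rtime F T.
Hypothesis T_le : forall w, T w <= t0.
Hypothesis Zb : forall w t, 0 <= t -> t <= T w -> `|Z t w| <= b.
Hypothesis QL : forall w t, 0 <= t -> t <= T w -> 0 <= Q t w <= L.
Hypothesis NZ : forall w t, 0 <= t -> t <= T w -> N t w = Z t w - Z 0 w + c * sint (Z^~ w) 0 t.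

Local Notation pt := (gridpt 0 t0).
Let Ts w t := Num.min (T w) t.

Let T_ge0 w : 0 <= T w. Proof. by case: T_rtime. Qed.

Let Ts_ge0 w t : 0 <= t -> 0 <= Ts w t. Proof. by move=> ht; rewrite le_min T_ge0. Qed.

Let Ts_le w t : Ts w t <= T w. Proof. by rewrite ge_min lexx. Qed.

Let Ts_mono w s t : s <= t -> Ts w s <= Ts w t.
Proof. by move=> st; rewrite /Ts le_min !ge_min lexx st !orbT. Qed.

Let Ts_diff w s t : s <= t -> Ts w t - Ts w s <= t - s.
Proof. by move=> st; rewrite /Ts; case: (leP (T w) s); case: (leP (T w) t); lra. Qed.

Let J t w := sint (Z^~ w) 0 (Ts w t).
Let z t w := Z (Ts w t) w.
Let Ns t w := N (Ts w t) w.
Let Qs t w := Q (Ts w t) w.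

Let z_bound t w : 0 <= t -> `|z t w| <= b.
Proof. by move=> ht; apply: Zb; [exact: Ts_ge0|exact: Ts_le]. Qed.

Let J_incr s t w : 0 <= s -> s <= t -> `|J t w - J s w| <= b * (t - s).
Proof.
move=> s0 st; rewrite /J (sint_diff (@cZ w) (Ts_ge0 w s0) (Ts_mono w st)).
have h := @sint_bound _ (Z^~ w) (Ts w s) (Ts w t) b (@cZ w) (Ts_mono w st).
apply: (le_trans (h _)).
  move=> x /andP[x1 x2]; apply: Zb; first by rewrite (le_trans _ x1)// Ts_ge0.
  by rewrite (le_trans x2).
by rewrite ler_wpM2l// Ts_diff.
Qed.

Let J0 w : J 0 w = 0. Proof. by rewrite /J /Ts min_r// sintxx. Qed.

(** The time integral [J] is measurable because of this linear relation with adapted variables. *)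
Let JE t w : 0 <= t -> J t w = c^-1 * (Ns t w - z t w + Z 0 w).
Proof.
move=> ht; rewrite /Ns NZ ?Ts_ge0 ?Ts_le// -/(z t w) -/(J t w).
by field; exact: lt0r_neq0.
Qed.

Let N_bmg : bmg P F t0 Ns.
Proof.
have NB t w : 0 <= t -> t <= t0 -> `|Ns t w| <= b + b + c * (b * t0).
  move=> ht tt0; rewrite /Ns NZ ?Ts_ge0 ?Ts_le// -/(z t w) -/(J t w).
  rewrite (le_trans (ler_normD _ _))// lerD//.
    rewrite (le_trans (ler_normB _ _))// lerD ?z_bound//.
    by have := z_bound w (lexx 0); rewrite /z /Ts min_r.
  rewrite normrM gtr0_norm// ler_wpM2l ?(ltW c_gt0)//.
  have := J_incr w (lexx 0) ht; rewrite J0 !subr0 => /le_trans; apply.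
  by rewrite ler_wpM2l.
have aN : forall t : R, 0 <= t -> Fm F t (N t).
  by case: Mloc => aM _ _; exact: (adapted_version usualF aM NM).
split.
- by move=> t ht _; exact: (stopped_Fm usualF cN aN T_rtime ht).
- by exists (b + b + c * (b * t0)) => t w ht tt0; exact: NB.
- move=> s t A s0 st tt0 FA.
  apply: (local_martingale_stopped usualF Mloc cN NM N0 T_rtime s0 st _ FA).
  by move=> w r r0 rt; apply: NB => //; exact: le_trans tt0.
Qed.

Let cN2 w : continuous ((fun t w => N t w ^+ 2 - Q t w)^~ w).
Proof.
move=> t; apply: cvgB; last exact: cQ.
rewrite (_ : (fun x => _) = fun x => N x w * N x w); last by apply/funext => x; rewrite expr2.
by rewrite expr2; apply: cvgM; exact: cN.
Qed.

Let N2_bmg : bmg P F t0 (fun t w => Ns t w ^+ 2 - Qs t w).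
Proof.
have [_ [B NB] _] := N_bmg.
have NB2 t w : 0 <= t -> t <= t0 -> `|N (Ts w t) w ^+ 2 - Q (Ts w t) w| <= B ^+ 2 + L.
  move=> ht tt0; rewrite (le_trans (ler_normB _ _))// lerD//.
    have h := NB t w ht tt0.
    by rewrite normrX ler_pXn2r// nnegrE// (le_trans _ h).
  have /andP[q0 q1] := QL (Ts_ge0 w ht) (Ts_le w t).
  by rewrite ger0_norm.
have aN : forall t : R, 0 <= t -> Fm F t (fun w => N t w ^+ 2 - Q t w).
  by case: M2loc => aM _ _; exact: (adapted_version usualF aM NM2).
split.
- by move=> t ht _; exact: (stopped_Fm usualF cN2 aN T_rtime ht).
- by exists (B ^+ 2 + L) => t w ht tt0; exact: NB2.
- move=> s t A s0 st tt0 FA.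
  apply: (local_martingale_stopped usualF M2loc cN2 NM2 _ T_rtime s0 st _ FA).
    by move=> w; rewrite N0 Q0 expr0n subrr.
  by move=> w r r0 rt; apply: NB2 => //; exact: le_trans tt0.
Qed.

(* In the telescoping sum of [Z ^+ 2] along a grid, the drift [- c * Z] contributes
   [- 2 * c * Z ^+ 2] and the squared increments contribute at most [L]. *)
Lemma energy_le :
  bmf (fun w => sint (fun t => Z t w ^+ 2) 0 (T w)) /\
  2 * c * Ex P (fun w => sint (fun t => Z t w ^+ 2) 0 (T w)) <= b ^+ 2 + 2 * L.
Proof.
have pt_ge0 n i : 0 <= pt n i by exact: gridpt_ge.
have pt_le n i : (i <= n.+1)%N -> pt n i <= t0 by move=> ?; exact: gridpt_le_end.
have pt_leS n i : pt n i <= pt n i.+1 by exact: gridpt_le.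
have mz (t : R) : 0 <= t -> Fm F t (z t) by move=> ht; exact: (stopped_Fm usualF cZ aZ T_rtime ht).
have bz (t : R) : 0 <= t -> bmf (z t).
  move=> ht; split; first exact: (Fm_meas usualF ht (mz t ht)).
  by exists b => w; exact: z_bound.
have bN t : 0 <= t -> t <= t0 -> bmf (Ns t) by exact: (bmg_bmf usualF N_bmg).
have bQ t : 0 <= t -> t <= t0 -> bmf (Qs t).
  move=> ht tt0; rewrite (_ : Qs t = fun w => Ns t w ^+ 2 - (Ns t w ^+ 2 - Qs t w)).
    by apply: bmfB; [apply: bmfX; exact: bN|exact: (bmg_bmf usualF N2_bmg)].
  by apply/funext => w; ring.
have bJ t : 0 <= t -> t <= t0 -> bmf (J t).
  move=> ht tt0; rewrite (_ : J t = fun w => c^-1 * (Ns t w - z t w + z 0 w)).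
    by apply: bmfM; [exact: bmf_cst|apply: bmfD; [apply: bmfB; [exact: bN|exact: bz]|exact: bz]].
  by apply/funext => w; rewrite JE// /z [Ts w 0]min_r.
pose dN n i w := Ns (pt n i.+1) w - Ns (pt n i) w.
pose dJ n i w := J (pt n i.+1) w - J (pt n i) w.
pose dQ n i w := Qs (pt n i.+1) w - Qs (pt n i) w.
have bdN n (i : 'I_n.+1) : bmf (dN n i) by apply: bmfB; apply: bN => //; apply: pt_le => //; exact: ltnW.
have bdJ n (i : 'I_n.+1) : bmf (dJ n i) by apply: bmfB; apply: bJ => //; apply: pt_le => //; exact: ltnW.
have bdQ n (i : 'I_n.+1) : bmf (dQ n i) by apply: bmfB; apply: bQ => //; apply: pt_le => //; exact: ltnW.
pose A n w := \sum_(i < n.+1) z (pt n i) w * dJ n i w.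
pose I w := sint (fun t => Z t w ^+ 2) 0 (T w).
have bA n : bmf (A n) by apply: bmf_sum => i; apply: bmfM => //; exact: bz.
have dJ_le n i w : `|dJ n i w| <= b * (t0 / n.+1%:R).
  by rewrite (le_trans (J_incr _ _ _))// gridptS subr0.
have A_le n w : `|A n w| <= b * (b * t0).
  rewrite (le_trans (ler_norm_sum _ _ _))//.
  have -> : b * (b * t0) = \sum_(i < n.+1) b * (b * (t0 / n.+1%:R)).
    rewrite sumr_const card_ord -[RHS]mulr_natr -!mulrA; congr (_ * (_ * _)).
    by rewrite mulVf ?mulr1// pnatr_eq0.
  by apply: ler_sum => i _; rewrite normrM ler_pM// z_bound.
have telescope n (f : R -> R) :
    f t0 - f 0 = \sum_(i < n.+1) (f (pt n i.+1) - f (pt n i)).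
  rewrite -(big_mkord xpredT (fun i => f (pt n i.+1) - f (pt n i))) telescope_sumr//.
  by rewrite gridpt_last gridpt0.
(* The last term comes from the squared increments of [J]: each is of the order of the squared mesh,
   so their sum vanishes in the limit. *)
have step n : 2 * c * Ex P (A n) <= b ^+ 2 + 2 * L + 2 * c ^+ 2 * (b * (b * t0) * (t0 / n.+1%:R)).
  pose B n w := \sum_(i < n.+1) z (pt n i) w * dN n i w.
  pose C n w := \sum_(i < n.+1) dN n i w ^+ 2.
  pose D n w := \sum_(i < n.+1) dJ n i w ^+ 2.
  have bB : bmf (B n) by apply: bmf_sum => i; apply: bmfM => //; exact: bz.
  have bC : bmf (C n) by apply: bmf_sum => i; exact: bmfX.
  have bD : bmf (D n) by apply: bmf_sum => i; exact: bmfX.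
  have EB : Ex P (B n) = 0.
    rewrite /B Ex_sum => [|i]; last by apply: bmf_int; apply: bmfM => //; exact: bz.
    rewrite big1// => i _; apply: (bmg_incr usualF N_bmg) => //; [exact: pt_le|exact: mz|exact: bz].
  have EC : Ex P (C n) <= L.
    have -> : Ex P (C n) = Ex P (fun w => \sum_(i < n.+1) dQ n i w).
      rewrite /C [LHS]Ex_sum => [|i]; last by apply: bmf_int; exact: bmfX.
      rewrite [RHS]Ex_sum => [|i]; last exact: bmf_int.
      apply: eq_bigr => i _.
      have := bmg_incr_sq usualF N_bmg N2_bmg (pt_ge0 n i) (pt_leS n i) (pt_le n i.+1 (ltn_ord i))
         (measurable_cst (1 : R)) (bmf_cst 1).
      rewrite (_ : (fun w => 1 * (Ns (pt n i.+1) w - Ns (pt n i) w) ^+ 2) = fun w => dN n i w ^+ 2); last first.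
        by apply/funext => w; rewrite mul1r.
      by move=> ->; congr Ex; apply/funext => w; rewrite mul1r.
    rewrite -[leRHS](Ex_cst P); apply: Ex_le; [|exact: intR_cst|].
      by apply: intR_sum => i; exact: bmf_int.
    move=> w; rewrite -(telescope n (Qs^~ w)) /Qs [Ts w 0]min_r// Q0 subr0.
    by have /andP[] := QL (Ts_ge0 w t0_ge0) (Ts_le w t0).
  have ED : Ex P (D n) <= b * (b * t0) * (t0 / n.+1%:R).
    rewrite -[leRHS](Ex_cst P); apply: Ex_le; [exact: bmf_int|exact: intR_cst|].
    move=> w; have -> : b * (b * t0) * (t0 / n.+1%:R) =
        \sum_(i < n.+1) (b * (t0 / n.+1%:R)) ^+ 2.
      rewrite sumr_const card_ord -mulr_natr.
      by field; rewrite addrC natr1 pnatr_eq0.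
    apply: ler_sum => i _; rewrite -[leLHS](@real_normK _ (dJ n i w)) ?num_real//.
    by rewrite ler_pXn2r ?nnegrE// mulr_ge0// divr_ge0.
  have pw w : 2 * c * A n w <= b ^+ 2 + (2 * B n w + (2 * C n w + 2 * c ^+ 2 * D n w)).
    have h1 : - z 0 w ^+ 2 <= \sum_(i < n.+1) (z (pt n i.+1) w ^+ 2 - z (pt n i) w ^+ 2).
      by rewrite -(telescope n (fun t => z t w ^+ 2)) lerDr sqr_ge0.
    have h2 : \sum_(i < n.+1) (z (pt n i.+1) w ^+ 2 - z (pt n i) w ^+ 2) <=
        2 * B n w - 2 * c * A n w + (2 * C n w + 2 * c ^+ 2 * D n w).
      rewrite /A /B /C /D !mulr_sumr -sumrB -!big_split/=; apply: ler_sum => i _.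
      have e1 : z (pt n i.+1) w - z (pt n i) w = dN n i w - c * dJ n i w.
        by rewrite /dJ !JE// /dN; field; exact: lt0r_neq0.
      have -> : z (pt n i.+1) w ^+ 2 - z (pt n i) w ^+ 2 =
          2 * z (pt n i) w * (z (pt n i.+1) w - z (pt n i) w) +
          (z (pt n i.+1) w - z (pt n i) w) ^+ 2 by ring.
      rewrite e1.
      (* This gives [(dN - c * dJ) ^ 2 <= 2 * dN ^ 2 + 2 * c ^ 2 * dJ ^ 2], the source of the factor
         2 in [2 * L]. *)
      have := sqr_ge0 (dN n i w + c * dJ n i w).
      by lra.
    have h3 : z 0 w ^+ 2 <= b ^+ 2.
      rewrite -[leLHS](@real_normK _ (z 0 w)) ?num_real//.
      by rewrite ler_pXn2r ?nnegrE// z_bound.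
    by move: h1 h2 h3; lra.
  have i1 : intR P (fun w => 2 * B n w) by apply: intRZ; exact: bmf_int.
  have i2 : intR P (fun w => 2 * C n w) by apply: intRZ; exact: bmf_int.
  have i3 : intR P (fun w => 2 * c ^+ 2 * D n w) by apply: intRZ; exact: bmf_int.
  have := Ex_le (intRZ (2 * c) (bmf_int P (bA n))) (intRD (intR_cst P (b ^+ 2)) (intRD i1 (intRD i2 i3))) pw.
  rewrite ExZ; last exact: bmf_int.
  rewrite (ExD (intR_cst P (b ^+ 2)) (intRD i1 (intRD i2 i3))) (ExD i1 (intRD i2 i3)) (ExD i2 i3) Ex_cst.
  rewrite !ExZ; [|exact: bmf_int..].
  have c2 : 0 <= 2 * c ^+ 2 by rewrite mulr_ge0// sqr_ge0.
  have := ler_wpM2l c2 ED.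
  move: (2 * c ^+ 2 * (b * (b * t0) * (t0 / n.+1%:R))) => W.
  move: (2 * c ^+ 2 * Ex P (D n)) (2 * c * Ex P (A n)) EC => x1 x2; rewrite EB.
  by lra.
have cvA w : A n w @[n --> \oo] --> I w.
  apply/cvgrPdist_le => e e0.
  pose e1 := e / (b * t0 + 1).
  have bt0 : 0 <= b * t0 by rewrite mulr_ge0.
  have e10 : 0 < e1 by rewrite divr_gt0// ltr_wpDl.
  have [dl dl0 hdl] := sint_continuous (@cZ w) (T_ge0 w) e10.
  have : (t0 / n.+1%:R) @[n --> \oo] --> (0 : R).
    rewrite -[X in _ --> X](mulr0 t0).
    by apply: cvgM; [exact: cvg_cst|exact: cvg_harmonic].
  move/cvgr_lt/(_ dl dl0); apply: filterS => n hn.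
  pose K t := sint (fun t => Z t w ^+ 2) 0 (Ts w t).
  have -> : I w = K t0 - K 0.
    by rewrite /K /Ts (min_l (T_le w)) min_r ?T_ge0// sintxx subr0.
  rewrite (telescope n K) /A -sumrB.
  apply: (le_trans (ler_norm_sum _ _ _)).
  apply: (@le_trans _ _ (\sum_(i < n.+1) b * e1 * (pt n i.+1 - pt n i))).
    apply: ler_sum => i _.
    have l1 := Ts_mono w (pt_leS n i); have l2 := Ts_ge0 w (pt_ge0 n i).
    have l3 := Ts_diff w (pt_leS n i).
    apply: (@le_trans _ _ (b * e1 * (Ts w (pt n i.+1) - Ts w (pt n i)))); last first.
      by rewrite ler_wpM2l// mulr_ge0// ltW.
    apply: (@sint_sq_approx _ (Z^~ w)) => //.
      move=> x /andP[x1 x2]; apply: Zb; first exact: le_trans x1.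
      by rewrite (le_trans x2)// Ts_le.
    apply: (hdl (Ts w (pt n i)) (Ts w (pt n i.+1)) l2 l1 (Ts_le w _)).
    by rewrite (le_lt_trans l3)// gridptS subr0.
  rewrite -mulr_sumr -(telescope n id) subr0 /e1.
  rewrite (_ : b * _ * t0 = e * (b * t0) / (b * t0 + 1)); last by ring.
  by rewrite ler_pdivrMr ?ltr_wpDl// ler_pM2l// lerDl.
have [bI limA] : bmf I /\ Ex P (A n) @[n --> \oo] --> Ex P I.
  apply: (@Ex_bct _ _ _ P A _ (b * (b * t0))) => //.
  by move=> n; exact: (proj1 (bA n)).
split => //.
have lim1 : 2 * c * Ex P (A n) @[n --> \oo] --> 2 * c * Ex P I by exact: cvgMr.
have lim2 : b ^+ 2 + 2 * L + 2 * c ^+ 2 * (b * (b * t0) * (t0 / n.+1%:R)) @[n --> \oo] -->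
    b ^+ 2 + 2 * L.
  rewrite -[X in _ --> X]addr0; apply: cvgD; first exact: cvg_cst.
  rewrite -[X in _ --> X](mulr0 (2 * c ^+ 2)); apply: cvgMr.
  rewrite -[X in _ --> X](mulr0 (b * (b * t0))); apply: cvgMr.
  rewrite -[X in _ --> X](mulr0 t0).
  by apply: cvgM; [exact: cvg_cst|exact: cvg_harmonic].
rewrite -(cvg_lim _ lim1)// -(cvg_lim _ lim2)//; apply: ler_lim.
- by apply/cvg_ex; eexists; exact: lim1.
- by apply/cvg_ex; eexists; exact: lim2.
- by apply: nearW => n; exact: step.
Qed.

End Energy.

(** * Absence of atoms *)

Section LowerIntegral.
Context {d} {T : measurableType d} {R : realType}.
Variable mu : {measure set T -> \bar R}.
Local Open Scope ereal_scope.
Import HBNNSimple.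

(* No measurability of [f] and [g]: the integral of a nonnegative function is a
   supremum over the simple functions below it. *)
Lemma ge0_ae_le_integral_lower (D N : set T) (f g : T -> \bar R) :
  measurable D -> measurable N -> mu N = 0 ->
  (forall x, D x -> 0 <= f x) -> (forall x, D x -> 0 <= g x) ->
  (forall x, D x -> ~ N x -> f x <= g x) ->
  \int[mu]_(x in D) f x <= \int[mu]_(x in D) g x.
Proof.
move=> mD mN N0 f0 g0 fg; rewrite !ge0_integralE//.
apply: ge_ereal_sup => /= _ [h /= hf <-].
have mNc : measurable (~` N) by exact: measurableC.
(* Cutting a simple function off on the null set [N] keeps its integral and puts it below [g] on
   [D]. *)
pose h' := mul_nnsfun h (indic_nnsfun R mNc).
apply: le_ereal_sup_tmp => /=; exists (sintegral mu h').
  exists h' => // x.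
  have -> : h' x = (h x * \1_(~` N) x)%R by [].
  rewrite indicE; have := hf x; rewrite /patch; case: ifPn => xD hx.
    case: (boolP (x \in ~` N)) => xN; last by rewrite mulr0; apply: g0; exact: set_mem.
    by rewrite mulr1 (le_trans hx)// fg//; exact: set_mem.
  case: (_ \in _); rewrite ?mulr0// mulr1//.
rewrite -!integralT_nnsfun le_eqVlt; apply/orP; left; apply/eqP.
apply: ae_eq_integral => //.
- exact/measurable_EFinP/measurable_funP.
- exact/measurable_EFinP/measurable_funP.
exists N; split => // x /= /not_implyP[_ hx]; apply: contrapT => xN; apply: hx.
rewrite /=; congr EFin.
have -> : mindic R mNc x = 1%R by rewrite /mindic indicE mem_set.
by rewrite mulr1.
Qed.

Lemma ge0_ae_eq_integral_lower (D N : set T) (f g : T -> \bar R) :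
  measurable D -> measurable N -> mu N = 0 ->
  (forall x, D x -> 0 <= f x) -> (forall x, D x -> 0 <= g x) ->
  (forall x, D x -> ~ N x -> f x = g x) ->
  \int[mu]_(x in D) f x = \int[mu]_(x in D) g x.
Proof.
move=> mD mN N0 f0 g0 fg; apply/eqP; rewrite eq_le; apply/andP; split.
  by apply: (@ge0_ae_le_integral_lower D N) => // x Dx Nx; rewrite fg.
by apply: (@ge0_ae_le_integral_lower D N) => // x Dx Nx; rewrite fg.
Qed.

End LowerIntegral.

(** * Distribution function of a finite measure *)

Section FiniteMeasureR.
Context {R : realType}.
Variable mu : finite_measureR R.

Definition mass : R := fine (mu setT).

Definition dfun (x : R) : R := fine (mu `]-oo, x]%classic).

Lemma fmu A : measurable A -> mu A \is a fin_num.
Proof. by move=> mA; exact: fin_num_measure. Qed.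

Lemma fmu_le A B : measurable A -> measurable B -> A `<=` B -> fine (mu A) <= fine (mu B).
Proof.
by move=> mA mB AB; rewrite fine_le ?fmu//; apply: le_measure; rewrite ?inE.
Qed.

Lemma fmu_ge0 A : 0 <= fine (mu A).
Proof. by rewrite fine_ge0. Qed.

Lemma cvg_fmu_nd (E : nat -> set R) : (forall n, measurable (E n)) ->
  (forall n, E n `<=` E n.+1) -> fine (mu (E n)) @[n --> \oo] --> fine (mu (\bigcup_n E n)).
Proof.
move=> mE ndE; apply: fine_cvg; rewrite fineK; last by apply: fmu; apply: bigcup_measurable => n _; exact: mE.
apply: nondecreasing_cvg_mu; [exact: mE|by apply: bigcup_measurable => n _; exact: mE|].
by apply/nondecreasing_seqP => n; apply/subsetPset; exact: ndE.
Qed.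

Lemma cvg_fmu_ni (E : nat -> set R) : (forall n, measurable (E n)) ->
  (forall n, E n.+1 `<=` E n) -> fine (mu (E n)) @[n --> \oo] --> fine (mu (\bigcap_n E n)).
Proof.
move=> mE niE; apply: fine_cvg; rewrite fineK; last first.
  by apply: fmu; apply: bigcap_measurable => [|n _]; [exists 0%N|exact: mE].
apply: nonincreasing_cvg_mu; [by rewrite ltey_eq (fmu (mE 0%N))|exact: mE| |].
- by apply: bigcap_measurable => [|n _]; [exists 0%N|exact: mE].
- by apply/nonincreasing_seqP => n; apply/subsetPset; exact: niE.
Qed.

Lemma dfun_mono x y : x <= y -> dfun x <= dfun y.
Proof.
by move=> xy; apply: fmu_le => //; apply: subset_itvl; rewrite bnd_simp.
Qed.

Lemma dfun_bounds x : 0 <= dfun x <= mass.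
Proof. by rewrite fmu_ge0 fmu_le. Qed.

Lemma dfun_measurable : measurable_fun setT dfun.
Proof. by apply: nondecreasing_measurable => // x y; exact: dfun_mono. Qed.

Lemma dfun_gt y : y < mass -> exists x, y < dfun x.
Proof.
move=> ym.
have cv : dfun n%:R @[n --> \oo] --> mass.
  rewrite /mass (_ : setT = \bigcup_n `]-oo, n%:R]%classic); last first.
    apply/seteqP; split => // x _; exists (Num.truncn x).+1 => //=.
    by rewrite in_itv/= ltW// truncnS_gt.
  apply: (@cvg_fmu_nd (fun n => `]-oo, n%:R]%classic)) => // n.
  by apply: subset_itvl; rewrite bnd_simp ler_nat.
have [n _ hn] := cvgr_gt _ cv _ ym.
by exists n%:R; exact: (hn n (leqnn n)).
Qed.

Lemma dfun_lt y : 0 < y -> exists x, dfun x < y.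
Proof.
move=> y0.
have cv : dfun (- n%:R) @[n --> \oo] --> (0 : R).
  rewrite -[X in _ --> X]/(fine 0%E) -(measure0 mu).
  rewrite (_ : set0 = \bigcap_n `]-oo, - n%:R]%classic); last first.
    apply/seteqP; split => // x /= hx.
    have := hx (Num.truncn (- x)).+1 I; rewrite /= in_itv/= lerNr leNgt.
    by rewrite truncnS_gt.
  apply: (@cvg_fmu_ni (fun n => `]-oo, - n%:R]%classic)) => // n.
  by apply: subset_itvl; rewrite bnd_simp lerN2 ler_nat.
have [n _ hn] := cvgr_lt _ cv _ y0.
by exists (- n%:R); exact: (hn n (leqnn n)).
Qed.

Lemma dfun_right s : dfun (s + n.+1%:R^-1) @[n --> \oo] --> dfun s.
Proof.
rewrite /dfun (_ : `]-oo, s]%classic = \bigcap_n `]-oo, s + n.+1%:R^-1]%classic); last first.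
  apply/seteqP; split => x /=; rewrite in_itv/=.
    by move=> xs n _ /=; rewrite in_itv/= (le_trans xs)// lerDl.
  move=> h; apply/ler_addgt0Pr => e e0.
  have [n _ hn] := near_infty_natSinv_lt (PosNum e0).
  have := h n I; rewrite /= in_itv/= => /le_trans; apply.
  by rewrite lerD2l ltW// (hn n (leqnn n)).
apply: (@cvg_fmu_ni (fun n => `]-oo, s + n.+1%:R^-1]%classic)) => // n.
by apply: subset_itvl; rewrite bnd_simp lerD2l lef_pV2 ?posrE// ler_nat.
Qed.

Hypothesis noatom : forall x, mu [set x] = 0%E.

(** The jump of [dfun] at [s] is the mass of the point [s]. *)
Lemma dfun_left s : dfun (s - n.+1%:R^-1) @[n --> \oo] --> dfun s.
Proof.
have -> : dfun s = fine (mu `]-oo, s[%classic).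
  rewrite /dfun (_ : `]-oo, s]%classic = `]-oo, s[ `|` [set s]); last first.
    by rewrite setUitv1// bnd_simp.
  have -> : mu (`]-oo, s[ `|` [set s])%classic = (mu `]-oo, s[%classic + mu [set s])%E.
    by apply: measureU => //; apply/seteqP; split => // x [+ hx]; rewrite (hx : x = s) /= in_itv/= ltxx.
  by have -> : mu [set s] = 0%E by []; rewrite adde0.
rewrite (_ : `]-oo, s[%classic = \bigcup_n `]-oo, s - n.+1%:R^-1]%classic); last first.
  apply/seteqP; split => x /=; rewrite in_itv/=.
    rewrite -subr_gt0 => xs.
    have [n _ hn] := near_infty_natSinv_lt (PosNum xs).
    exists n => //=; rewrite in_itv/= lerBrDr -lerBrDl ltW//; exact: (hn n (leqnn n)).
  by move=> [n _ /=]; rewrite in_itv/= => /le_lt_trans; apply; rewrite ltrBlDr ltrDl.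
apply: (@cvg_fmu_nd (fun n => `]-oo, s - n.+1%:R^-1]%classic)) => // n.
by apply: subset_itvl; rewrite bnd_simp lerD2l lerN2 lef_pV2 ?posrE// ler_nat.
Qed.

(** The level set is a ray []-oo, s]], and continuity from both sides forces [dfun s = y]. If the
    set is empty then [y = 0], since [dfun] takes arbitrarily small values. *)
Lemma mu_dfun_le y : 0 <= y -> y < mass -> fine (mu [set x | dfun x <= y]) = y.
Proof.
move=> y0 ym; have [x1 hx1] := dfun_gt ym.
pose E := [set x | dfun x <= y].
have [[x0 Ex0]|E0] := pselect (E !=set0); last first.
  have -> : [set x | dfun x <= y] = set0.
    by apply/seteqP; split => // x Ex; exfalso; apply: E0; exists x.
  rewrite measure0/=; apply/eqP; rewrite eq_le y0/= leNgt; apply/negP => /dfun_lt[x hx].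
  by apply: E0; exists x; exact: ltW.
have hs : has_sup E.
  split; first by exists x0.
  exists x1 => x /= Ex; rewrite leNgt; apply/negP => /ltW /dfun_mono.
  by move=> /(lt_le_trans hx1); rewrite ltNge Ex.
set s := sup E.
have below x : x < s -> dfun x <= y.
  move=> xs; have [z Ez xz] := sup_adherent (ltac:(by rewrite subr_gt0) : 0 < s - x) hs.
  rewrite opprB addrC subrK in xz.
  by rewrite (le_trans _ Ez)// dfun_mono// ltW.
have above x : s < x -> y < dfun x.
  move=> sx; rewrite ltNge; apply/negP => h.
  have : x <= s by apply: sup_upper_bound.
  by rewrite leNgt sx.
have le1 : dfun s <= y.
  have cv := dfun_left (s := s).
  rewrite -(cvg_lim _ cv)//; apply: limr_le; first by apply/cvg_ex; eexists; exact: cv.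
  by apply: nearW => n; apply: below; rewrite ltrBlDr ltrDl.
have ge1 : y <= dfun s.
  have cv := dfun_right (s := s).
  rewrite -(cvg_lim _ cv)//; apply: limr_ge; first by apply/cvg_ex; eexists; exact: cv.
  by apply: nearW => n; apply/ltW/above; rewrite ltrDl.
have -> : [set x | dfun x <= y] = `]-oo, s]%classic.
  apply/seteqP; split => x /=; rewrite in_itv/=.
    by move=> h; rewrite leNgt; apply/negP => /above; rewrite ltNge h.
  by move=> xs; rewrite (le_trans (dfun_mono xs)).
by apply/eqP; rewrite eq_le le1 ge1.
Qed.

Let mdfun_gt y : measurable [set x | y < dfun x].
Proof.
rewrite (_ : [set x | _] = setT `&` dfun @^-1` `]y, +oo[); first exact: dfun_measurable.
by apply/seteqP; split => x /=; rewrite in_itv/= andbT; [|case].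
Qed.

Let mdfun_le y : measurable [set x | dfun x <= y].
Proof.
rewrite (_ : [set x | _] = setT `&` dfun @^-1` `]-oo, y]); first exact: dfun_measurable.
by apply/seteqP; split => x /=; rewrite in_itv/=; [|case].
Qed.

(** Rays []y, +oo[] are stable under intersection and generate the Borel sets, so these values
    determine the image of [mu] under [dfun]. *)
Lemma mu_dfun_gt y : mu [set x | y < dfun x] = lebesgue_measure (`]y, +oo[ `&` `[0, mass] : set R).
Proof.
have m0 : 0 <= mass by exact: fmu_ge0.
have [y0|y0] := ltP y 0.
  have -> : [set x | y < dfun x] = setT.
    by apply/seteqP; split => // x _ /=; case/andP: (dfun_bounds x) => h _; exact: lt_le_trans h.
  rewrite (_ : _ `&` _ = `[0, mass]%classic).
    rewrite lebesgue_measure_itv/= lte_fin sube0 -[LHS]fineK ?fmu// -/mass.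
    by move: m0; rewrite le_eqVlt => /predU1P[<-|->]; rewrite ?ltxx.
  apply/seteqP; split => x /=; first by case.
  by rewrite !in_itv/= => /andP[h1 h2]; rewrite h1 h2 (lt_le_trans y0).
have [ym|my] := ltP y mass.
  have -> : mu [set x | y < dfun x] = (mass - y)%:E.
    rewrite -[LHS](fineK (fmu (mdfun_gt y))); congr (_%:E).
    have : mass = fine (mu [set x | dfun x <= y]) + fine (mu [set x | y < dfun x]).
      rewrite /mass (_ : setT = [set x | dfun x <= y] `|` [set x | y < dfun x]).
        rewrite measureU ?fineD ?fmu//.
        - by first [exact: mdfun_gt|exact: mdfun_le].
        - by first [exact: mdfun_gt|exact: mdfun_le].
        - by first [exact: mdfun_gt|exact: mdfun_le].
        - by first [exact: mdfun_gt|exact: mdfun_le].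
        - by apply/seteqP; split => // x [/= h1 h2]; move: h1; rewrite leNgt h2.
      by apply/seteqP; split => // x _ /=; case: (leP (dfun x) y); [left|right].
    by rewrite mu_dfun_le//; lra.
  rewrite (_ : _ `&` _ = `]y, mass]%classic).
    by rewrite lebesgue_measure_itv/= lte_fin ym.
  apply/seteqP; split => x /=; rewrite !in_itv/= ?andbT.
    by move=> [h1 /andP[_ h2]]; rewrite h1 h2.
  by move=> /andP[h1 h2]; rewrite h1 h2 (le_trans y0)// ltW.
rewrite (_ : [set x | _] = set0); last first.
  apply/seteqP; split => // x /= h; have /andP[_ h2] := dfun_bounds x.
  by have := lt_le_trans h (le_trans h2 my); rewrite ltxx.
rewrite (_ : _ `&` _ = set0) ?measure0//.
apply/seteqP; split => // x /=; rewrite !in_itv/= andbT => -[h /andP[_ h2]].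
by have := lt_le_trans h (le_trans h2 my); rewrite ltxx.
Qed.

(* The distribution function of an atomless [mu] maps it to Lebesgue measure on
   [0, mass]. *)
Lemma integral_dfun (sg : R -> R) : (forall u, 0 <= u -> 0 <= sg u) ->
  measurable_fun (`[0, +oo[ : set R) sg ->
  \int[mu]_x (sg (dfun x)) = sigma0 sg mass.
Proof.
move=> sg0 msg; rewrite /sigma0 /Rintegral; congr fine.
have msg' : measurable_fun (`[0, mass] : set R) sg.
  apply: measurable_funS msg => //; apply: subset_itvl; rewrite bnd_simp//.
pose T := measurableTypeR R.
have mD : @measurable_fun _ _ T T setT (dfun : T -> T) := dfun_measurable.
pose m1 : {measure set T -> \bar R} :=
  measure_function_pushforward__canonical__measure_function_Measure mu mD.
pose m2 : {measure set T -> \bar R} := mrestr lebesgue_measure (measurable_itv `[0, mass]).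
have m12 (A : set R) : measurable A -> m1 A = m2 A.
  apply: (@measure_unique _ R T (@RGenOInfty.G R) (fun n => `]- n%:R, +oo[%classic)).
  - exact: RGenOInfty.measurableE.
  - move=> _ _ [x ->] [y ->]; rewrite /RGenOInfty.G/=; exists (Num.max x y); apply/seteqP; split => z /=.
      by rewrite !in_itv/= !andbT gt_max => -[-> ->].
    by rewrite !in_itv/= !andbT gt_max => /andP[-> ->].
  - by move=> n; exists (- n%:R).
  - apply/seteqP; split => // x _; exists (Num.truncn (- x)).+1 => //=.
    by rewrite in_itv/= andbT ltrNl truncnS_gt.
  - move=> _ [y ->]; transitivity (mu [set x | y < dfun x]); last exact: mu_dfun_gt.
    by rewrite /m1 /= /pushforward; congr (mu _); apply/seteqP; split => x /=; rewrite in_itv/= andbT.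
  - by move=> n; rewrite ltey_eq fmu//; rewrite -[X in measurable X]setTI; exact: dfun_measurable.
pose D : set T := `[0, mass]%classic.
transitivity (\int[m1]_(y in D) (sg y)%:E)%E.
  rewrite (@ge0_integral_pushforward _ _ T T R (dfun : T -> T) mD mu D (EFin \o sg))//.
  - rewrite (_ : dfun @^-1` _ = setT)//; apply/seteqP; split => // x _ /=.
    by rewrite /D/= in_itv/= dfun_bounds.
  - exact: measurable_itv.
  - exact/measurable_EFinP.
  - by move=> y; rewrite inE /D/= in_itv/= => /andP[y0 _]; rewrite lee_fin sg0.
apply: eq_measure_integral => A mA AD; rewrite (m12 A mA) /m2 /mrestr.
by transitivity (lebesgue_measure (A `&` D)) => //; rewrite setIidl.
Qed.

End FiniteMeasureR.

(** * Fourier coefficients and atoms *)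

Section Fourier.
Context {R : realType}.
Variable mu : finite_measureR R.
Let T := measurableTypeR R.
Implicit Types f g : T -> R.

Lemma bmf_integrable f : bmf f -> mu.-integrable setT (EFin \o f).
Proof.
move=> [mf [B fB]]; apply: measurable_bounded_integrable => //.
  by rewrite -ge0_fin_numE ?fmu.
exists B; split; first exact: num_real.
by move=> M BM x _ /=; rewrite (le_trans (fB x))// ltW.
Qed.

Lemma int_cst (c : R) : \int[mu]_x c = c * mass mu.
Proof. by rewrite Rintegral_cst. Qed.

Lemma int_sum n (f : 'I_n -> T -> R) : (forall i, bmf (f i)) ->
  \int[mu]_x (\sum_(i < n) f i x) = \sum_(i < n) \int[mu]_x f i x.
Proof.
elim: n f => [f _|n IH f bf].
  rewrite big_ord0 -[RHS](mul0r (mass mu)) -int_cst.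
  by congr (Rintegral _ _ _); apply/funext=> w; rewrite big_ord0.
rewrite big_ord_recr/= -IH//.
rewrite -RintegralD//; [|exact/bmf_integrable/bmf_sum|exact/bmf_integrable].
by congr (Rintegral _ _ _); apply/funext => w; rewrite big_ord_recr.
Qed.

Let bmf_affine (h : R -> R) (k a : R) : continuous h -> (forall x, `|h x| <= 1) ->
  bmf (fun x : T => h (k * x - a)).
Proof.
move=> ch hb; split; last by exists 1.
apply: continuous_measurable_fun => x; apply: continuous_comp; last exact: ch.
by apply: cvgB; [apply: cvgM; [exact: cvg_cst|exact: cvg_id]|exact: cvg_cst].
Qed.

Lemma bmf_cos (k a : R) : bmf (fun x : T => cos (k * x - a)).
Proof. by apply: bmf_affine; [exact: continuous_cos|exact: cos_max]. Qed.

Lemma bmf_sin (k a : R) : bmf (fun x : T => sin (k * x - a)).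
Proof. by apply: bmf_affine; [exact: continuous_sin|exact: sin_max]. Qed.

Section Fejer.
Variables (x0 e : R) (K : nat).
Let h (k : nat) (x : T) := cos (k%:R * x - k%:R * x0).
Let g (k : nat) (x : T) := sin (k%:R * x - k%:R * x0).
Let A (n : nat) (x : T) := \sum_(j < n) h (K * j) x.
Let B (n : nat) (x : T) := \sum_(j < n) g (K * j) x.
Let fejer n x := A n x ^+ 2 + B n x ^+ 2.
Hypothesis e0 : 0 <= e.
Hypothesis hK : forall k, (K <= k)%N -> \int[mu]_x h k x <= e.

Let hb k : bmf (h k). Proof. exact: bmf_cos. Qed.
Let gb k : bmf (g k). Proof. exact: bmf_sin. Qed.
Let fb n : bmf (fejer n).
Proof. by apply: bmfD; apply: bmfX; apply: bmf_sum. Qed.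

(** [fejer n] is the squared modulus of a sum of [n] unit complex numbers. One more adds its own
    square 1 and twice its scalar products with the earlier ones, which are cosines of frequencies
    [K * (n - j)]. *)
Let fejerS n x : fejer n.+1 x = fejer n x + (1 + 2 * \sum_(j < n) h (K * (n - j)) x).
Proof.
have -> : \sum_(j < n) h (K * (n - j)) x = A n x * h (K * n) x + B n x * g (K * n) x.
  rewrite /A /B !mulr_suml -big_split/=; apply: eq_bigr => j _.
  rewrite /h /g addrC [sin _ * sin _]mulrC [cos _ * cos _]mulrC addrC -cosB; congr cos.
  by rewrite mulnBr natrB ?leq_mul2l ?(ltnW (ltn_ord j)) ?orbT//; ring.
rewrite /fejer /A /B !big_ord_recr/= -/(A n x) -/(B n x).
have := cos2Dsin2 ((K * n)%:R * x - (K * n)%:R * x0); rewrite -/(h _ _) -/(g _ _) => E.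
move: (h _ x) (g _ x) (A n x) (B n x) E => a b u v E; rewrite [X in _ + (X + _)](esym E); ring.
Qed.

(** The frequencies [K * (n - j)] with [j < n] are at least [K], so the step from [n] to [n + 1]
    adds at most [mass mu + 2 * n * e]. *)
Let fejer_int n : \int[mu]_x fejer n x <= n%:R * mass mu + n%:R ^+ 2 * e.
Proof.
elim: n => [|n IH].
  rewrite !mul0r expr0n/= mul0r addr0 -[leRHS](mul0r (mass mu)) -int_cst.
  rewrite le_eqVlt; apply/orP; left; apply/eqP; congr (Rintegral _ _ _).
  by apply/funext => x; rewrite /fejer /A /B !big_ord0 expr0n/= addr0.
have -> : \int[mu]_x fejer n.+1 x =
    \int[mu]_x fejer n x + (mass mu + 2 * \sum_(j < n) \int[mu]_x h (K * (n - j)) x).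
  have sb : bmf (fun x => \sum_(j < n) h (K * (n - j)) x) by exact: bmf_sum.
  have s2 := bmfM (bmf_cst 2) sb.
  rewrite -int_sum// -RintegralZl//; last exact: bmf_integrable.
  rewrite -[mass mu]mul1r -int_cst -RintegralD//; [|exact/bmf_integrable/bmf_cst|exact: bmf_integrable].
  rewrite -RintegralD//; [|exact: bmf_integrable|exact/bmf_integrable/bmfD/s2/bmf_cst].
  by congr (Rintegral _ _ _); apply/funext => x; rewrite fejerS.
have le1 : \sum_(j < n) \int[mu]_x h (K * (n - j)) x <= n%:R * e.
  rewrite -[n in n%:R]card_ord mulr_natl -sumr_const; apply: ler_sum => j _.
  by apply: hK; rewrite leq_pmulr// subn_gt0.
rewrite -natr1.
have : (n%:R + 1) ^+ 2 * e = n%:R ^+ 2 * e + 2 * (n%:R * e) + e by rewrite sqrrD -mulr_natl; ring.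
by move: le1 IH e0; set sm := \sum_(j < n) _; set fi := \int[mu]_x _; lra.
Qed.

(* The squared modulus of the sum of the [exp (i K j (x - x0))] is [n ^+ 2] at [x0],
   and its integral only involves Fourier coefficients of order at least [K]. *)
Lemma fejer_atom n : n%:R ^+ 2 * fine (mu [set x0]) <= n%:R * mass mu + n%:R ^+ 2 * e.
Proof.
apply: le_trans (fejer_int n).
have -> : fine (mu [set x0]) = \int[mu]_x \1_[set x0] x.
  by rewrite /Rintegral integral_indic// setIT.
rewrite -RintegralZl//; last by apply: bmf_integrable; apply: bmf_indic.
apply: le_Rintegral => //.
- by apply: bmf_integrable; apply: bmfM; [exact: bmf_cst|exact: bmf_indic].
- exact: bmf_integrable.
move=> x _; rewrite indicE; have [xx|xx] := boolP (x \in _); last first.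
  by rewrite mulr0 addr_ge0// sqr_ge0.
have -> : x = x0 by move: xx; rewrite inE.
rewrite mulr1 /fejer (_ : A n x0 = n%:R); first by rewrite lerDl sqr_ge0.
rewrite /A -[n in RHS]card_ord -sumr_const; apply: eq_bigr => j _.
by rewrite /h subrr cos0.
Qed.

End Fejer.

(** [K] is taken beyond the index from which both coefficients are below [e / 4]; recentring at [x0]
    mixes them with weights at most 1. Divided by the square of [n], [fejer_atom] bounds the atom by
    [mass mu / n + e / 2]. *)
Lemma no_atom : 
  \int[mu]_x cos (k%:R * x) @[k --> \oo] --> (0 : R) ->
  \int[mu]_x sin (k%:R * x) @[k --> \oo] --> (0 : R) ->
  forall x, mu [set x] = 0%E.
Proof.
move=> ccv scv x0.
suff a0 : fine (mu [set x0]) <= 0.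
  rewrite -[LHS](fineK (fmu mu (measurable_set1 x0))); congr EFin.
  by apply/eqP; rewrite eq_le a0 fmu_ge0.
apply/ler_addgt0Pr => e e0; rewrite add0r.
have e2 : 0 < e / 2 by rewrite divr_gt0.
have e4 : 0 < e / 4 by rewrite divr_gt0.
move/cvgrPdist_lt : ccv => /(_ _ e4)[N1 _ h1].
move/cvgrPdist_lt : scv => /(_ _ e4)[N2 _ h2].
pose K := (maxn N1 N2).+1.
have hK k : (K <= k)%N -> \int[mu]_x cos (k%:R * x - k%:R * x0) <= e / 2.
  move=> Kk.
  have k1 : (N1 <= k)%N by rewrite (leq_trans _ Kk)// ltnW// ltnS leq_maxl.
  have k2 : (N2 <= k)%N by rewrite (leq_trans _ Kk)// ltnW// ltnS leq_maxr.
  have := h1 _ k1; have := h2 _ k2; rewrite /= !sub0r !normrN.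
  set ck := \int[mu]_x cos _; set sk := \int[mu]_x sin _ => sk4 ck4.
  have bc : bmf (fun x : T => cos (k%:R * x)).
    by have := bmf_cos k%:R 0; under eq_fun do rewrite subr0.
  have bs : bmf (fun x : T => sin (k%:R * x)).
    by have := bmf_sin k%:R 0; under eq_fun do rewrite subr0.
  have -> : \int[mu]_x cos (k%:R * x - k%:R * x0) =
      cos (k%:R * x0) * ck + sin (k%:R * x0) * sk.
    rewrite /ck /sk -!RintegralZl//; [|exact: bmf_integrable|exact: bmf_integrable].
    rewrite -RintegralD//; [|exact/bmf_integrable/bmfM/bc/bmf_cst|exact/bmf_integrable/bmfM/bs/bmf_cst].
    by congr (Rintegral _ _ _); apply/funext => x; rewrite cosB; ring.
  apply: (le_trans (ler_norm _)); apply: (le_trans (ler_normD _ _)); rewrite !normrM.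
  have := cos_max (k%:R * x0); have := sin_max (k%:R * x0).
  by have := normr_ge0 ck; have := normr_ge0 sk; nra.
have H n : fine (mu [set x0]) <= n.+1%:R^-1 * mass mu + e / 2.
  have := fejer_atom (ltW e2) hK n.+1.
  have n0 : 0 < n.+1%:R :> R by [].
  rewrite (_ : n.+1%:R * mass mu + _ = n.+1%:R ^+ 2 * (n.+1%:R^-1 * mass mu + e / 2)).
    by rewrite ler_pM2l// exprn_gt0.
  by rewrite mulrDr mulrA expr2 mulfK// gt_eqF.
have m0 : 0 <= mass mu by exact: fmu_ge0.
have m1 : 0 < mass mu + 1 by lra.
have p0 : 0 < e / 2 / (mass mu + 1) by rewrite divr_gt0.
have [n _ hn] := near_infty_natSinv_lt (PosNum p0).
have {hn} := hn n (leqnn n); rewrite /= => hn.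
apply: (le_trans (H n)); have h3 : n.+1%:R^-1 * mass mu <= e / 2.
  rewrite (@le_trans _ _ (n.+1%:R^-1 * (mass mu + 1)))//; first by rewrite ler_wpM2l//; lra.
  by move: hn; rewrite ltr_pdivlMr// => /ltW.
by rewrite [leRHS](splitr e) lerD2r.
Qed.

End Fourier.

(** * Series with bounded integrals *)

Section BorelCantelli.
Context {R : realType} {d : measure_display} {T : measurableType d}.
Variable mu : {measure set T -> \bar R}.

(** By monotone convergence the sum of the series has integral at most [B], hence is finite almost
    everywhere. *)
Lemma ae_bounded_sum (D : set T) (f : nat -> T -> R) (B : R) :
  measurable D -> (forall k, mu.-integrable D (EFin \o f k)) ->
  (forall k x, D x -> 0 <= f k x) ->
  (forall n, \sum_(0 <= k < n) \int[mu]_(x in D) f k x <= B) ->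
  {ae mu, forall x, D x -> exists b, forall n, \sum_(0 <= k < n) f k x <= b}.
Proof.
move=> mD If f0 fB.
pose G x : \bar R := (\sum_(0 <= k <oo) (f k x)%:E)%E.
have f0' k x : D x -> (0 <= (f k x)%:E)%E by move=> Dx; rewrite lee_fin f0.
have mf k : measurable_fun D (EFin \o f k) by exact: measurable_int (If k).
have mG : measurable_fun D G.
  by apply: ge0_emeasurable_sum => k ?; [move=> Dx _; exact: f0'|exact: mf].
have G0 x : D x -> (0 <= G x)%E by move=> Dx; apply: nneseries_ge0 => k _ _; exact: f0'.
have IG : mu.-integrable D G.
  apply/integrableP; split => //.
  rewrite (eq_integral G); last by move=> x; rewrite inE => Dx; rewrite gee0_abs// G0.
  rewrite integral_nneseries//.
  apply: (@le_lt_trans _ _ B%:E); last by rewrite ltry.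
  apply: lime_le; first by apply: is_cvg_nneseries => n _ _; apply: integral_ge0 => x; exact: f0'.
  apply: nearW => n; apply: le_trans (_ : ((\sum_(0 <= k < n) \int[mu]_(x in D) f k x)%:E <= _)%E).
    rewrite -sumEFin; apply: lee_sum => k _; rewrite /Rintegral fineK//.
    exact: integrable_fin_num (If k).
  by rewrite lee_fin.
have := integrable_ae mD IG; apply: filterS => x /= h Dx.
exists (fine (G x)) => n; rewrite -lee_fin fineK; last exact: h.
by rewrite -sumEFin; apply: nneseries_lim_ge => k *; exact: f0'.
Qed.

End BorelCantelli.

Lemma bounded_sum_cvg0 (R : realType) (u : nat -> R) (B : R) : (forall k, 0 <= u k) ->
  (forall n, \sum_(0 <= k < n) u k <= B) -> u @ \oo --> (0 : R).
Proof.
move=> u0 uB; apply: cvg_series_cvg_0; apply: nondecreasing_is_cvgn.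
  by apply/nondecreasing_seqP => n; rewrite /series/= big_nat_recr//= lerDl.
by exists B => _ [n _ <-]; exact: uB.
Qed.

(** Telescoping, with [1 / (a + 1) ^ 2 <= 1 / a - 1 / (a + 1)]. *)
Lemma sum_invsq (R : realType) n : \sum_(0 <= k < n) (k.+1%:R ^+ 2)^-1 <= (2 : R).
Proof.
suff H m : \sum_(0 <= k < m.+1) (k.+1%:R ^+ 2)^-1 <= 2 - m.+1%:R^-1 :> R.
  case: n => [|n]; first by rewrite big_nil.
  by apply: (le_trans (H n)); rewrite gerBl.
elim: m => [|m IH]; first by rewrite big_nat1 expr1n invr1; lra.
rewrite big_nat_recr//=.
rewrite -[m.+2%:R]natr1; set a := m.+1%:R in IH *.
have a0 : 0 < a by rewrite /a.
have a1 : 0 < a + 1 by lra.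
have E : a^-1 - (a + 1)^-1 = (a * (a + 1))^-1 by field; rewrite !gt_eqF.
have le1 : ((a + 1) ^+ 2)^-1 <= a^-1 - (a + 1)^-1.
  rewrite E lef_pV2 ?posrE; [|exact: exprn_gt0|exact: mulr_gt0].
  by rewrite expr2 ler_wpM2r// ?ltW//; lra.
by apply: (le_trans (lerD IH le1)); rewrite addrA subrK.
Qed.

(** * Trigonometric test functions *)

Section Trig.
Context {R : realType}.
Implicit Types k a b x : R.

(** With two coefficients the family is closed under differentiation, so the second derivative is
    obtained by applying one rule twice. *)
Definition trig k a b x : R := a * cos (k * x) + b * sin (k * x).

Lemma is_derive_trig k a b x : is_derive x (1 : R) (trig k a b) (trig k (k * b) (- (k * a)) x).
Proof.
have hk : is_derive x (1 : R) ( *%R k : R -> R) k.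
  have h := is_deriveZ k (is_derive_id x (1 : R)).
  by apply: is_derive_eq h _; rewrite /GRing.scale/= mulr1.
have hc : is_derive x (1 : R) (cos \o *%R k) (- (k * sin (k * x))).
  have h := is_derive1_comp (is_derive_cos (k * x)) hk.
  by apply: is_derive_eq h _; rewrite mulNr [sin _ * _]mulrC.
have hs : is_derive x (1 : R) (sin \o *%R k) (k * cos (k * x)).
  have h := is_derive1_comp (is_derive_sin (k * x)) hk.
  by apply: is_derive_eq h _; rewrite mulrC.
have h := is_deriveD (is_deriveZ a hc) (is_deriveZ b hs).
by apply: is_derive_eq h _; rewrite /trig /GRing.scale/=; ring.
Qed.

Lemma derive_trig k a b : (trig k a b)^`()%classic = trig k (k * b) (- (k * a)).
Proof. by apply/funext => x; rewrite derive1E; have [_ ->] := is_derive_trig k a b x. Qed.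

Lemma derive2_trig k a b x : (trig k a b)^`(2)%classic x = - k ^+ 2 * trig k a b x.
Proof. by rewrite derive1nS derive1n1 !derive_trig /trig; ring. Qed.

Lemma trig_continuous k a b : continuous (trig k a b).
Proof.
move=> x; apply: differentiable_continuous; apply/derivable1_diffP.
by have [] := is_derive_trig k a b x.
Qed.

Lemma trig_bound k a b x : `|trig k a b x| <= `|a| + `|b|.
Proof.
rewrite (le_trans (ler_normD _ _))// !normrM lerD//.
  by rewrite ler_piMr// cos_max.
by rewrite ler_piMr// sin_max.
Qed.

Lemma trig_bounded k a b : [bounded trig k a b x | x in [set: R]].
Proof.
exists (`|a| + `|b|); split; first exact: num_real.
by move=> B hB x _ /=; rewrite (le_trans (trig_bound k a b x))// ltW.
Qed.

Lemma C2b_trig k a b : C2b (trig k a b).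
Proof.
have e2 : (trig k a b)^`(2)%classic = trig k (k * - (k * a)) (- (k * (k * b))).
  by rewrite derive1nS derive1n1 !derive_trig.
split.
- by move=> x; have [] := is_derive_trig k a b x.
- by move=> x; rewrite derive_trig; have [] := is_derive_trig k (k * b) (- (k * a)) x.
- by rewrite e2; exact: trig_continuous.
- by rewrite e2 derive_trig; split; exact: trig_bounded.
Qed.

End Trig.

(** * Extension of paths to negative times, and primitives *)

Section SegmentPrimitive.
Context {R : realType}.
Implicit Types f : R -> R.

Lemma max0_dist (t s : R) : `|Num.max 0 t - Num.max 0 s| <= `|t - s|.
Proof.
have h1 := ler_norm (t - s); have h2 := ler_norm (s - t); rewrite distrC in h2.
rewrite ler_norml; apply/andP; split.
  by case: (leP 0 t) => ?; case: (leP 0 s) => ?; lra.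
by case: (leP 0 t) => ?; case: (leP 0 s) => ?; lra.
Qed.

(** Freezing a path at its initial value for negative times turns continuity on [[0, +oo[] into the
    continuity on the line that the stopping arguments assume. *)
Lemma continuous_max0 f : {within `[0, +oo[, continuous f} -> continuous (fun t : R => f (Num.max 0 t)).
Proof.
move=> cf t; apply/cvgrPdist_lt => e e0.
have m0 : 0 <= Num.max 0 t by rewrite le_max lexx.
move/subspace_continuousP : cf => /(_ (Num.max 0 t)) /=; rewrite in_itv/= andbT => /(_ m0).
move=> /cvgrPdist_lt/(_ e e0).
move=> /nbhs_ballP[r /= r0 hr]; exists r => //= s ts.
have s0 : 0 <= Num.max 0 s by rewrite le_max lexx.
apply: hr; last by rewrite /= in_itv/= andbT.
rewrite /ball/= in ts *; apply: le_lt_trans ts.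
exact: max0_dist.
Qed.

Lemma lipschitz_continuous_max0 f :
  (forall b, exists2 L : R, 0 <= L &
    forall s t, 0 <= s -> s <= t -> t <= b -> `|f t - f s| <= L * (t - s)) ->
  continuous (fun t : R => f (Num.max 0 t)).
Proof.
move=> lf; apply: continuous_max0; apply/subspace_continuousP => t /=; rewrite in_itv/= andbT => t0.
apply/cvgrPdist_lt => e e0; have [L L0 hL] := lf (t + 1).
have r0 : 0 < Num.min 1 (e / (L + 1)) by rewrite lt_min ltr01/= divr_gt0//; lra.
apply/nbhs_ballP; exists (Num.min 1 (e / (L + 1))) => //= s; rewrite /ball/= lt_min => /andP[ts1 ts2] /=.
rewrite in_itv/= andbT => s0.
have lt_e (v : R) : 0 <= v -> v < e / (L + 1) -> L * v < e.
  by move=> v0; rewrite ltr_pdivlMr; [|lra]; nra.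
have [st|/ltW ts] := leP s t.
  apply: (@le_lt_trans _ _ (L * (t - s))); first by apply: hL => //; rewrite lerDl.
  by apply: lt_e; rewrite ?subr_ge0//; rewrite ger0_norm ?subr_ge0 in ts2.
rewrite distrC in ts1 ts2; rewrite distrC; rewrite !ger0_norm ?subr_ge0// in ts1 ts2.
apply: (@le_lt_trans _ _ (L * (s - t))); first by apply: hL => //; lra.
by apply: lt_e; rewrite ?subr_ge0.
Qed.

Lemma sint_prim_continuous f : continuous f -> continuous (fun t : R => sint f 0 (Num.max 0 t)).
Proof.
move=> cf; apply: (@lipschitz_continuous_max0 (sint f 0)) => b.
have [B /= [_ hB]] := compact_bounded (continuous_compact (continuous_subspaceT cf) (@segment_compact R 0 b)).
exists (`|B| + 1) => [|s t s0 st tb]; first by rewrite addr_ge0.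
rewrite sint_diff//; apply: sint_bound => // x /andP[sx xt].
apply: (hB (`|B| + 1)); first by rewrite (le_lt_trans (ler_norm _))// ltrDl.
by exists x => //=; rewrite in_itv/= (le_trans s0 sx) (le_trans xt).
Qed.

Lemma sint_cst (a s t : R) : s <= t -> sint (fun=> a) s t = a * (t - s).
Proof.
move=> st; rewrite /sint Rintegral_cst//; congr (_ * _).
transitivity (fine (lebesgue_measure (`[s, t]%classic : set R))) => //.
rewrite lebesgue_measure_itv/= lte_fin.
by move: st; rewrite le_eqVlt => /predU1P[->|->//]; rewrite ltxx/= subrr.
Qed.

Lemma sint_mono f g (s t : R) : continuous f -> continuous g ->
  (forall r, s <= r <= t -> f r <= g r) -> sint f s t <= sint g s t.
Proof.
move=> cf cg fg; apply: le_Rintegral; [by []|exact: sint_integrable|exact: sint_integrable|].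
by move=> r /=; rewrite in_itv/=; exact: fg.
Qed.

End SegmentPrimitive.

Section LowerBounds.
Context {d} {T : measurableType d} {R : realType}.
Variable mu : {measure set T -> \bar R}.

(** The integral of a nonnegative function is a supremum over simple functions, so pointwise bounds
    suffice. The bracket is a nested integral, to which this is applied once in space and once in
    time. *)
Lemma Rintegral_lower_bound (D : set T) (f : T -> R) (C : R) : measurable D ->
  (mu D < +oo)%E -> (forall x, D x -> 0 <= f x <= C) ->
  0 <= \int[mu]_(x in D) f x <= C * fine (mu D).
Proof.
move=> mD fD fC.
have D0 : mu D \is a fin_num by rewrite ge0_fin_numE.
have i0 : (0 <= \int[mu]_(x in D) (f x)%:E)%E.
  by apply: integral_ge0 => x Dx; rewrite lee_fin; case/andP: (fC x Dx).
have i1 : (\int[mu]_(x in D) (f x)%:E <= (C * fine (mu D))%:E)%E.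
  rewrite EFinM fineK// -integral_cst//.
  apply: (@ge0_ae_le_integral_lower _ _ _ mu D set0) => //.
  - by move=> x Dx; rewrite lee_fin; case/andP: (fC x Dx).
  - by move=> x Dx; rewrite lee_fin; case/andP: (fC x Dx); exact: le_trans.
  - by move=> x Dx _; rewrite lee_fin; case/andP: (fC x Dx).
rewrite /Rintegral fine_ge0//= -[leRHS]/(fine (C * fine (mu D))%:E) fine_le//.
by rewrite ge0_fin_numE// (le_lt_trans i1)// ltry.
Qed.

End LowerBounds.

(** * Growth of [sigma0] *)

Section Sigma0.
Context {R : realType}.
Variable sigma : R -> R.
Hypothesis sigma_ge0 : forall u, 0 <= u -> 0 <= sigma u.
Hypothesis sigma_borel : measurable_fun (`[0, +oo[ : set R) sigma.
Hypothesis sigma_bounded : forall n : nat, (1 <= n)%N ->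
  [bounded sigma u | u in `[0, n%:R]%classic].
Local Notation leb := (@lebesgue_measure R).

Lemma sigma_bound (b : R) : exists2 L, 0 <= L & forall u, 0 <= u <= b -> 0 <= sigma u <= L.
Proof.
have [B /= [_ hB]] := sigma_bounded (ltn0Sn (Num.truncn `|b|)).
exists (`|B| + 1) => [|u /andP[u0 ub]]; first by rewrite addr_ge0.
rewrite sigma_ge0//=; apply: (le_trans (ler_norm _)).
apply: (hB (`|B| + 1)); first by rewrite (le_lt_trans (ler_norm _))// ltrDl.
rewrite /= in_itv/= u0 (le_trans ub)// (le_trans (ler_norm b))// ltW//.
exact: truncnS_gt.
Qed.

Let leb_itv_lty (b1 b2 : bool) (x y : R) : (leb [set` Interval (BSide b1 x) (BSide b2 y)] < +oo)%E.
Proof. by rewrite lebesgue_measure_itv/=; case: ifP => // _; exact: ltry. Qed.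

Lemma sigma0_integrable (x : R) : leb.-integrable `[0, x] (EFin \o sigma).
Proof.
have [L L0 hL] := sigma_bound x.
apply: measurable_bounded_integrable => //.
- exact: leb_itv_lty.
- by apply: measurable_funS sigma_borel => //; apply: subset_itvl; rewrite bnd_simp.
exists L; split; first exact: num_real.
move=> M LM u /=; rewrite in_itv/= => hu; case/andP: (hL u hu) => h1 h2.
by rewrite ger0_norm// (le_trans h2)// ltW.
Qed.

Lemma sigma0_diff (x y L : R) : 0 <= x -> x <= y ->
  (forall u, 0 <= u <= y -> 0 <= sigma u <= L) ->
  0 <= sigma0 sigma y - sigma0 sigma x <= L * (y - x).
Proof.
move=> x0 xy hL.
rewrite /sigma0 Rintegral_itvB ?bnd_simp//; last exact: sigma0_integrable.
have /andP[h1 h2] : 0 <= \int[leb]_(u in `]x, y]) sigma u <= L * fine (leb `]x, y]%classic).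
  apply: Rintegral_lower_bound => //; first exact: leb_itv_lty.
  move=> u /=; rewrite in_itv/= => /andP[xu uy]; apply: hL.
  by rewrite uy (le_trans x0)// ltW.
rewrite h1/= (le_trans h2)// lebesgue_measure_itv/= lte_fin.
by move: xy; rewrite le_eqVlt => /predU1P[->|->//]; rewrite ltxx subrr.
Qed.

Lemma sigma0_0 : sigma0 sigma 0 = 0.
Proof. by rewrite /sigma0 set_itv1 Rintegral_set1. Qed.

Lemma sigma0_mono (x y : R) : 0 <= x -> x <= y -> sigma0 sigma x <= sigma0 sigma y.
Proof.
move=> x0 xy; have [L L0 hL] := sigma_bound y.
by have /andP[+ _] := sigma0_diff x0 xy hL; rewrite subr_ge0.
Qed.

Lemma sigma0_ge0 (x : R) : 0 <= x -> 0 <= sigma0 sigma x.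
Proof. by move=> x0; rewrite -sigma0_0; apply: sigma0_mono. Qed.

Lemma sigma0_continuous : continuous (fun t : R => sigma0 sigma (Num.max 0 t)).
Proof.
apply: lipschitz_continuous_max0 => b; have [L L0 hL] := sigma_bound b.
exists L => // s t s0 st tb; have [|h1 h2] := andP (@sigma0_diff s t L s0 st _).
  by move=> u /andP[u0 ut]; apply: hL; rewrite u0 (le_trans ut).
by rewrite ger0_norm.
Qed.

(** The cap at 1 makes powers of [x < e] decrease when the exponent grows. *)
Lemma near0_right (V : set R) : (0^'+ : set_system R) V ->
  exists2 e : R, 0 < e <= 1 & forall x, 0 < x -> x < e -> V x.
Proof.
move=> /nbhs_ballP[r /= r0 hr]; exists (Num.min r 1) => [|x x0].
  by rewrite lt_min r0 ltr01 ge_min lexx orbT.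
rewrite lt_min => /andP[xr _]; apply: hr => //.
by rewrite /ball/= sub0r normrN gtr0_norm.
Qed.

Lemma sigma0_growth_ge (g : R) : 0 <= g < 2 ->
  (0 < limf_einf (fun x : R => (sigma0 sigma x / x `^ g)%:E) 0^'+)%E ->
  exists2 gam, 1 < gam < 2 & forall b, 0 < b ->
    exists2 c, 0 < c & forall x, 0 < x -> x <= b -> c * x `^ gam <= sigma0 sigma x.
Proof.
move=> /andP[g0 g2]; rewrite limf_einfE => /ereal_sup_gt[_ [V /near0_right[e /andP[e0 e1] hV] <-]].
move=> hinf.
have [c0 c00 hc0] : exists2 c, 0 < c & forall x, 0 < x -> x < e -> c * x `^ g <= sigma0 sigma x.
  pose S := [set (sigma0 sigma x / x `^ g)%:E | x in V].
  have lb x : 0 < x -> x < e -> (ereal_inf S <= (sigma0 sigma x / x `^ g)%:E)%E.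
    by move=> x0 xe; apply: ereal_inf_lbound; exists x => //; exact: hV.
  have fin : ereal_inf S \is a fin_num.
    rewrite fin_numE gt_eqF ?(lt_trans _ hinf)//=.
    rewrite lt_eqF// (le_lt_trans (lb (e / 2) _ _))// ?ltry//; first by rewrite divr_gt0.
    by rewrite ltr_pdivrMr// ltr_pMr// ltr1n.
  exists (fine (ereal_inf S)); first by rewrite fine_gt0// hinf/= ltey_eq fin.
  move=> x x0 xe; rewrite -ler_pdivlMr ?powR_gt0//.
  by rewrite -lee_fin fineK//; exact: lb.
(* The test function in the exit estimate needs [2 - gam] strictly between 0 and 1; the value 3 / 2
   is an arbitrary point of []1, 2[]. *)
exists (Num.max g (3 / 2)); first by rewrite lt_max gt_max g2/=; lra.
set gam := Num.max _ _ => b b0.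
have gam0 : 0 <= gam by rewrite /gam le_max g0.
have ge_gam : g <= gam by rewrite /gam le_max lexx.
pose h := e / 2; have h0 : 0 < h by rewrite divr_gt0.
have he : h < e by rewrite /h; lra.
pose s := sigma0 sigma h.
have s0 : 0 < s by apply: lt_le_trans (hc0 _ h0 he); rewrite mulr_gt0// powR_gt0.
have bg : 0 < b `^ gam by rewrite powR_gt0.
exists (Num.min c0 (s / b `^ gam)); first by rewrite lt_min c00 divr_gt0.
move=> x x0 xb; have [xe|ex] := ltP x e.
  apply: le_trans (hc0 x x0 xe); apply: ler_pM => //.
  - by rewrite le_min ltW//= ltW// divr_gt0.
  - exact: powR_ge0.
  - by rewrite ge_min lexx.
  - by apply: ger_powR => //; rewrite x0/=; lra.
apply: (@le_trans _ _ s); last by apply: sigma0_mono; [exact: ltW|lra].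
apply: (@le_trans _ _ (s / b `^ gam * b `^ gam)); last by rewrite divfK// gt_eqF.
apply: ler_pM => //.
- by rewrite le_min ltW//= ltW// divr_gt0.
- exact: powR_ge0.
- by rewrite ge_min lexx orbT.
- by apply: ge0_ler_powR => //; rewrite nnegrE ltW.
Qed.

(** Near 0 the exponent may be lowered to 2 since [x < 1]; from [e] up to [b], [sigma0 b] is
    compared with [e ^ 2]. *)
Lemma sigma0_growth_le (g : R) : 2 <= g ->
  (limf_esup (fun x : R => (sigma0 sigma x / x `^ g)%:E) 0^'+ < +oo)%E ->
  forall b, 0 < b ->
    exists2 C, 0 <= C & forall x, 0 < x -> x <= b -> sigma0 sigma x <= C * x ^+ 2.
Proof.
move=> g2; rewrite limf_esupE => /ereal_inf_lt[_ [V /near0_right[e /andP[e0 e1] hV] <-]].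
move=> hsup.
have [C0 C00 hC0] : exists2 C, 0 <= C & forall x, 0 < x -> x < e -> sigma0 sigma x <= C * x ^+ 2.
  pose S := [set (sigma0 sigma x / x `^ g)%:E | x in V].
  have ub x : 0 < x -> x < e -> ((sigma0 sigma x / x `^ g)%:E <= ereal_sup S)%E.
    by move=> x0 xe; apply: ereal_sup_ubound; exists x => //; exact: hV.
  have h0 : 0 < e / 2 by rewrite divr_gt0.
  have he : e / 2 < e by lra.
  have S0 : (0 <= ereal_sup S)%E.
    apply: le_trans (ub _ h0 he); rewrite lee_fin divr_ge0 ?powR_ge0//.
    by apply: sigma0_ge0; exact: ltW.
  have fin : ereal_sup S \is a fin_num by rewrite ge0_fin_numE.
  exists (fine (ereal_sup S)); first by rewrite fine_ge0.
  move=> x x0 xe.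
  have : sigma0 sigma x <= fine (ereal_sup S) * x `^ g.
    by rewrite -ler_pdivrMr ?powR_gt0// -lee_fin fineK//; exact: ub.
  move=> /le_trans; apply; rewrite ler_wpM2l ?fine_ge0//.
  rewrite -powR_mulrn; last exact: ltW.
  by apply: ger_powR => //; rewrite x0/=; lra.
move=> b b0; pose s := sigma0 sigma b.
have s0 : 0 <= s by apply: sigma0_ge0; exact: ltW.
have e20 : 0 < e ^+ 2 by rewrite exprn_gt0.
exists (Num.max C0 (s / e ^+ 2)); first by rewrite le_max C00.
move=> x x0 xb; have [xe|ex] := ltP x e.
  apply: (le_trans (hC0 x x0 xe)); rewrite ler_wpM2r ?sqr_ge0//.
  by rewrite le_max lexx.
apply: (@le_trans _ _ s); first by apply: sigma0_mono => //; exact: ltW.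
apply: (@le_trans _ _ (s / e ^+ 2 * e ^+ 2)); first by rewrite divfK// gt_eqF.
apply: ler_pM; [by rewrite divr_ge0// ltW|exact: ltW|by rewrite le_max lexx orbT|].
by rewrite lerXn2r// nnegrE ltW.
Qed.

End Sigma0.

(** * The total mass process *)

Section Evaluation.
Context {R : realType}.

Lemma pairing_continuous (f : R -> R) : continuous f -> [bounded f x | x in [set: R]] ->
  continuous (fun m : MR R => \int[m]_x f x).
Proof.
move=> cf bf m; pose g : bounded_continuous R := exist _ f (conj cf bf).
apply: (@continuous_comp (MR R) {ptws bounded_continuous R -> R} R
  (@pairing R) (fun h => h g)); first exact: initial_continuous.
exact: proj_continuous.
Qed.

Context {d : measure_display} {Omega : measurableType d}.
Variable F : R -> set_system Omega.

Lemma Fm_rays (t : R) (f : Omega -> R) : (forall a, F t [set w | a < f w]) -> Fm F t f.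
Proof.
move=> h; apply: (@measurability _ _ (g_sigma_algebraType (F t)) R setT f (@RGenOInfty.G R)).
  exact: RGenOInfty.measurableE.
move=> _ [_ [a ->] <-]; rewrite setTI; apply: sub_sigma_algebra.
rewrite (_ : _ @^-1` _ = [set w | a < f w]); first exact: h.
by apply/seteqP; split => w /=; rewrite in_itv/= andbT.
Qed.

Lemma Fm_pairing (X : R -> Omega -> MR R) (f : R -> R) t : continuous f -> [bounded f x | x in [set: R]] ->
  (forall B : set (MR R), <<s open >> B -> F t (X t @^-1` B)) ->
  Fm F t (fun w => \int[X t w]_x f x).
Proof.
move=> cf bf aX; apply: Fm_rays => a.
have := aX [set m : MR R | a < \int[m]_x f x]; apply; apply: sub_sigma_algebra.
have /continuousP/(_ `]a, +oo[%classic) h := pairing_continuous cf bf.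
rewrite (_ : [set m | _] = (fun m : MR R => \int[m]_x f x) @^-1` `]a, +oo[%classic).
  by apply: h; exact: interval_open.
by apply/seteqP; split => m /=; rewrite in_itv/= andbT.
Qed.

End Evaluation.

Section MassProcess.
Context {R : realType} {d : measure_display} {Omega : measurableType d}.
Variables (P : probability Omega R) (F : R -> set_system Omega).
Hypothesis usualF : usual_conditions P F.
Variable sigma : R -> R.
Hypothesis sigma_ge0 : forall u, 0 <= u -> 0 <= sigma u.
Hypothesis sigma_borel : measurable_fun (`[0, +oo[ : set R) sigma.
Hypothesis sigma_bounded : forall n : nat, (1 <= n)%N ->
  [bounded sigma u | u in `[0, n%:R]%classic].
Variable mu : finite_measureR R.
Variable X : R -> Omega -> MR R.
Hypothesis X_ISBM : interacting_superBM P F sigma X.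
Hypothesis X0 : {ae P, forall w, forall B : set R, measurable B -> X 0 w B = mu B}.
Local Notation leb := (@lebesgue_measure R).

(** [true] gives the cosine and [false] the sine. Frequency 0 with [true] is the constant 1, so the
    total mass is one of the waves and shares their lemmas. *)
Definition wave (k : nat) (c : bool) : R -> R := trig k%:R c%:R (~~ c)%:R.

Let bracket k c := ISBM_bracket sigma X (wave k c).

Let regular_bracket k c w :=
  [/\ {within `[0, +oo[, continuous (fun t => bracket k c t w)},
        bracket k c 0 w = 0 & forall s t, 0 <= s -> s <= t -> bracket k c s w <= bracket k c t w].

(** Only the countably many waves are asked to have regular brackets, so that these paths have full
    measure. *)
Definition good w :=
  [/\ {within `[0, +oo[, continuous (fun t => X t w)},
      (forall B : set R, measurable B -> X 0 w B = mu B) &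
      forall k c, regular_bracket k c w].

Lemma ae_good : {ae P, forall w, good w}.
Proof.
have [_ cX hX] := X_ISBM.
have hk k c : {ae P, forall w, regular_bracket k c w}.
  have [_ [_ h1 h2 _]] := hX _ (C2b_trig k%:R c%:R (~~ c)%:R).
  by apply: filterS2 h1 h2 => w ? [].
have hT : {ae P, forall w, forall k, regular_bracket k true w}.
  by apply: ae_foralln => k; exact: hk.
have hF : {ae P, forall w, forall k, regular_bracket k false w}.
  by apply: ae_foralln => k; exact: hk.
by apply: filterS3 (filterI cX X0) hT hF => w [h1 h2] h3 h4; split => // k [|].
Qed.

Lemma wave_bound k c x : `|wave k c x| <= 1.
Proof.
rewrite (le_trans (trig_bound _ _ _ _))//.
by case: c; rewrite /= ?normr1 ?normr0 ?addr0 ?add0r.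
Qed.

Lemma wave_continuous k c : continuous (wave k c).
Proof. exact: trig_continuous. Qed.

Lemma wave_bounded k c : [bounded wave k c x | x in [set: R]].
Proof. exact: trig_bounded. Qed.

Lemma wave_cos k x : wave k true x = cos (k%:R * x).
Proof. by rewrite /wave /trig/= mul1r mul0r addr0. Qed.

Lemma wave_sin k x : wave k false x = sin (k%:R * x).
Proof. by rewrite /wave /trig/= mul1r mul0r add0r. Qed.

Lemma wave0 x : wave 0 true x = 1.
Proof. by rewrite wave_cos mul0r cos0. Qed.

Lemma bmf_wave k c : bmf (wave k c : measurableTypeR R -> R).
Proof.
split; last by exists 1; exact: wave_bound.
exact: continuous_measurable_fun (@wave_continuous k c).
Qed.

Lemma int_wave_bound (m : finite_measureR R) k c : `|\int[m]_x wave k c x| <= mass m.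
Proof.
have i1 := bmf_integrable m (bmf_wave k c).
apply: (le_trans (le_normr_Rintegral _ i1)) => //.
rewrite -[leRHS]mul1r -int_cst; apply: le_Rintegral => //.
- exact/bmf_integrable/bmf_norm/bmf_wave.
- exact/bmf_integrable/bmf_cst.
- by move=> x _; exact: wave_bound.
Qed.

Lemma int_wave0 (m : finite_measureR R) : \int[m]_x wave 0 true x = mass m.
Proof.
rewrite -[RHS]mul1r -int_cst; congr (Rintegral _ _ _).
by apply/funext => x; rewrite wave0.
Qed.

(* Values at negative times and off the full-measure event [good] are chosen so
   that the regularity of the paths holds everywhere. *)
Definition wave_int k c t w : R :=
  if `[< good w >] then \int[X (Num.max 0 t) w]_x wave k c x else \int[mu]_x wave k c x.

Lemma wave_int_good k c t w : good w -> 0 <= t -> wave_int k c t w = \int[X t w]_x wave k c x.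
Proof. by move=> gw t0; rewrite /wave_int; case: asboolP => // _; rewrite max_r. Qed.

Lemma wave_int0 k c w : wave_int k c 0 w = \int[mu]_x wave k c x.
Proof.
rewrite /wave_int; case: asboolP => // gw; rewrite maxxx; have [_ h _] := gw.
rewrite /Rintegral; congr fine; apply: eq_measure_integral => A mA _; exact: h.
Qed.

Lemma wave_int_continuous k c w : continuous (wave_int k c ^~ w).
Proof.
rewrite /wave_int; case: asboolP => [gw|_]; last by move=> t; exact: cvg_cst.
have [cX _ _] := gw.
apply: (@continuous_max0 R (fun t => \int[X t w]_x wave k c x)).
apply/subspace_continuousP => t t0; move/subspace_continuousP : cX => /(_ t t0) ct.
have hp : {for X t w, continuous (fun m : MR R => \int[m]_x wave k c x)}.
  by apply: pairing_continuous; [exact: wave_continuous|exact: wave_bounded].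
exact: (cvg_comp (X^~ w) (fun m : MR R => \int[m]_x wave k c x) ct hp).
Qed.

Lemma wave_int_Fm k c (t : R) : 0 <= t -> Fm F t (wave_int k c t).
Proof.
move=> t0; have [aX _ _] := X_ISBM.
have h := @Fm_pairing _ _ _ F X _ t (@wave_continuous k c) (wave_bounded k c) (aX t t0).
have e : {ae P, forall w, wave_int k c t w = \int[X t w]_x wave k c x}.
  by apply: filterS ae_good => w gw; rewrite wave_int_good.
exact: (Fm_ae usualF t0 h e).
Qed.

Lemma wave_int_bound k c t w : `|wave_int k c t w| <= wave_int 0 true t w.
Proof. by rewrite /wave_int; case: asboolP => _; rewrite int_wave0; exact: int_wave_bound. Qed.

Let M k c := ISBM_martingale X (wave k c).
Let M2 k c t w := (M k c t w - M k c 0 w) ^+ 2 - bracket k c t w.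

Let M_loc k c : continuous_local_martingale P F (M k c).
Proof. by have [_ _ h] := X_ISBM; have [] := h _ (C2b_trig k%:R c%:R (~~ c)%:R). Qed.

Let M2_loc k c : continuous_local_martingale P F (M2 k c).
Proof. by have [_ _ h] := X_ISBM; have [_ []] := h _ (C2b_trig k%:R c%:R (~~ c)%:R). Qed.

(** A version of [ISBM_martingale] for the wave: its second derivative is [- k ^ 2] times itself, so
    the drift is a multiple of the primitive of the process itself, as the energy estimate
    requires. *)
Definition wave_mart k c t w : R :=
  wave_int k c t w - wave_int k c 0 w + k%:R ^+ 2 / 2 * sint (wave_int k c ^~ w) 0 (Num.max 0 t).

Definition wave_qv k c t w : R := if `[< good w >] then bracket k c (Num.max 0 t) w else 0.

Lemma wave_mart0 k c w : wave_mart k c 0 w = 0.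
Proof. by rewrite /wave_mart maxxx sintxx subrr mulr0 addr0. Qed.

Lemma wave_mart_continuous k c w : continuous (wave_mart k c ^~ w).
Proof.
move=> t; apply: cvgD; first by apply: cvgB; [exact: wave_int_continuous|exact: cvg_cst].
apply: cvgM; first exact: cvg_cst.
have h := @sint_prim_continuous R _ (@wave_int_continuous k c w).
exact: h.
Qed.

Lemma wave_mart_martingale k c t w : good w -> 0 <= t -> wave_mart k c t w = M k c t w.
Proof.
move=> gw t0.
have e2 : (wave k c)^`(2)%classic = fun x => - k%:R ^+ 2 * wave k c x.
  by apply/funext => x; rewrite derive2_trig.
rewrite /wave_mart /M /ISBM_martingale !wave_int_good// max_r// e2.
congr (_ + _); rewrite sintZ; last exact: wave_int_continuous.
rewrite -mulrN -[X in _ * - X]/(sint (fun s => \int[X s w]_x (- k%:R ^+ 2 * wave k c x)) 0 t).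
have -> : sint (fun s => \int[X s w]_x (- k%:R ^+ 2 * wave k c x)) 0 t =
    sint (fun s => - k%:R ^+ 2 * wave_int k c s w) 0 t.
  apply: eq_Rintegral => s; rewrite inE/= in_itv/= => /andP[s0 _].
  by rewrite wave_int_good// -RintegralZl//; exact/bmf_integrable/bmf_wave.
rewrite -!sintZ; [|exact: wave_int_continuous|exact: wave_int_continuous].
by ring.
Qed.

Lemma ISBM_wave0 k c w : good w -> M k c 0 w = 0.
Proof. by move=> gw; rewrite -wave_mart_martingale// wave_mart0. Qed.

Lemma wave_qv_good k c t w : good w -> 0 <= t -> wave_qv k c t w = bracket k c t w.
Proof. by move=> gw t0; rewrite /wave_qv asboolT// max_r. Qed.

Lemma wave_qv0 k c w : wave_qv k c 0 w = 0.
Proof. by rewrite /wave_qv; case: asboolP => // -[_ _ h]; have [_ + _] := h k c; rewrite maxxx. Qed.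

Lemma wave_qv_continuous k c w : continuous (wave_qv k c ^~ w).
Proof.
rewrite /wave_qv; case: asboolP => [gw|_]; last by move=> t; exact: cvg_cst.
have [_ _ h] := gw; have [h1 _ _] := h k c.
exact: (@continuous_max0 R (fun t => bracket k c t w)).
Qed.

Lemma ae_NM k c : {ae P, forall w, forall t, 0 <= t -> wave_mart k c t w = M k c t w}.
Proof. by apply: filterS ae_good => w gw t t0; exact: wave_mart_martingale. Qed.

Lemma ae_NM2 k c : {ae P, forall w, forall t, 0 <= t -> wave_mart k c t w ^+ 2 - wave_qv k c t w = M2 k c t w}.
Proof.
apply: filterS ae_good => w gw t t0.
by rewrite wave_qv_good// wave_mart_martingale// /M2 ISBM_wave0// subr0.
Qed.

Section Level.
Variables (b L : R).
Hypothesis b_ge0 : 0 <= b.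
Hypothesis hL : forall u, 0 <= u <= b -> 0 <= sigma u <= L.

Lemma inner_bound (m : finite_measureR R) k c : mass m <= b ->
  0 <= \int[m]_x (sigma (fine (m `]-oo, x]%classic)) * wave k c x ^+ 2) <= L * b.
Proof.
move=> mb.
have hin x : 0 <= sigma (fine (m `]-oo, x]%classic)) <= L.
  by apply: hL; have /andP[-> h] := dfun_bounds m x; rewrite (le_trans h).
have w2 x : 0 <= wave k c x ^+ 2 <= 1.
  by rewrite sqr_ge0 -[_ ^+ 2]ger0_norm ?sqr_ge0// normrX expr_le1// wave_bound.
have L0 : 0 <= L by have /andP[h1 h2] := hin 0; exact: le_trans h2.
have /andP[-> h] : 0 <= \int[m]_x (sigma (fine (m `]-oo, x]%classic)) * wave k c x ^+ 2) <= L * fine (m setT).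
  apply: Rintegral_lower_bound => //; first by rewrite -ge0_fin_numE ?fmu.
  move=> x _; have /andP[a1 a2] := hin x; have /andP[a3 a4] := w2 x.
  by rewrite mulr_ge0//= -[L]mulr1 ler_pM.
by rewrite (le_trans h)//= ler_wpM2l.
Qed.

Lemma bracket_bound k c t w : 0 <= t -> (forall s, 0 <= s <= t -> mass (X s w) <= b) ->
  0 <= bracket k c t w <= L * b * t.
Proof.
move=> t0 hb; rewrite /bracket /ISBM_bracket.
have -> : L * b * t = L * b * fine (leb `[0, t]%classic).
  rewrite lebesgue_measure_itv/= lte_fin; move: t0; rewrite le_eqVlt => /predU1P[<-|->]/=.
    by rewrite ltxx/=.
  by rewrite subr0.
have fin : (leb (`[0%R, t] : set R) < +oo)%E.
  by rewrite lebesgue_measure_itv/=; case: ifP => // _; exact: ltry.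
apply: Rintegral_lower_bound => //.
by move=> s /=; rewrite in_itv/= => st; apply: inner_bound; exact: hb.
Qed.

Variable t0 : R.
Hypothesis t0_ge0 : 0 <= t0.
Hypothesis mub : mass mu <= b.

Let T := hit (fun t w => wave_int 0 true t w - b) t0.

Let cY' v : continuous (fun t => wave_int 0 true t v - b).
Proof. by move=> s; apply: cvgB; [exact: wave_int_continuous|exact: cvg_cst]. Qed.

Let wave_int_le w t : 0 <= t -> t <= T w -> wave_int 0 true t w <= b.
Proof.
move=> h0 hT; rewrite -subr_le0.
by apply: (hit_le_npos cY' t0_ge0) => //; rewrite wave_int0 int_wave0 subr_le0.
Qed.

(** [energy_le] at the rate [c = k.+1 ^ 2 / 2]. Up to [T] the mass, hence every wave, is at most
    [b], and the quadratic variation is at most [L * b * t0]. *)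
Lemma wave_energy k c : bmf (fun w => sint (fun t => wave_int k.+1 c t w ^+ 2) 0 (T w)) /\
  Ex P (fun w => sint (fun t => wave_int k.+1 c t w ^+ 2) 0 (T w)) <= (b ^+ 2 + 2 * (L * b * t0)) * (k.+1%:R ^+ 2)^-1.
Proof.
have kp : 0 < k.+1%:R ^+ 2 :> R by rewrite exprn_gt0.
have L0 : 0 <= L.
  have /andP[h1 h2] : 0 <= sigma 0 <= L by apply: hL; rewrite lexx.
  exact: le_trans h2.
have [bI hI] : bmf (fun w => sint (fun t => wave_int k.+1 c t w ^+ 2) 0 (T w)) /\
  2 * (k.+1%:R ^+ 2 / 2) * Ex P (fun w => sint (fun t => wave_int k.+1 c t w ^+ 2) 0 (T w)) <= b ^+ 2 + 2 * (L * b * t0).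
  apply: (energy_le usualF (N := wave_mart k.+1 c) (Q := wave_qv k.+1 c) (M := M k.+1 c) (M2 := M2 k.+1 c) (t0 := t0)) => //.
  - exact: wave_int_continuous.
  - exact: wave_mart_continuous.
  - exact: wave_qv_continuous.
  - exact: wave_int_Fm.
  - exact: wave_mart0.
  - exact: wave_qv0.
  - exact: ae_NM.
  - exact: ae_NM2.
  - apply: (hit_rtime usualF) => // t tge; apply: measurable_funB; [exact: wave_int_Fm|exact: measurable_cst].
  - by move=> w; exact: hit_le.
  - by move=> w t h0 hT; apply: (le_trans (wave_int_bound _ _ _ _)); exact: wave_int_le.
  - move=> w t h0 hT; rewrite /wave_qv; case: asboolP => gw; last by rewrite lexx !mulr_ge0.
    rewrite max_r//; have [|-> /= h] := andP (@bracket_bound k.+1 c t w h0 _).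
      move=> s /andP[s0 st]; rewrite -int_wave0 -wave_int_good//; apply: wave_int_le => //.
      exact: le_trans hT.
    by rewrite (le_trans h)// ler_wpM2l ?mulr_ge0// (le_trans hT)// hit_le.
  - by move=> w t h0 hT; rewrite /wave_mart max_r.
split => //; rewrite ler_pdivlMr// mulrC; apply: le_trans hI.
by rewrite [2 * _]mulrC divfK.
Qed.

(** [ae_bounded_sum] is used twice: over [Omega] for the energies integrated in time, then over time
    on a fixed path. Frequencies start at 1 because frequency 0 has no drift. *)
Lemma ae_decay c : {ae P, forall w, {ae leb, forall s, `[0, T w]%classic s -> wave_int k.+1 c s w @[k --> \oo] --> (0 : R)}}.
Proof.
pose B := b ^+ 2 + 2 * (L * b * t0).
have B0 : 0 <= B.
  have /andP[h1 h2] : 0 <= sigma 0 <= L by apply: hL; rewrite lexx.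
  by rewrite addr_ge0 ?sqr_ge0// !mulr_ge0// (le_trans h1).
pose I k w := sint (fun t => wave_int k.+1 c t w ^+ 2) 0 (T w).
have cY2 k w : continuous (fun t => wave_int k.+1 c t w ^+ 2).
  by move=> s; apply: cvgM; exact: wave_int_continuous.
have H : {ae P, forall w, setT w -> exists B', forall n, \sum_(0 <= k < n) I k w <= B'}.
  apply: (@ae_bounded_sum _ _ _ P setT I (B * 2)) => //.
  - by move=> k; apply: bmf_int; have [] := wave_energy k c.
  - by move=> k w _; apply: Rintegral_ge0 => s _; exact: sqr_ge0.
  - move=> n; apply: (@le_trans _ _ (\sum_(0 <= k < n) B * (k.+1%:R ^+ 2)^-1)).
      by apply: ler_sum => k _; have [] := wave_energy k c.
    by rewrite -mulr_sumr ler_wpM2l// sum_invsq.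
apply: filterS H => w /(_ Logic.I)[B' hB'].
have : {ae leb, forall s, `[0, T w]%classic s -> exists B', forall n, \sum_(0 <= k < n) wave_int k.+1 c s w ^+ 2 <= B'}.
  apply: (@ae_bounded_sum _ _ _ leb _ (fun k s => wave_int k.+1 c s w ^+ 2) B') => //.
  - by move=> k; exact: sint_integrable.
  - by move=> k s _; exact: sqr_ge0.
apply: (@filterS _ _ (ae_filter_ringOfSetsType leb)) => s h /h[B2 hB2].
have sq : wave_int k.+1 c s w ^+ 2 @[k --> \oo] --> (0 : R).
  by apply: (bounded_sum_cvg0 _ hB2) => k; exact: sqr_ge0.
apply/cvgrPdist_lt => e e0.
move/cvgrPdist_lt : sq => /(_ (e ^+ 2)); rewrite exprn_gt0// => /(_ isT).
apply: filterS => k; rewrite !sub0r !normrN normrX => h'.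
by rewrite -(ltr_pXn2r (ltn0Sn 1)) ?nnegrE// ltW.
Qed.

Lemma ae_no_atom_level : {ae P, forall w, {ae leb, forall s, `[0, T w]%classic s -> forall x, X s w [set x] = 0%E}}.
Proof.
apply: filterS3 ae_good (ae_decay true) (ae_decay false) => w gw h1 h2.
apply: (@filterS2 _ _ (ae_filter_ringOfSetsType leb) _ _ _ _ h1 h2) => s k1 k2 hs.
have s0 : 0 <= s by move: hs; rewrite /= in_itv/= => /andP[].
apply: no_atom; rewrite -cvg_shiftS.
  apply: cvg_trans (k1 hs); apply: near_eq_cvg; near=> n.
  by rewrite wave_int_good//; congr (Rintegral _ _ _); apply/funext => x; rewrite wave_cos.
apply: cvg_trans (k2 hs); apply: near_eq_cvg; near=> n.
by rewrite wave_int_good//; congr (Rintegral _ _ _); apply/funext => x; rewrite wave_sin.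
Unshelve. all: by end_near. Qed.

End Level.

(** Horizons [n] and levels [b] are integers, so one null set of paths suffices. For a given path
    and [n], a level above the mass on [[0, n]] makes the hitting time equal to [n]. *)
Lemma ae_no_atom :
  {ae P, forall w, {ae leb, forall s, 0 <= s -> forall x, X s w [set x] = 0%E}}.
Proof.
have H : {ae P, forall w, forall n b : nat, mass mu <= b%:R ->
    {ae leb, forall s, `[0, hit (fun t w => wave_int 0 true t w - b%:R) n%:R w]%classic s ->
       forall x, X s w [set x] = 0%E}}.
  apply: ae_foralln => n; apply: ae_foralln => b.
  have [mb|mb] := leP (mass mu) b%:R; last first.
    by apply: aeW => w h; move: mb; rewrite ltNge h.
  have [L _ hL] := sigma_bound sigma_ge0 sigma_bounded b%:R.
  have h := @ae_no_atom_level b%:R L (ler0n _ b) hL n%:R (ler0n _ n) mb.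
  by apply: filterS h => w h' _.
apply: filterS H => w h.
have hn : {ae leb, forall s, forall n : nat, `[0, n%:R]%classic s -> forall x, X s w [set x] = 0%E}.
  apply: ae_foralln => n.
  have [b mb hb] := U_bounded (mass mu) (@wave_int_continuous 0 true) w (ler0n R n).
  have {h} := h n b (ltW mb).
  have cY' v : continuous (fun t => wave_int 0 true t v - b%:R).
    by move=> s; apply: cvgB; [exact: wave_int_continuous|exact: cvg_cst].
  suff -> : hit (fun t w => wave_int 0 true t w - b%:R) n%:R w = n%:R by [].
  apply/eqP; rewrite eq_le hit_le//= leNgt; apply/negP => hlt.
  have := hit_lt_end cY' (ler0n R n) hlt; rewrite subr_ge0 leNgt hb//.
  by rewrite hit_ge0//= ltW.
apply: (@filterS _ _ (ae_filter_ringOfSetsType leb) _ _ _ hn) => s h' s0.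
by apply: (h' (Num.truncn s).+1); rewrite /= in_itv/= s0 ltW// truncnS_gt.
Qed.

Let U := wave_int 0 true.
Let m := mass mu.
Let S w s := sigma0 sigma (Num.max 0 (U s w)).
Let V t w := sint (S w) 0 (Num.max 0 t).

Let S_continuous w : continuous (S w).
Proof.
move=> s; apply: (@continuous_comp R R R (U^~ w) (fun x => sigma0 sigma (Num.max 0 x)) s).
  exact: wave_int_continuous.
exact: sigma0_continuous.
Qed.

Let U_ge0 t w : 0 <= U t w.
Proof. exact: le_trans (normr_ge0 _) (wave_int_bound 0 true t w). Qed.

Let SE w s : S w s = sigma0 sigma (U s w).
Proof. by rewrite /S max_r. Qed.

Let U0 w : U 0 w = m. Proof. by rewrite /U wave_int0 int_wave0. Qed.

Let UM : {ae P, forall w, forall t, 0 <= t -> U t w - m = M 0 true t w}.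
Proof.
apply: filterS (ae_NM 0 true) => w h t t0.
by rewrite -h// /wave_mart -/U U0 expr0n/= mul0r mul0r addr0.
Qed.

(** At an atomless time, [integral_dfun] turns the inner integral into [sigma0 (U s)]. The other
    times lie in a Lebesgue null set, which the comparison of lower integrals ignores. *)
Let bracket_one w : good w -> {ae leb, forall s, 0 <= s -> forall x, X s w [set x] = 0%E} ->
  forall t, 0 <= t -> bracket 0 true t w = V t w.
Proof.
move=> gw [A [mA A0 hA]] t t0; rewrite /V max_r// /bracket /ISBM_bracket /sint /Rintegral; congr fine.
have in_ge0 (s : R) : 0 <= \int[X s w]_x (sigma (fine (X s w `]-oo, x]%classic)) * wave 0 true x ^+ 2).
  apply: Rintegral_ge0 => x _; rewrite mulr_ge0 ?sqr_ge0// sigma_ge0//.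
  by rewrite fine_ge0.
apply: (@ge0_ae_eq_integral_lower _ _ _ leb _ A) => //.
- by move=> s _; rewrite lee_fin; exact: in_ge0.
- by move=> s _; rewrite lee_fin SE sigma0_ge0.
move=> s /=; rewrite in_itv/= => /andP[s0 _] As.
have na : forall x, X s w [set x] = 0%E.
  by apply: contrapT => nx; apply: As; apply: hA => /= h; apply: nx; exact: h.
congr EFin; rewrite SE /U wave_int_good// int_wave0 -(integral_dfun na sigma_ge0 sigma_borel).
by congr (Rintegral _ _ _); apply/funext => x; rewrite wave0 expr1n mulr1.
Qed.

Let UM2 : {ae P, forall w, forall t, 0 <= t -> (U t w - m) ^+ 2 - V t w = M2 0 true t w}.
Proof.
apply: filterS3 ae_good ae_no_atom UM => w gw na um t t0.
by rewrite um// /M2 ISBM_wave0// subr0 bracket_one.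
Qed.

Let cV w : continuous (V^~ w).
Proof. exact: (@sint_prim_continuous R (S w) (@S_continuous w)). Qed.

Let V0 w : V 0 w = 0. Proof. by rewrite /V maxxx sintxx. Qed.

Let V_ge w (s t lo : R) : 0 <= s -> s <= t -> 0 <= lo ->
  (forall r, s <= r <= t -> lo <= U r w) -> sigma0 sigma lo * (t - s) <= V t w - V s w.
Proof.
move=> s0 st lo0 h; rewrite /V !max_r//; last exact: le_trans st.
rewrite (sint_diff (@S_continuous w) s0 st) -(sint_cst _ st); apply: sint_mono; [by move=> x; exact: cvg_cst|exact: S_continuous|].
by move=> r /h; rewrite SE; exact: sigma0_mono.
Qed.

Let V_le w (s t hi : R) : 0 <= s -> s <= t ->
  (forall r, s <= r <= t -> U r w <= hi) -> V t w - V s w <= sigma0 sigma hi * (t - s).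
Proof.
move=> s0 st h; rewrite /V !max_r//; last exact: le_trans st.
rewrite (sint_diff (@S_continuous w) s0 st) -(sint_cst _ st); apply: sint_mono; [exact: S_continuous|by move=> x; exact: cvg_cst|].
by move=> r /h; rewrite SE; exact: sigma0_mono.
Qed.

Hypothesis mu_gt0 : (0 < mu setT)%E.

Let m_gt0 : 0 < m.
Proof. by rewrite fine_gt0// mu_gt0/= ltey_eq fmu. Qed.

Let good_mass w t : good w -> 0 <= t -> (X t w setT = 0%E) <-> U t w = 0.
Proof.
move=> gw t0; rewrite /U wave_int_good// int_wave0 /mass; split => [->//|h].
by rewrite -[LHS](fineK (fmu (X t w) measurableT)) h.
Qed.

Lemma extinction (g : R) : 0 <= g < 2 ->
  (0 < limf_einf (fun x : R => (sigma0 sigma x / x `^ g)%:E) 0^'+)%E ->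
  {ae P, forall w, exists2 t, 0 <= t & forall s, t <= s -> X s w setT = 0%E}.
Proof.
move=> g02 hg; have [gam gam12 hgam] := sigma0_growth_ge sigma_ge0 sigma_borel sigma_bounded g02 hg.
have S0 x : 0 <= x -> 0 <= sigma0 sigma x by exact: sigma0_ge0.
have h1 := extinct_ae usualF m_gt0 (@wave_int_continuous 0 true) U0 U_ge0 (M_loc 0 true) UM
  (M2_loc 0 true) UM2 cV V0 S0 V_ge V_le gam12 hgam.
have h2 := absorbed_ae usualF m_gt0 (@wave_int_continuous 0 true) U0 U_ge0 (M_loc 0 true) UM.
apply: filterS3 ae_good h1 h2 => w gw [t t0 ht] ab; exists t => // s ts.
by apply/good_mass => //; [exact: le_trans ts|exact: ab ht].
Qed.

Lemma persistence (g : R) : 2 <= g ->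
  (limf_esup (fun x : R => (sigma0 sigma x / x `^ g)%:E) 0^'+ < +oo)%E ->
  {ae P, forall w, forall t, 0 <= t -> (0 < X t w setT)%E}.
Proof.
move=> g2 hg; have hgam := sigma0_growth_le sigma_ge0 sigma_borel sigma_bounded g2 hg.
have S0 x : 0 <= x -> 0 <= sigma0 sigma x by exact: sigma0_ge0.
have h1 := positive_ae usualF m_gt0 (@wave_int_continuous 0 true) U0 U_ge0 (M_loc 0 true) UM
  (M2_loc 0 true) UM2 cV V0 S0 V_ge V_le hgam.
apply: filterS2 ae_good h1 => w gw h t t0.
rewrite lt_neqAle measure_ge0 andbT eq_sym; apply/eqP => Xt0.
by have := h t t0; rewrite -/U (proj1 (good_mass gw t0) Xt0) ltxx.
Qed.

End MassProcess.

(** * From almost sure statements on paths to the extinction time *)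

Theorem theorem3p5 (R : realType) (d : measure_display)
    (Omega : measurableType d) (P : probability Omega R)
    (F : R -> set_system Omega) (usualF : usual_conditions P F)
    (sigma : R -> R)
    (sigma_ge0 : forall u, 0 <= u -> 0 <= sigma u)
    (sigma_borel : measurable_fun (`[0, +oo[ : set R) sigma)
    (sigma_bounded : forall n : nat, (1 <= n)%N ->
       [bounded sigma u | u in `[0, n%:R]%classic])
    (sigma_neq0 : lebesgue_measure [set u : R | 0 <= u /\ sigma u = 0] = 0%E)
    (mu : finite_measureR R) (mu_gt0 : (0 < mu [set: R])%E)
    (X : R -> Omega -> MR R)
    (X_ISBM : interacting_superBM P F sigma X)
    (X0 : {ae P, forall w, forall B : set R, measurable B -> X 0 w B = mu B}) :
  ((exists gamma1 : R, 0 <= gamma1 < 2 /\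
      (0 < limf_einf (fun x : R => (sigma0 sigma x / x `^ gamma1)%:E) 0^'+)%E) ->
   P [set w | (extinction_time X w < +oo)%E] = 1%E /\
   {ae P, forall w, \forall t \near +oo, X t w [set: R] = 0%E})
  /\
  ((exists gamma2 : R, 2 <= gamma2 /\
      (limf_esup (fun x : R => (sigma0 sigma x / x `^ gamma2)%:E) 0^'+ < +oo)%E) ->
   P [set w | extinction_time X w = +oo%E] = 1%E /\
   {ae P, forall w, forall t : R, 0 < t -> (0 < X t w [set: R])%E}).
Proof.
have [complP _ _ _ _] := usualF.
(* Completeness of [P] makes the complement of an almost sure event measurable, so its probability
   can be evaluated as 0. *)
have full (A : Omega -> Prop) : {ae P, forall w, A w} -> P [set w | A w] = 1%E.
  move=> aeA; have mAc : measurable (~` [set w | A w]) by exact: complP.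
  have mA : measurable [set w | A w] by rewrite -[X in measurable X]setCK; exact: measurableC.
  have /eqP := probability_setC P mAc; rewrite setCK => /eqP ->.
  by rewrite (proj1 (negligibleP _ mAc) aeA) sube0.
split=> -[g [g_bd hg]].
  have h := extinction usualF sigma_ge0 sigma_borel sigma_bounded X_ISBM X0 mu_gt0 g_bd hg.
  split.
    apply: full; apply: filterS h => w [t t0 ht].
    apply: (@le_lt_trans _ _ t%:E); last by rewrite ltry.
    by apply: ereal_inf_lbound; exists t => //; split => //; exact: ht.
  apply: filterS h => w [t t0 ht]; near=> s; apply: ht; near: s.
  by exists t; split; [exact: num_real|move=> x /ltW].
have h := persistence usualF sigma_ge0 sigma_borel sigma_bounded X_ISBM X0 mu_gt0 g_bd hg.
split; last by apply: filterS h => w h' t t0; apply: h'; exact: ltW.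
apply: full; apply: filterS h => w h'.
rewrite /extinction_time (_ : [set _ | _ in _] = set0) ?ereal_inf0//.
apply/seteqP; split => // x [t [t0 Xt0] _]; have := h' t t0.
by rewrite Xt0 ltxx.
Unshelve. all: by end_near. Qed.
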